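(* For each integer $r\geq 1$, there exists a positive integer $n(r)$ such that for all integers $n\geq n(r)$, $$(-1)^{r-1}\Delta^{r}\log p(n)<\log\left(1+\frac{\sqrt{6}\,\pi}{6}\left(\frac{1}{2}\right)_{r-1}\frac{1}{(n+1)^{r-\frac{1}{2}}}\right).$$
   Context: $p(n)$ denotes the partition function, i.e. the number of partitions of the positive integer $n$ (nonincreasing sequences of positive integers with sum $n$), with $p(0)=1$. $\Delta$ is the difference operator with respect to $n$, $\Delta f(n)=f(n+1)-f(n)$, and $\Delta^{r}$ is its $r$-fold iterate, so $\Delta^{r}\log p(n)=\sum_{k=0}^{r}(-1)^{r-k}\binom{r}{k}\log p(n+k)$. $(a)_k$ is the rising factorial: $(a)_0=1$ and $(a)_k=a(a+1)\cdots(a+k-1)$ for $k\geq 1$. *)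

(* Defs.v *)
From Stdlib Require Import Reals.
From mathcomp Require Import all_boot.

Set Implicit Arguments.
Unset Strict Implicit.
Unset Printing Implicit Defensive.

Definition is_partition (n : nat) (s : seq nat) : bool :=
  [&& sorted geq s, all (leq 1) s & sumn s == n].

(* A partition of n has at most n parts, each at most n, so nothing is lost
   by ranging over the finite type of sequences of length at most n with
   entries in 'I_n.+1; see npartP. *)
Definition npart (n : nat) : nat :=
  #|[set s : n.-bseq 'I_n.+1 | is_partition n (map val s)]|.

Lemma npartP (n : nat) : exists e : seq (seq nat),
  [/\ uniq e, forall s, (s \in e) = is_partition n s & size e = npart n].
Proof.
exists [seq map val (bseqval s) |
         s <- enum [set s : n.-bseq 'I_n.+1 | is_partition n (map val s)]].
split.
- rewrite map_inj_uniq ?enum_uniq // => s t.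
  by move/(inj_map val_inj)/val_inj.
- move=> s; apply/mapP/idP => [[t]|sP]; first by rewrite mem_enum inE => tP ->.
  have [_ s_pos /eqP s_sum] := and3P sP.
  have s_le x : x \in s -> x < n.+1.
    rewrite ltnS -s_sum; elim: {s_pos s_sum sP} s => //= y s IHs.
    rewrite inE => /orP[/eqP->|/IHs]; first exact: leq_addr.
    by move=> /leq_trans; apply; exact: leq_addl.
  have s_size : size s <= n.
    rewrite -s_sum; elim: {s_sum sP s_le} s s_pos => //= y s IHs /andP[y0 /IHs].
    by move=> ssum; rewrite -add1n leq_add.
  pose t := [seq inord x : 'I_n.+1 | x <- s].
  have t_size : size t <= n by rewrite size_map.
  have ts : map val t = s.
    by rewrite -map_comp map_id_in // => x /s_le xn /=; rewrite inordK.
  by exists (Bseq t_size); rewrite ?mem_enum ?inE /= ts.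
- by rewrite size_map -cardE.
Qed.

Local Open Scope R_scope.

Definition fdiff (f : nat -> R) : nat -> R := fun n => f n.+1 - f n.

Fixpoint rising (a : R) (k : nat) : R :=
  match k with
  | O => 1
  | S j => rising a j * (a + INR j)
  end.

(* Main.v *)
(** The circle method, carried out with real integrals and with unspecified
    coefficients.  Put [z = pi^2 / 6], [n = z / u^2] and [u = w^8].  Up to a
    truncation error, [p(n) exp(- n u)] is a Fourier coefficient of
    [exp (sum_(d, e) exp (- d e (u - i t)) / e)], and the cumulants
    [kap j] (the derivatives in [u] of the exponent at [t = 0]) have expansions
    [u^(j+1) kap j = j! z + polynomial in u + O(u^K)] for all [K]: Euler-Maclaurin
    gives [j = 1], convexity allows one to differentiate it, and integrating it
    gives [kap 0 = z / u + (ln u) / 2 + polynomial + O(u^K)].  Hence, after the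
    substitution [t = w^12 y], the part [t <= w^11] of the Fourier integral is a
    Gaussian integral with polynomial corrections, while the rest is smaller than
    any power of [w].  This yields
    [ln p(n) = 2 sqrt (z n) - ln n + polynomial in n^(-1/16) + O(n^-K)].

    In the [r]-th difference the first term contributes the main term
    [A n^(1/2 - r)] of the right-hand side, the second contributes
    [- (r-1)! n^-r], and everything else is [o(n^-r)].  The second order term of the
    right-hand side is of order [n^(1 - 2 r)]; it matters only for [r = 1], where it
    is [- pi^2 / (12 n)] and the inequality holds because [pi^2 / 12 < 1]. *)
Require Import Defs.
From HB Require Import structures.
From Stdlib Require Import Reals Lra Lia Factorial.
From Coquelicot Require Import Coquelicot.
From mathcomp Require Import all_boot zify.

Set Implicit Arguments.
Unset Strict Implicit.
Unset Printing Implicit Defensive.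

(** * A recurrence for the partition function *)

Local Open Scope nat_scope.

(** The powers of [w] come from a balance. As [kap j] has size [u^-(j+1)], the Gaussian has width
    [u^(3/2) = w^12], and in the variable [y] the term of degree [j] in [t] has size
    [w^(4 j - 8) y^j]. The cut [t = w^11], that is [y = 1 / w], leaves at most [w^(3 j - 8)], which
    tends to 0 for every [j >= 3], while beyond the cut the modulus has already dropped by a factor
    [exp (- c / w^2)]. With [u = w^8] all these exponents are integers. The double sums stay finite,
    truncated at [N]. Constants are chosen before [w], and the threshold for [N] after [w], so no
    bound has to be uniform in [N] as [w] tends to 0. The [n]-th Fourier coefficient itself is exact
    as soon as [n <= N]; only the cumulants feel the truncation. The behaviour near other roots of
    unity is never described: away from [t = 0], the terms with [e = 1] alone give the decay. *)

Fixpoint plist (f m n : nat) : seq (seq nat) :=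
  match f with
  | 0 => if n == 0 then [:: [::]] else [::]
  | f'.+1 =>
    (fix aux m := match m with
      | 0 => if n == 0 then [:: [::]] else [::]
      | m'.+1 => aux m' ++
          (if m'.+1 <= n then [seq m'.+1 :: s | s <- plist f' m'.+1 (n - m'.+1)] else [::])
      end) m
  end.

Lemma plistS0 f n : plist f 0 n = if n == 0 then [:: [::]] else [::].
Proof. by case: f. Qed.

Lemma plistSS f m n : plist f.+1 m.+1 n = plist f.+1 m n ++
  (if m.+1 <= n then [seq m.+1 :: s | s <- plist f m.+1 (n - m.+1)] else [::]).
Proof. by []. Qed.

Lemma is_partition_cons n x s : is_partition n (x :: s) =
  [&& 0 < x <= n, all (geq x) s & is_partition (n - x) s].
Proof.
rewrite /is_partition /= (path_sortedE (leT := geq)); last first.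
  by move=> a b c /= ab bc; apply: leq_trans bc ab.
case: (sorted geq s); case: (all (geq x) s); rewrite /= ?andbF //.
case: (all (leq 1) s); rewrite /= ?andbF //.
lia.
Qed.

Lemma mem_plist f m n s : n <= f ->
  (s \in plist f m n) = is_partition n s && all (geq m) s.
Proof.
elim: f m n s => [|f IHf] m n s nf.
  rewrite leqn0 in nf; rewrite (eqP nf) /= inE.
  case: s => [|x s] //; rewrite is_partition_cons /=; case: x => //.
elim: m s => [|m IHm] s.
  rewrite plistS0; case: s => [|x s].
    by rewrite /is_partition /= eq_sym; case: eqP.
  by rewrite is_partition_cons /=; case: eqP => _; case: x; rewrite ?inE //= => x; rewrite !andbF.
rewrite plistSS mem_cat IHm.
case: s => [|x s].
  rewrite /= andbT; case: is_partition => //=.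
  by case: ifP => // _; apply/negbTE/negP => /mapP[].
have mem2 : (x :: s \in (if m.+1 <= n then [seq m.+1 :: s | s <- plist f m.+1 (n - m.+1)] else [::]))
  = [&& x == m.+1, m.+1 <= n, is_partition (n - m.+1) s & all (geq m.+1) s].
  case: ifP => mn; last by rewrite /= andbF.
  have [->|xm] := eqVneq x m.+1.
    rewrite mem_map; last by move=> a b [].
    by rewrite IHf //; lia.
  by apply/negbTE/negP => /mapP[t _ [xE _]]; rewrite xE eqxx in xm.
rewrite mem2 is_partition_cons /=.
have [->|xm] := eqVneq x m.+1.
  rewrite ltnn /= andbF /= ltnSn /=.
  by case: (m < n); case: (all _ s); rewrite /= ?andbF ?andbT.
rewrite orbF.
have -> : (x <= m.+1) = (x <= m) by lia.
have [xm'|] := leqP x m; last by rewrite !andbF.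
have [/= sx|_] := boolP (all (geq x) s); last by rewrite !andbF.
have a1 : all (geq m) s by apply: sub_all sx => y /= ; lia.
have a2 : all (geq m.+1) s by apply: sub_all sx => y /= ; lia.
by rewrite a1 a2.
Qed.

Lemma uniq_plist f m n : n <= f -> uniq (plist f m n).
Proof.
elim: f m n => [|f IHf] m n nf; first by rewrite /=; case: eqP.
elim: m => [|m IHm]; first by rewrite plistS0; case: eqP.
rewrite plistSS cat_uniq IHm andTb; case: (leqP m.+1 n) => // mn.
rewrite map_inj_uniq ?IHf ?andbT; [|lia|by move=> a b []].
apply/hasPn => s /mapP[t _ ->]; rewrite mem_plist //= ltnn /= andbF.
by [].
Qed.

(** Partitions of [n] into parts at most [m]. The first argument of [plist] is fuel for a recursion
    on [n] that is not structural; fuel [n] is enough because parts are positive. *)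
Definition nparts (m n : nat) : nat := size (plist n m n).

Lemma size_plist f m n : n <= f -> size (plist f m n) = nparts m n.
Proof.
move=> nf; apply: perm_size; apply: uniq_perm; rewrite ?uniq_plist //.
by move=> s; rewrite !mem_plist.
Qed.

Lemma nparts_npart m n : n <= m -> nparts m n = npart n.
Proof.
move=> nm; have [e [ue me <-]] := npartP n.
apply: perm_size; apply: uniq_perm; rewrite ?uniq_plist // => s.
rewrite me mem_plist //; case sP : (is_partition n s) => //=.
move/and3P: sP => [_ _ /eqP sn]; apply/allP => x xs /=.
apply: leq_trans nm; rewrite -sn.
elim: {sn} s xs => //= y s IHs; rewrite inE => /orP[/eqP->|/IHs]; lia.
Qed.

Lemma nparts0 m : nparts m 0 = 1.
Proof. by rewrite /nparts /=. Qed.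

Definition shiftn (k : nat) (f : nat -> nat) (n : nat) : nat :=
  if k <= n then f (n - k) else 0.

Lemma npartsS m n : nparts m.+1 n = nparts m n + shiftn m.+1 (nparts m.+1) n.
Proof.
rewrite {1}/nparts /shiftn; case: n => [|n]; first by rewrite /= nparts0.
rewrite plistSS size_cat /=; congr (_ + _).
by case: ifP => // mn; rewrite size_map size_plist //; lia.
Qed.

Lemma shiftn_gt k f n : n < k -> shiftn k f n = 0.
Proof. by rewrite /shiftn ltnNge => /negbTE ->. Qed.

Lemma shiftn_le k f n : k <= n -> shiftn k f n = f (n - k).
Proof. by rewrite /shiftn => ->. Qed.

Lemma shiftnD k l f n : shiftn k (shiftn l f) n = shiftn (k + l) f n.
Proof.
rewrite /shiftn; case: leqP => kn; last by case: leqP => //; lia.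
have -> : (l <= n - k) = (k + l <= n) by lia.
by case: ifP => // _; congr f; lia.
Qed.

(** This is the logarithmic derivative of [prod_(d <= m) 1 / (1 - x^d)], read on coefficients. The
    induction on [m], then on [n], uses only [npartsS], that is [P_(m+1) = P_m + x^(m+1) P_(m+1)].
    The bound [B] loses nothing, since terms with [d e > n] are zero. *)
Lemma nparts_rec B m n : n <= B ->
  n * nparts m n =
  \sum_(d < m) \sum_(e < B) d.+1 * shiftn (d.+1 * e.+1) (nparts m) n.
Proof.
elim: m n => [|m IHm] n nB.
  rewrite big_ord0 /nparts; case: n {nB} => //= n; rewrite muln0 //.
elim/ltn_ind: n nB => n IHn nB.
rewrite npartsS mulnDr (IHm n nB) big_ord_recr /=.
have TE : \sum_(d < m) \sum_(e < B) d.+1 * shiftn (d.+1 * e.+1) (nparts m.+1) n =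
  \sum_(d < m) \sum_(e < B) d.+1 * shiftn (d.+1 * e.+1) (nparts m) n +
  \sum_(d < m) \sum_(e < B) d.+1 * shiftn (m.+1 + d.+1 * e.+1) (nparts m.+1) n.
  rewrite -big_split; apply: eq_bigr => d _; rewrite -big_split; apply: eq_bigr => e _.
  rewrite /= -mulnDr; congr (_ * _).
  rewrite (addnC m.+1) -shiftnD ![shiftn (d.+1 * e.+1) _ _]/shiftn.
  by case: ifP => // _; exact: npartsS.
rewrite TE -addnA; congr (_ + _).
(* For the new part size the sum over [e] is shifted by one: the first term splits off, and the
   extra term at the top vanishes because its shift exceeds [n]. *)
have SE : \sum_(e < B) m.+1 * shiftn (m.+1 * e.+1) (nparts m.+1) n =
   m.+1 * shiftn m.+1 (nparts m.+1) n +
   \sum_(e < B) m.+1 * shiftn (m.+1 + m.+1 * e.+1) (nparts m.+1) n.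
  case: B nB {IHn IHm TE} => [|B] nB.
    by rewrite !big_ord0 shiftn_gt ?muln0 //; lia.
  rewrite big_ord_recl [in RHS]big_ord_recr /= muln1; congr (_ + _).
  rewrite [X in _ = _ + X](_ : _ = 0) ?addn0; last first.
    by rewrite shiftn_gt ?muln0 //; nia.
  apply: eq_bigr => e _; congr (_ * shiftn _ _ _); by rewrite /bump /= add1n mulnS.
rewrite SE addnCA.
case: (leqP m.+1 n) => mn; last first.
  rewrite shiftn_gt // !muln0 add0n [RHS]addnC.
  rewrite !big1 // => [d _|e _]; last by rewrite shiftn_gt ?muln0 //; lia.
  by rewrite big1 // => e _; rewrite shiftn_gt ?muln0 //; lia.
rewrite shiftn_le //.
have -> : n * nparts m.+1 (n - m.+1) =
   m.+1 * nparts m.+1 (n - m.+1) + (n - m.+1) * nparts m.+1 (n - m.+1) by rewrite -mulnDl subnKC.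
congr (_ + _); rewrite IHn; try lia.
rewrite big_ord_recr /=; congr (_ + _).
  by apply: eq_bigr => d _; apply: eq_bigr => e _; rewrite -shiftnD [shiftn m.+1 _ _]shiftn_le.
by apply: eq_bigr => e _; rewrite -[in RHS]shiftnD [shiftn m.+1 _ _]shiftn_le.
Qed.

(* The recurrence of the partition function in the sigma-free form obtained by
   writing sigma(k) as a sum over the factorisations k = d e. *)
Lemma npart_rec N n : n <= N ->
  n * npart n = \sum_(d < N) \sum_(e < N) d.+1 * shiftn (d.+1 * e.+1) npart n.
Proof.
move=> nN; rewrite -(nparts_npart nN) (nparts_rec N nN).
apply: eq_bigr => d _; apply: eq_bigr => e _; congr (_ * _).
by rewrite /shiftn; case: ifP => // _; rewrite nparts_npart //; lia.
Qed.

Lemma npart0 : npart 0 = 1.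
Proof. by rewrite -(@nparts_npart 0). Qed.

(** * Fourier coefficients of exponentials of trigonometric polynomials *)

Local Open Scope R_scope.

(** * Finite sums of real numbers *)

Fact Rplus_associative : associative Rplus. Proof. by move=> x y z; ring. Qed.
Fact Rmult_Rplus_left : left_distributive Rmult Rplus. Proof. by move=> x y z; ring. Qed.
Fact Rmult_Rplus_right : right_distributive Rmult Rplus. Proof. by move=> x y z; ring. Qed.

HB.instance Definition _ :=
  Monoid.isComLaw.Build R 0 Rplus Rplus_associative Rplus_comm Rplus_0_l.
HB.instance Definition _ := Monoid.isMulLaw.Build R 0 Rmult Rmult_0_l Rmult_0_r.
HB.instance Definition _ :=
  Monoid.isAddLaw.Build R Rmult Rplus Rmult_Rplus_left Rmult_Rplus_right.

Arguments INR : simpl never.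
Arguments Z.of_nat : simpl never.
Arguments Z.opp : simpl never.

Reserved Notation "\rsum_ ( i <- s ) F"
  (at level 41, F at level 41, i, s at level 60, right associativity).
Reserved Notation "\rsum_ ( i < n ) F"
  (at level 41, F at level 41, i, n at level 60, right associativity).
Notation "\rsum_ ( i <- s ) F" := (\big[Rplus/0]_(i <- s) F) : R_scope.
Notation "\rsum_ ( i < n ) F" := (\big[Rplus/0]_(i < n) F) : R_scope.

Section FiniteSums.
Context {I : Type}.
Implicit Types (s : seq I) (F G : I -> R).

Lemma rsum_le s F G : (forall i, F i <= G i) ->
  \rsum_(i <- s) F i <= \rsum_(i <- s) G i.
Proof.
elim: s => [|i s IHs] FG; first by rewrite !big_nil; lra.
rewrite !big_cons; apply: Rplus_le_compat; first exact: FG.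
exact: IHs.
Qed.

Lemma rsum_ge0 s F : (forall i, 0 <= F i) -> 0 <= \rsum_(i <- s) F i.
Proof.
move=> F0; apply: Rle_trans (rsum_le (F := fun=> 0) s F0).
by rewrite big1 //; apply: Rle_refl.
Qed.

Lemma Rabs_rsum s F : Rabs (\rsum_(i <- s) F i) <= \rsum_(i <- s) Rabs (F i).
Proof.
elim: s => [|i s IHs]; first by rewrite !big_nil Rabs_R0; lra.
rewrite !big_cons; by apply: Rle_trans (Rabs_triang _ _) _; lra.
Qed.

Lemma Rabs_rsum_le s F G : (forall i, Rabs (F i) <= G i) ->
  Rabs (\rsum_(i <- s) F i) <= \rsum_(i <- s) G i.
Proof. by move=> FG; apply: Rle_trans (Rabs_rsum _ _) (rsum_le _ FG). Qed.

Lemma rsum_minus s F G :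
  \rsum_(i <- s) (F i - G i) = \rsum_(i <- s) F i - \rsum_(i <- s) G i.
Proof.
elim: s => [|i s IHs]; first by rewrite !big_nil; lra.
by rewrite !big_cons IHs; lra.
Qed.

Lemma is_derive_rsum s (F F' : I -> R -> R) x :
  (forall i, is_derive (F i) x (F' i x)) ->
  is_derive (fun y => \rsum_(i <- s) F i y) x (\rsum_(i <- s) F' i x).
Proof.
elim: s => [|i s IHs] dF.
  rewrite big_nil; apply: (is_derive_ext (fun=> 0)) => [y|]; first by rewrite big_nil.
  exact: is_derive_const.
rewrite big_cons.
apply: (is_derive_ext (fun y => F i y + \rsum_(j <- s) F j y)) => [y|].
  by rewrite big_cons.
apply: is_derive_plus; first exact: dF.
exact: IHs.
Qed.

Lemma is_RInt_rsum s (F : I -> R -> R) (v : I -> R) a b :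
  (forall i, is_RInt (F i) a b (v i)) ->
  is_RInt (fun y => \rsum_(i <- s) F i y) a b (\rsum_(i <- s) v i).
Proof.
elim: s => [|i s IHs] dF.
  rewrite big_nil; apply: (is_RInt_ext (fun=> 0)) => [y _|]; first by rewrite big_nil.
  by rewrite -{2}(Rmult_0_r (b - a)); exact: is_RInt_const.
rewrite big_cons.
apply: (is_RInt_ext (fun y => F i y + \rsum_(j <- s) F j y)) => [y _|].
  by rewrite big_cons.
apply: is_RInt_plus; first exact: dF.
exact: IHs.
Qed.

End FiniteSums.

Lemma exp_le x y : x <= y -> exp x <= exp y.
Proof. by case=> [xy|->]; [apply/Rlt_le/exp_increasing|apply: Rle_refl]. Qed.

Lemma Rabs_RInt_le (f : R -> R) a b M : a <= b -> ex_RInt f a b ->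
  (forall t, a <= t <= b -> Rabs (f t) <= M) -> Rabs (RInt f a b) <= (b - a) * M.
Proof.
by move=> ab ef fM; apply: (norm_RInt_le_const f a b) => //; apply: RInt_correct.
Qed.

Lemma ex_RInt_derivable (f : R -> R) a b : (forall t, ex_derive f t) -> ex_RInt f a b.
Proof. by move=> df; apply: ex_RInt_continuous => t _; apply: ex_derive_continuous. Qed.

Section Fourier.
Implicit Types (s : seq (nat * R)) (z : Z) (t : R).

(* An entry [(k, a)] stands for the frequency [k.+1]. *)
Definition cos_sum s t := \rsum_(p <- s) (p.2 * cos (INR p.1.+1 * t)).
Definition sin_sum s t := \rsum_(p <- s) (p.2 * sin (INR p.1.+1 * t)).

(** The real part of [exp (sum_k a_k e^(i k t)) e^(- i z t)]. As the [a_k] are real, its integral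
    over a period is the full Fourier integral. The frequency is an integer of type [Z] because
    negative frequencies must be shown to vanish. *)
Definition fourier_fun s z t := exp (cos_sum s t) * cos (sin_sum s t - IZR z * t).
Definition fourier s z := RInt (fourier_fun s z) (- PI) PI.

Lemma is_derive_cos_sum s t :
  is_derive (cos_sum s) t (\rsum_(p <- s) (p.2 * INR p.1.+1 * - sin (INR p.1.+1 * t))).
Proof.
refine (is_derive_rsum s (F := fun p t => p.2 * cos (INR p.1.+1 * t))
  (F' := fun p t => p.2 * INR p.1.+1 * - sin (INR p.1.+1 * t)) _) => p.
by move: (INR p.1.+1) => k; auto_derive => //; ring.
Qed.

Lemma is_derive_sin_sum s t :
  is_derive (sin_sum s) t (\rsum_(p <- s) (p.2 * INR p.1.+1 * cos (INR p.1.+1 * t))).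
Proof.
refine (is_derive_rsum s (F := fun p t => p.2 * sin (INR p.1.+1 * t))
  (F' := fun p t => p.2 * INR p.1.+1 * cos (INR p.1.+1 * t)) _) => p.
by move: (INR p.1.+1) => k; auto_derive => //; ring.
Qed.

Lemma ex_derive_fourier_fun s z t : ex_derive (fourier_fun s z) t.
Proof.
have dU := is_derive_cos_sum s t; have dV := is_derive_sin_sum s t.
rewrite /fourier_fun; auto_derive; split; first by eexists; exact: dU.
by split; first by eexists; exact: dV.
Qed.

Lemma ex_RInt_fourier s z a b : ex_RInt (fourier_fun s z) a b.
Proof. by apply: ex_RInt_derivable; exact: ex_derive_fourier_fun. Qed.

Lemma sin_INR_PI k : sin (INR k * PI) = 0.
Proof. by apply: sin_eq_0_1; exists (Z.of_nat k); rewrite INR_IZR_INZ. Qed.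

(** Integration by parts: [G] is the imaginary part that accompanies [fourier_fun], it vanishes at
    both ends, and its derivative is the difference of the two sides. *)
Lemma fourier_rec s z : IZR z * fourier s z =
  \rsum_(p <- s) (p.2 * INR p.1.+1 * fourier s (z - Z.of_nat p.1.+1)).
Proof.
pose G t := exp (cos_sum s t) * sin (sin_sum s t - IZR z * t).
pose G' t := \rsum_(p <- s) (p.2 * INR p.1.+1 * fourier_fun s (z - Z.of_nat p.1.+1) t)
   - IZR z * fourier_fun s z t.
have dG t : is_derive G t (G' t).
  have dU := is_derive_cos_sum s t; have dV := is_derive_sin_sum s t.
  rewrite /G; auto_derive.
    by split; [eexists; exact: dU|split; first by eexists; exact: dV].
  have -> : Derive (fun x => cos_sum s x) t = _ := is_derive_unique _ _ _ dU.
  have -> : Derive (fun x => sin_sum s x) t = _ := is_derive_unique _ _ _ dV.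
  rewrite /G' /fourier_fun !Rmult_1_l.
  set W := sin_sum s t + - (IZR z * t).
  have -> : sin_sum s t - IZR z * t = W by [].
  have -> : \rsum_(p <- s) (p.2 * INR p.1.+1 *
      (exp (cos_sum s t) * cos (sin_sum s t - IZR (z - Z.of_nat p.1.+1) * t))) =
    exp (cos_sum s t) * ((\rsum_(p <- s) (p.2 * INR p.1.+1 * - sin (INR p.1.+1 * t))) * sin W
     + (\rsum_(p <- s) (p.2 * INR p.1.+1 * cos (INR p.1.+1 * t))) * cos W).
    rewrite !big_distrl -big_split big_distrr; apply: eq_bigr => p _ /=.
    rewrite (_ : _ - _ = W + INR p.1.+1 * t); first by rewrite cos_plus; ring.
    by rewrite minus_IZR -INR_IZR_INZ /W; ring.
  ring.
have iG : is_RInt G' (- PI) PI 0.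
  have -> : 0 = minus (G PI) (G (- PI)).
    have sP : sin_sum s PI = 0.
      by rewrite /sin_sum big1 // => p _; rewrite sin_INR_PI Rmult_0_r.
    have sN : sin_sum s (- PI) = 0.
      rewrite /sin_sum big1 // => p _.
      by rewrite Ropp_mult_distr_r_reverse sin_neg sin_INR_PI; ring.
    have zP : sin (IZR z * PI) = 0 by apply: sin_eq_0_1; exists z.
    rewrite /G sP sN /minus /plus /opp /= !Rminus_0_l.
    by rewrite Ropp_mult_distr_r_reverse !sin_neg zP; ring.
  apply: is_RInt_derive => t _; first exact: dG.
  apply: ex_derive_continuous; apply: ex_derive_minus.
    eexists; refine (is_derive_rsum s (F := fun p t => p.2 * INR p.1.+1 * fourier_fun s (z - Z.of_nat p.1.+1) t)
      (F' := fun p t => p.2 * INR p.1.+1 * Derive (fourier_fun s (z - Z.of_nat p.1.+1)) t) _) => p.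
    by apply: is_derive_scal; apply: Derive_correct; apply: ex_derive_fourier_fun.
  by apply: ex_derive_scal; apply: ex_derive_fourier_fun.
have iG2 : is_RInt G' (- PI) PI (\rsum_(p <- s) (p.2 * INR p.1.+1 * fourier s (z - Z.of_nat p.1.+1))
     - IZR z * fourier s z).
  apply: (is_RInt_minus (V := R_NormedModule)).
    apply: is_RInt_rsum => p; apply: (is_RInt_scal (V := R_NormedModule)).
    by apply: RInt_correct; apply: ex_RInt_fourier.
  apply: (is_RInt_scal (V := R_NormedModule)).
  by apply: RInt_correct; apply: ex_RInt_fourier.
have := is_RInt_unique _ _ _ _ iG; rewrite (is_RInt_unique _ _ _ _ iG2); lra.
Qed.

Lemma fourier_bounded s : exists2 M, 0 <= M & forall z, Rabs (fourier s z) <= M.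
Proof.
pose A := \rsum_(p <- s) Rabs p.2.
have PI0 := PI_RGT_0; have eA := exp_pos A.
exists ((PI - - PI) * exp A) => [|z]; first nra.
apply: Rabs_RInt_le; [lra|exact: ex_RInt_fourier|move=> t _].
rewrite /fourier_fun Rabs_mult Rabs_pos_eq; last exact: Rlt_le (exp_pos _).
rewrite -[X in _ <= X]Rmult_1_r; apply: Rmult_le_compat; try exact: Rabs_pos.
- exact: Rlt_le (exp_pos _).
- apply: exp_le; apply: Rle_trans (Rle_abs _) _.
  apply: Rabs_rsum_le => p; rewrite Rabs_mult -[X in _ <= X]Rmult_1_r.
  apply: Rmult_le_compat_l; first exact: Rabs_pos.
  by apply: Rabs_le; have := COS_bound (INR p.1.+1 * t); lra.
- by apply: Rabs_le; have := COS_bound (sin_sum s t - IZR z * t); lra.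
Qed.

(** At a negative frequency the recurrence only refers to frequencies that are more negative still.
    Far out, each use of it halves the uniform bound, so those coefficients are zero; the recurrence
    then carries the zeros back towards the origin. *)
Lemma fourier_neg s n : fourier s (- Z.of_nat n.+1) = 0.
Proof.
have [M M0 bM] := fourier_bounded s.
pose A := \rsum_(p <- s) Rabs (p.2 * INR p.1.+1).
have A0 : 0 <= A by apply: rsum_ge0 => p; exact: Rabs_pos.
have step n' B : (forall m, (n' < m)%N -> Rabs (fourier s (- Z.of_nat m)) <= B) ->
    INR n' * Rabs (fourier s (- Z.of_nat n')) <= A * B.
  move=> hB; have -> : INR n' * Rabs (fourier s (- Z.of_nat n')) =
      Rabs (IZR (- Z.of_nat n') * fourier s (- Z.of_nat n')).
    by rewrite Rabs_mult opp_IZR Rabs_Ropp -INR_IZR_INZ (Rabs_pos_eq (INR n')) //; exact: pos_INR.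
  rewrite fourier_rec big_distrl; apply: Rabs_rsum_le => p.
  rewrite Rabs_mult; apply: Rmult_le_compat_l; first exact: Rabs_pos.
  rewrite (_ : (_ - _)%Z = (- Z.of_nat (n' + p.1.+1))%Z); last lia.
  by apply: hB; lia.
(* From [n' >= 2 A] on, the factor [A / n'] in [step] is at most one half. *)
pose N := Z.to_nat (up (2 * A)).
have N2 n' : (N <= n')%N -> 2 * A <= INR n'.
  move=> Nn; have [u1 _] := archimed (2 * A).
  apply: Rle_trans (Rlt_le _ _ u1) _; rewrite INR_IZR_INZ; apply: IZR_le.
  rewrite /N in Nn; lia.
clearbody N.
have half m : forall n', (N <= n')%N -> (0 < n')%N -> Rabs (fourier s (- Z.of_nat n')) <= M * (/ 2) ^ m.
  elim: m => [|m IHm] n' Nn n0; first by rewrite /= Rmult_1_r; exact: bM.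
  have hB m' : (n' < m')%N -> Rabs (fourier s (- Z.of_nat m')) <= M * (/ 2) ^ m.
    by move=> m'n; apply: IHm; lia.
  have h := step n' _ hB.
  have n1 : 1 <= INR n' by apply: (le_INR 1); lia.
  have q0 : 0 <= (/ 2) ^ m by apply: pow_le; lra.
  have Mq : 0 <= M * (/ 2) ^ m by apply: Rmult_le_pos.
  have N2n := N2 _ Nn; have F0 := Rabs_pos (fourier s (- Z.of_nat n')).
  have := Rmult_le_compat_r _ _ _ Mq N2n => N2Q.
  apply: (Rmult_le_reg_l (INR n')); first lra.
  by apply: Rle_trans h _; rewrite /=; lra.
have big0 n' : (N <= n')%N -> (0 < n')%N -> fourier s (- Z.of_nat n') = 0.
  move=> Nn n0; apply: Rabs_eq_0; apply: Rle_antisym; last exact: Rabs_pos.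
  apply: le_epsilon => e e0; rewrite Rplus_0_l.
  have Me : 0 < e / (M + 1) by apply: Rdiv_lt_0_compat; lra.
  have [m hm] := pow_lt_1_zero (/ 2) (ltac:(rewrite Rabs_pos_eq; lra)) _ Me.
  apply: Rle_trans (half m _ Nn n0) _.
  have := hm m (le_n _); have q0 : 0 <= (/ 2) ^ m by apply: pow_le; lra.
  rewrite Rabs_pos_eq // => q.
  have : (/ 2) ^ m * (M + 1) <= e.
    by apply: (Rmult_le_reg_r (/ (M + 1))); [apply: Rinv_0_lt_compat; lra|field_simplify; lra].
  nra.
have down d : forall n', (N <= n' + d)%N -> (0 < n')%N -> fourier s (- Z.of_nat n') = 0.
  elim: d => [|d IHd] n' Nn n0; first by apply: big0; rewrite ?addn0 in Nn.
  have n1 : 1 <= INR n' by apply: (le_INR 1); lia.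
  have h0 : forall m, (n' < m)%N -> Rabs (fourier s (- Z.of_nat m)) <= 0.
    by move=> m nm; rewrite IHd ?Rabs_R0; [lra|lia|lia].
  have h := step n' 0 h0; apply: Rabs_eq_0; have := Rabs_pos (fourier s (- Z.of_nat n')); nra.
by apply: (down N); lia.
Qed.

Definition scale_coefs (tau : R) s := [seq (p.1, tau * p.2) | p <- s].

Lemma cos_sum_scale tau s t : cos_sum (scale_coefs tau s) t = tau * cos_sum s t.
Proof.
by rewrite /cos_sum big_map big_distrr; apply: eq_bigr => p _ /=; ring.
Qed.

Lemma sin_sum_scale tau s t : sin_sum (scale_coefs tau s) t = tau * sin_sum s t.
Proof.
by rewrite /sin_sum big_map big_distrr; apply: eq_bigr => p _ /=; ring.
Qed.

(* The mean value property of [exp] of a polynomial without constant term: the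
   derivative in [tau] is a combination of negative Fourier coefficients. *)
Lemma fourier0 s : fourier s 0 = 2 * PI.
Proof.
pose J tau := RInt (fun t => exp (tau * cos_sum s t) * cos (tau * sin_sum s t)) (- PI) PI.
have dphi tau t : is_derive (fun u => exp (u * cos_sum s t) * cos (u * sin_sum s t)) tau
    (exp (tau * cos_sum s t) * (cos_sum s t * cos (tau * sin_sum s t)
      - sin_sum s t * sin (tau * sin_sum s t))).
  by auto_derive => //; ring.
have cU t : continuity_pt (cos_sum s) t.
  apply/continuity_pt_filterlim; apply: ex_derive_continuous; eexists; exact: is_derive_cos_sum.
have cV t : continuity_pt (sin_sum s) t.
  apply/continuity_pt_filterlim; apply: ex_derive_continuous; eexists; exact: is_derive_sin_sum.
have dJ tau : is_derive J tau 0.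
  have -> : 0 = RInt (fun t => Derive (fun u => exp (u * cos_sum s t) * cos (u * sin_sum s t)) tau) (- PI) PI.
    rewrite (RInt_ext _ (fun t => \rsum_(p <- s) (p.2 * fourier_fun (scale_coefs tau s) (- Z.of_nat p.1.+1) t))).
      rewrite (is_RInt_unique _ _ _ (\rsum_(p <- s) (p.2 * fourier (scale_coefs tau s) (- Z.of_nat p.1.+1)))).
        by rewrite big1 // => p _; rewrite fourier_neg Rmult_0_r.
      refine (is_RInt_rsum (F := fun p t => p.2 * fourier_fun (scale_coefs tau s) (- Z.of_nat p.1.+1) t) _) => p.
      apply: (is_RInt_scal (V := R_NormedModule)).
      by apply: RInt_correct; apply: ex_RInt_fourier.
    move=> t _; rewrite (is_derive_unique _ _ _ (dphi tau t)).
    rewrite [X in _ * (X * _ - _)]/cos_sum [X in _ * (_ - X * _)]/sin_sum !big_distrl /= -rsum_minus big_distrr.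
    apply: eq_bigr => p _ /=; rewrite /fourier_fun cos_sum_scale sin_sum_scale.
    rewrite (_ : _ - IZR _ * t = tau * sin_sum s t + INR p.1.+1 * t).
      by rewrite cos_plus; ring.
    by rewrite opp_IZR -INR_IZR_INZ; ring.
  apply: is_derive_RInt_param.
  - by apply: filter_forall => u t _; eexists; exact: dphi.
  - move=> t _.
    apply: (continuity_2d_pt_ext (fun u v => exp (u * cos_sum s v) * (cos_sum s v * cos (u * sin_sum s v)
      - sin_sum s v * sin (u * sin_sum s v)))).
      by move=> u v; rewrite (is_derive_unique _ _ _ (dphi u v)).
    have c1 : continuity_2d_pt (fun _ v => cos_sum s v) tau t.
      by apply: (continuity_1d_2d_pt_comp (cos_sum s) (fun _ v => v)) => //; exact: continuity_2d_pt_id2.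
    have c2 : continuity_2d_pt (fun _ v => sin_sum s v) tau t.
      by apply: (continuity_1d_2d_pt_comp (sin_sum s) (fun _ v => v)) => //; exact: continuity_2d_pt_id2.
    have c3 : continuity_2d_pt (fun u v => u * cos_sum s v) tau t.
      by apply: continuity_2d_pt_mult => //; exact: continuity_2d_pt_id1.
    have c4 : continuity_2d_pt (fun u v => u * sin_sum s v) tau t.
      by apply: continuity_2d_pt_mult => //; exact: continuity_2d_pt_id1.
    apply: continuity_2d_pt_mult.
      apply: (continuity_1d_2d_pt_comp exp) => //.
      by apply: derivable_continuous_pt; exact: derivable_pt_exp.
    apply: continuity_2d_pt_minus; apply: continuity_2d_pt_mult => //.
      by apply: (continuity_1d_2d_pt_comp cos) => //; exact: continuity_cos.
    by apply: (continuity_1d_2d_pt_comp sin) => //; exact: continuity_sin.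
  - apply: filter_forall => u; apply: ex_RInt_derivable => t.
    have dU := is_derive_cos_sum s t; have dV := is_derive_sin_sum s t.
    by auto_derive; split; [eexists; exact: dU|split => //; eexists; exact: dV].
have JE : J 1 = J 0.
  by symmetry; apply: (eq_is_derive J 0 1); [move=> t _; exact: dJ|lra].
have -> : fourier s 0 = J 1.
  apply: RInt_ext => t _; rewrite /fourier_fun !Rmult_1_l; congr (_ * cos _); ring.
rewrite JE /J (RInt_ext _ (fun=> 1)) => [|t _]; last by rewrite !Rmult_0_l exp_0 cos_0 Rmult_1_r.
by rewrite RInt_const /scal /= /mult /=; ring.
Qed.

(** The Fourier coefficients satisfy the same recurrence by [fourier_rec], with starting value
    [2 * PI] by [fourier0]; the [else 0] branch corresponds to [fourier_neg]. *)
Lemma fourier_coef s (c : nat -> R) N : c 0%N = 1 ->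
  (forall n, (n <= N)%N -> INR n * c n =
    \rsum_(p <- s) (p.2 * INR p.1.+1 * (if (p.1 < n)%N then c (n - p.1.+1)%N else 0))) ->
  forall n, (n <= N)%N -> fourier s (Z.of_nat n) = 2 * PI * c n.
Proof.
move=> c0 crec; elim/ltn_ind => n IHn nN.
have [->|n0] := posnP n; first by rewrite c0 Rmult_1_r; exact: fourier0.
apply: (Rmult_eq_reg_l (INR n)); last by apply: not_0_INR; lia.
rewrite [RHS](_ : _ = 2 * PI * (INR n * c n)); last ring.
rewrite INR_IZR_INZ fourier_rec -INR_IZR_INZ crec // big_distrr; apply: eq_bigr => p _ /=.
case: ltnP => pn.
  rewrite (_ : (_ - _)%Z = Z.of_nat (n - p.1.+1)); last lia.
  by rewrite IHn; [ring|lia|lia].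
rewrite (_ : (_ - _)%Z = (- Z.of_nat (p.1 - n).+1)%Z); last lia.
by rewrite fourier_neg; ring.
Qed.
End Fourier.

(** * Euler-Maclaurin expansion of Riemann sums *)

Lemma ex_derive_continuity_pt (f : R -> R) x : ex_derive f x -> continuity_pt f x.
Proof. by move=> df; apply/continuity_pt_filterlim; apply: ex_derive_continuous. Qed.

Lemma mvt_bound (f df : R -> R) a b M :
  (forall t, Rmin a b <= t <= Rmax a b -> is_derive f t (df t)) ->
  (forall t, Rmin a b <= t <= Rmax a b -> Rabs (df t) <= M) ->
  Rabs (f b - f a) <= M * Rabs (b - a).
Proof.
move=> dF dM.
have C1 t : Rmin a b < t < Rmax a b -> is_derive f t (df t).
  by move=> tab; apply: dF; lra.
have C2 t : Rmin a b <= t <= Rmax a b -> continuity_pt f t.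
  move=> tab; apply: ex_derive_continuity_pt; eexists.
  exact: (dF _ tab).
have [t [tab ->]] := MVT_gen f a b df C1 C2.
by rewrite Rabs_mult; apply: Rmult_le_compat_r; [exact: Rabs_pos|exact: dM].
Qed.

(** Induction on [J]: the derivative of the remainder is the remainder of one order less for the
    shifted family, and [mvt_bound] integrates the bound. This gives no factor [1 / J!], and only
    the power of [x - c] matters below. *)
Lemma taylor_bound (F : nat -> R -> R) J c x M :
  (forall j t, Rmin c x <= t <= Rmax c x -> is_derive (F j) t (F j.+1 t)) ->
  (forall t, Rmin c x <= t <= Rmax c x -> Rabs (F J t) <= M) ->
  Rabs (F 0%N x - \rsum_(i < J) (F i c * (x - c) ^ i / INR (fact i))) <= M * Rabs (x - c) ^ J.
Proof.
elim: J F x => [|J IHJ] F x dF FM.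
  rewrite big_ord0 Rminus_0_r /= Rmult_1_r; apply: FM.
  by split; [exact: Rmin_r|exact: Rmax_r].
pose P t := \rsum_(i < J.+1) (F i c * (t - c) ^ i / INR (fact i)).
pose dP t := \rsum_(i < J) (F i.+1 c * (t - c) ^ i / INR (fact i)).
have dPE t : is_derive P t (dP t).
  have PE y : F 0%N c + \rsum_(i < J) (F i.+1 c * (y - c) ^ i.+1 / INR (fact i.+1)) = P y.
    by rewrite /P big_ord_recl /=; congr (_ + _); rewrite /Rdiv Rinv_1; ring.
  apply: (is_derive_ext _ _ _ _ PE); rewrite -[dP t]Rplus_0_l.
  apply: (is_derive_plus (fun=> F 0%N c)); first exact: is_derive_const.
  refine (is_derive_rsum _ (F := fun (i : 'I_J) y => F i.+1 c * (y - c) ^ i.+1 / INR (fact i.+1))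
    (F' := fun (i : 'I_J) t => F i.+1 c * (t - c) ^ i / INR (fact i)) _) => i.
  have f0 := INR_fact_neq_0 i; have i0 : INR i.+1 <> 0 by apply: not_0_INR.
  have fE : INR (fact i.+1) = INR i.+1 * INR (fact i) by rewrite -mult_INR.
  auto_derive => //; rewrite fE -/(INR i.+1); move: f0 i0.
  rewrite /=; move: (INR i.+1) (INR (fact i)) => a b a0 b0; rewrite -/(t - c); field; lra.
have Pc : P c = F 0%N c.
  rewrite /P big_ord_recl /= big1; first by rewrite /Rdiv Rinv_1; ring.
  by move=> i _; rewrite Rminus_eq_0 /= /Rdiv; ring.
have := @mvt_bound (fun t => F 0%N t - P t) (fun t => F 1%N t - dP t) c x (M * Rabs (x - c) ^ J).
rewrite Pc Rminus_eq_0 Rminus_0_r /= => h.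
rewrite (_ : M * _ = M * Rabs (x - c) ^ J * Rabs (x - c)); last ring.
apply: h => t tcx.
  by apply: is_derive_minus => //; exact: dF.
have sub u : Rmin c t <= u <= Rmax c t -> Rmin c x <= u <= Rmax c x.
  by move: tcx; rewrite /Rmin /Rmax; do 2!case: Rle_dec; lra.
apply: Rle_trans (IHJ (fun j => F j.+1) t _ _) _.
- by move=> j u ut; apply: dF; exact: sub.
- by move=> u ut; apply: FM; exact: sub.
apply: Rmult_le_compat_l.
  apply: Rle_trans (FM x _); first exact: Rabs_pos.
  by split; [exact: Rmin_r|exact: Rmax_r].
apply: pow_incr; split; first exact: Rabs_pos.
by move: tcx; rewrite /Rmin /Rmax; case: Rle_dec => cx tcx; rewrite -!(Rabs_minus_sym c);
  [rewrite !Rabs_left1|rewrite !Rabs_pos_eq]; lra.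
Qed.

Arguments fact : simpl never.

(** Polynomials appear as existentially quantified coefficient lists: the expansions assert that
    some polynomial exists and at most control its lowest coefficients. *)
Fixpoint pe (l : seq R) (x : R) : R := if l is a :: l' then a + x * pe l' x else 0.

Lemma pe_add l1 l2 : exists l, forall x, pe l x = pe l1 x + pe l2 x.
Proof.
elim: l1 l2 => [|a l1 IHl] l2; first by exists l2 => x /=; ring.
case: l2 => [|b l2]; first by exists (a :: l1) => x /=; ring.
have [l lE] := IHl l2; exists (a + b :: l) => x /=; rewrite lE; ring.
Qed.

Lemma pe_scal c l1 : exists l, forall x, pe l x = c * pe l1 x.
Proof.
elim: l1 => [|a l1 [l lE]]; first by exists [::] => x /=; ring.
by exists (c * a :: l) => x /=; rewrite lE; ring.
Qed.

Lemma pe_mul l1 l2 : exists l, forall x, pe l x = pe l1 x * pe l2 x.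
Proof.
elim: l1 => [|a l1 [l lE]]; first by exists [::] => x /=; ring.
have [l' lE'] := pe_scal a l2; have [m mE] := pe_add l' (0 :: l).
by exists m => x; rewrite mE /= lE lE'; ring.
Qed.

Lemma pe_bounded l : exists2 C, 0 <= C & forall x, Rabs x <= 1 -> Rabs (pe l x) <= C.
Proof.
elim: l => [|a l [C C0 hC]]; first by exists 0 => [|x _ /=]; rewrite ?Rabs_R0; lra.
exists (Rabs a + C) => [|x x1 /=]; first by have := Rabs_pos a; lra.
apply: Rle_trans (Rabs_triang _ _) _; rewrite Rabs_mult.
have := hC x x1; have := Rabs_pos (pe l x); have := Rabs_pos x; nra.
Qed.

(* Approximation to order [K] near [0] of a sequence of functions, for large
   index only but then uniformly on every interval [sigma, 1]. *)
Definition evapprox (f : nat -> R -> R) (p : R -> R) (K : nat) : Prop :=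
  exists2 C, 0 <= C & forall sigma, 0 < sigma <= 1 -> exists N0, forall N, (N0 <= N)%N ->
    forall u, sigma <= u <= 1 -> Rabs (f N u - p u) <= C * u ^ K.

Lemma evapprox_ext f g p q K :
  (forall N u, 0 < u <= 1 -> f N u = g N u) -> (forall u, 0 < u <= 1 -> p u = q u) ->
  evapprox f p K -> evapprox g q K.
Proof.
move=> fg pq [C C0 hC]; exists C => // s s01; have [N0 hN] := hC s s01.
exists N0 => N NN u su; rewrite -fg; last lra.
by rewrite -pq; [exact: hN|lra].
Qed.

Lemma evapprox_plus f g p q K : evapprox f p K -> evapprox g q K ->
  evapprox (fun N u => f N u + g N u) (fun u => p u + q u) K.
Proof.
move=> [C C0 hC] [D D0 hD]; exists (C + D); first lra.
move=> s s01; have [N1 h1] := hC s s01; have [N2 h2] := hD s s01.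
exists (maxn N1 N2) => N NN u su.
rewrite (_ : _ - _ = (f N u - p u) + (g N u - q u)); last ring.
apply: Rle_trans (Rabs_triang _ _) _; rewrite Rmult_plus_distr_r.
by apply: Rplus_le_compat; [apply: h1|apply: h2] => //; lia.
Qed.

Lemma evapprox_xmul c m f p K : evapprox f p K ->
  evapprox (fun N u => c * u ^ m * f N u) (fun u => c * u ^ m * p u) (m + K).
Proof.
move=> [C C0 hC]; exists (Rabs c * C); first by have := Rabs_pos c; nra.
move=> s s01; have [N0 h] := hC s s01; exists N0 => N NN u su.
rewrite -Rmult_minus_distr_l !Rabs_mult pow_add (Rabs_pos_eq (u ^ m)); last by apply: pow_le; lra.
have c0 := Rabs_pos c; have um : 0 <= u ^ m by apply: pow_le; lra.
rewrite (_ : Rabs c * C * _ = Rabs c * u ^ m * (C * u ^ K)); last ring.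
by apply: Rmult_le_compat_l; [nra|exact: h].
Qed.

Lemma pow_le_pow u j k : 0 <= u <= 1 -> (j <= k)%N -> u ^ k <= u ^ j.
Proof.
move=> u01 jk; rewrite -(subnKC jk) pow_add.
have uj : 0 <= u ^ j by apply: pow_le; lra.
have := pow_incr u 1 (k - j) u01; rewrite pow1; nra.
Qed.

Lemma evapprox_weaken f p K K' : (K' <= K)%N -> evapprox f p K -> evapprox f p K'.
Proof.
move=> KK [C C0 hC]; exists C => // s s01; have [N0 h] := hC s s01.
exists N0 => N NN u su; apply: Rle_trans (h N NN u su) _.
by apply: Rmult_le_compat_l => //; apply: pow_le_pow => //; lra.
Qed.

Lemma evapprox_cst p K : evapprox (fun=> p) p K.
Proof.
by exists 0 => [|s _]; [lra|exists 0%N => N _ u _; rewrite Rminus_eq_0 Rabs_R0; lra].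
Qed.

Definition evpoly f K := exists l, evapprox f (pe l) K.

Lemma evpoly_plus f g K : evpoly f K -> evpoly g K -> evpoly (fun N u => f N u + g N u) K.
Proof.
move=> [l fl] [m gm]; have [n nE] := pe_add l m; exists n.
by apply: evapprox_ext (evapprox_plus fl gm) => // u _; rewrite nE.
Qed.

Lemma evpoly_xmul c m f K : evpoly f K -> evpoly (fun N u => c * u ^ m * f N u) (m + K).
Proof.
move=> [l fl].
have [n nE] : exists n, forall u, pe n u = c * u ^ m * pe l u.
  elim: m {fl} c => [|m IHm] c.
    by have [n nE] := pe_scal c l; exists n => u; rewrite nE /=; ring.
  by have [n nE] := IHm c; exists (0 :: n) => u /=; rewrite nE; ring.
by exists n; apply: evapprox_ext (evapprox_xmul c m fl) => // u _; rewrite nE.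
Qed.

Lemma evpoly_rsum m (f : nat -> nat -> R -> R) K : (forall i, evpoly (f i) K) ->
  evpoly (fun N u => \rsum_(i < m) f i N u) K.
Proof.
move=> fK; elim: m => [|m IH].
  by exists [::]; apply: evapprox_ext (evapprox_cst (fun=> 0) K) => // N u _; rewrite big_ord0.
have [n H] := evpoly_plus IH (fK m); exists n.
by apply: evapprox_ext H => // N u _; rewrite big_ord_recr.
Qed.

Lemma evpoly_weaken f K K' : (K' <= K)%N -> evpoly f K -> evpoly f K'.
Proof. by move=> KK [l fl]; exists l; exact: evapprox_weaken fl. Qed.

Section EulerMaclaurin.
(** The function to be summed is [H 1], and [H 0] is its antiderivative that vanishes at infinity,
    so [- H 0 0] stands for the improper integral of [H 1]. The quadratic decay makes all Riemann
    sums bounded. *)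
Variables (H : nat -> R -> R) (B : nat -> R).
Hypothesis dH : forall j u, 0 <= u -> is_derive (H j) u (H j.+1 u).
Hypothesis HB : forall j u, 0 <= u -> Rabs (H j.+1 u) <= B j.+1 / (1 + u) ^ 2.
Hypothesis H0 : forall e, 0 < e -> exists U, forall u, U <= u -> Rabs (H 0%N u) <= e.

Definition riemann j N u := \rsum_(k < N) (u * H j (INR k.+1 * u)).

Let B0 j : 0 <= B j.+1.
Proof.
have := @HB j 0 (Rle_refl _); rewrite Rplus_0_r pow1 Rdiv_1_r.
by have := Rabs_pos (H j.+1 0); lra.
Qed.

(** The terms are below the telescoping differences of [1 / (1 + k u)]; the bound is the integral of
    [(1 + x)^-2] over the half-line. *)
Let weight_sum N u : 0 < u -> \rsum_(k < N) (u / (1 + INR k.+1 * u) ^ 2) <= 1.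
Proof.
move=> u0; suff : \rsum_(k < N) (u / (1 + INR k.+1 * u) ^ 2) <= 1 - / (1 + INR N * u).
  have : 0 < / (1 + INR N * u) by apply: Rinv_0_lt_compat; have := pos_INR N; nra.
  lra.
elim: N => [|N IHN]; first by rewrite big_ord0 /INR; field_simplify; lra.
rewrite big_ord_recr /= S_INR; rewrite /= in IHN; have n0 := pos_INR N.
suff : u / ((1 + (INR N + 1) * u) * ((1 + (INR N + 1) * u) * 1)) <= / (1 + INR N * u) - / (1 + (INR N + 1) * u) by lra.
have a0 : 0 < 1 + INR N * u by nra.
have b0 : 0 < 1 + (INR N + 1) * u by nra.
rewrite (_ : / _ - _ = u / ((1 + INR N * u) * (1 + (INR N + 1) * u))); last by field; lra.
apply: Rmult_le_compat_l; first lra.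
apply: Rinv_le_contravar; first nra.
rewrite Rmult_1_r; apply: Rmult_le_compat_r; lra.
Qed.

Let H_lim j e : 0 < e -> exists U, forall u, U <= u -> Rabs (H j u) <= e.
Proof.
case: j => [|j] e0; first exact: H0.
exists (B j.+1 / e) => u Uu.
have u0 : 0 <= u.
  by apply: Rle_trans Uu; apply: Rdiv_le_0_compat => //; exact: B0.
apply: Rle_trans (HB _ u0) _; apply: (Rmult_le_reg_r ((1 + u) ^ 2)); first nra.
have -> : B j.+1 / (1 + u) ^ 2 * (1 + u) ^ 2 = B j.+1 by field; nra.
have : B j.+1 <= u * e.
  rewrite -(Rmult_1_r (B _)) -(Rinv_l e); last lra.
  by rewrite -Rmult_assoc; apply: Rmult_le_compat_r => //; lra.
nra.
Qed.

(** Expand [H j] at the right end of each interval of length [u] and sum: the values of [H j]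
    telescope, the linear terms form the Riemann sum of [H j.+1], and the higher terms form Riemann
    sums of higher derivatives. Bernoulli numbers do not show up, because those sums are left in
    place and expanded recursively later. *)
Lemma euler_maclaurin j K :
  evapprox (fun N u => riemann j.+1 N u -
     \rsum_(i < K) ((-1) ^ i / INR (fact i.+2) * u ^ i.+1 * riemann (j.+2 + i) N u))
   (fun=> - H j 0) K.+1.
Proof.
exists (4 * B (j + K.+2) + 1); first by rewrite addnS; have := B0 (j + K.+1); lra.
move=> s s01.
have sK : 0 < s ^ K.+1 by apply: pow_lt; lra.
have [U hU] := H_lim j sK.
exists (Z.to_nat (up (U / s))) => N NU u su.
have NU' : U <= INR N * u.
  have [u1 _] := archimed (U / s); have : U / s <= INR N.
    by apply: Rle_trans (Rlt_le _ _ u1) _; rewrite INR_IZR_INZ; apply: IZR_le; lia.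
  move=> h; have := Rmult_le_compat_r s _ _ (ltac:(lra)) h.
  rewrite /Rdiv Rmult_assoc Rinv_l; last lra.
  by have := pos_INR N; nra.
pose Rk k := H j (INR k * u) - \rsum_(i < K.+2) (H (j + i) (INR k.+1 * u) * (- u) ^ i / INR (fact i)).
have RkB k : Rabs (Rk k) <= 4 * B (j + K.+2) * u ^ K.+1 * (u / (1 + INR k.+1 * u) ^ 2).
  have k0 := pos_INR k.
  have := @taylor_bound (fun i => H (j + i)) K.+2 (INR k.+1 * u) (INR k * u)
     (4 * B (j + K.+2) / (1 + INR k.+1 * u) ^ 2).
  rewrite addn0 S_INR (_ : INR k * u - (INR k + 1) * u = - u); last ring.
  rewrite Rabs_Ropp (Rabs_pos_eq u); last lra.
  rewrite /Rk S_INR => h.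
  apply: Rle_trans (h _ _) _; last by rewrite /= /Rdiv; apply: Req_le; ring.
    move=> i t; rewrite addnS => tk; apply: dH.
    by apply: Rle_trans (proj1 tk); apply: Rmin_glb; nra.
  move=> t; rewrite Rmin_right ?Rmax_left; [|nra|nra] => tk.
  rewrite addnS; apply: Rle_trans (HB _ _) _; first nra.
  rewrite /Rdiv Rmult_assoc (Rmult_comm 4) Rmult_assoc.
  apply: Rmult_le_compat_l; first exact: B0.
  have t0 : 0 <= t by nra.
  have q0 : 0 < (1 + t) ^ 2 by nra.
  have r0 : 0 < (1 + (INR k + 1) * u) ^ 2 by apply: pow_lt; nra.
  (* Since [u <= 1], the weight changes by a factor at most 4 over one interval; this is the 4 in
     the constant. *)
  have ar : (1 + (INR k + 1) * u) ^ 2 <= (1 + t) ^ 2 * 4.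
    rewrite (_ : (1 + t) ^ 2 * 4 = (2 * (1 + t)) ^ 2); last ring.
    by apply: pow_incr; nra.
  rewrite (_ : / (1 + t) ^ 2 = 4 * / ((1 + t) ^ 2 * 4)); last by field; nra.
  rewrite Rmult_comm; apply: Rmult_le_compat_r; first lra.
  exact: Rinv_le_contravar.
have tele : \rsum_(k < N) (H j (INR k * u) - H j (INR k.+1 * u)) = H j 0 - H j (INR N * u).
  elim: (N) => [|n IHn]; first by rewrite big_ord0 /INR Rmult_0_l Rminus_eq_0.
  by rewrite big_ord_recr /= IHn; ring.
have E : riemann j.+1 N u
    - \rsum_(i < K) ((-1) ^ i / INR (fact i.+2) * u ^ i.+1 * riemann (j.+2 + i) N u)
    - - H j 0 = H j (INR N * u) + \rsum_(k < N) Rk k.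
  have -> : \rsum_(i < K) ((-1) ^ i / INR (fact i.+2) * u ^ i.+1 * riemann (j.+2 + i) N u)
    = \rsum_(k < N) \rsum_(i < K) (H (j + i.+2) (INR k.+1 * u) * (- u) ^ i.+2 / INR (fact i.+2)).
    rewrite exchange_big; apply: eq_bigr => i _ /=.
    rewrite /riemann big_distrr; apply: eq_bigr => k _ /=.
    rewrite (_ : (j.+2 + i)%N = (j + i.+2)%N); last lia.
    rewrite (_ : - u = -1 * u); last ring.
    rewrite Rpow_mult_distr /Rdiv; ring.
  have -> : \rsum_(k < N) Rk k = H j 0 - H j (INR N * u) + riemann j.+1 N u
     - \rsum_(k < N) \rsum_(i < K) (H (j + i.+2) (INR k.+1 * u) * (- u) ^ i.+2 / INR (fact i.+2)).
    rewrite -tele /riemann -big_split -rsum_minus; apply: eq_bigr => k _ /=.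
    rewrite /Rk !big_ord_recl /= addn0 addn1.
    rewrite (eq_bigr (fun i : 'I_K => H (j + i.+2) (INR k.+1 * u) * (- u) ^ i.+2 / INR (fact i.+2))) /=.
      by rewrite (_ : fact 0 = 1%N) // (_ : fact 1 = 1%N) // /INR; field.
    by move=> i _; rewrite /bump /= !add1n.
  ring.
rewrite E; apply: Rle_trans (Rabs_triang _ _) _.
have h1 := hU _ NU'.
have h2 : s ^ K.+1 <= u ^ K.+1 by apply: pow_incr; lra.
have h3 := Rabs_rsum_le (index_enum 'I_N) (fun k : 'I_N => RkB k).
have h4 := @weight_sum N u (ltac:(lra)).
rewrite -big_distrr in h3.
have uK : 0 <= u ^ K.+1 by apply: pow_le; lra.
have b0 : 0 <= B (j + K.+2) by rewrite addnS; exact: B0.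
have c0 : 0 <= 4 * B (j + K.+2) * u ^ K.+1 by apply: Rmult_le_pos => //; lra.
have h5 := Rle_trans _ _ _ h3 (Rmult_le_compat_l _ _ _ c0 h4).
move: (u ^ K.+1) (s ^ K.+1) h1 h2 h5 => a b h1 h2 h5.
apply: Rle_trans (Rplus_le_compat _ _ _ _ h1 h5) _; lra.
Qed.

Lemma riemann_bounded j : evpoly (riemann j.+1) 0.
Proof.
exists [::], (B j.+1) => [|s s01]; first exact: B0.
exists 0%N => N _ u su; rewrite /= Rminus_0_r Rmult_1_r.
have h4 := @weight_sum N u (ltac:(lra)).
have h : forall k : 'I_N, Rabs (u * H j.+1 (INR k.+1 * u)) <= B j.+1 * (u / (1 + INR k.+1 * u) ^ 2).
  move=> k; have k0 := pos_INR k.+1.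
  rewrite Rabs_mult Rabs_pos_eq; last lra.
  rewrite (_ : B j.+1 * _ = u * (B j.+1 / (1 + INR k.+1 * u) ^ 2)); last by rewrite /Rdiv; ring.
  by apply: Rmult_le_compat_l; [lra|apply: HB; nra].
apply: Rle_trans (Rabs_rsum_le _ h) _; rewrite -big_distrr.
apply: Rle_trans (Rmult_le_compat_l _ _ _ (B0 j) h4) _; lra.
Qed.

(** Every correction term carries a factor [u] more than the sum it multiplies, so order [K] for all
    [j] yields order [K.+1] for all [j]. *)
Lemma riemann_poly j K : evpoly (riemann j.+1) K.
Proof.
elim: K j => [|K IHK] j; first exact: riemann_bounded.
have em := euler_maclaurin j K.
have P1 : evpoly (fun N u =>
    \rsum_(i < K) ((-1) ^ i / INR (fact i.+2) * u ^ i.+1 * riemann (j.+2 + i) N u)) K.+1.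
  apply: (@evpoly_rsum K (fun i N u => (-1) ^ i / INR (fact i.+2) * u ^ i.+1 * riemann (j.+2 + i) N u)) => i.
  apply: (evpoly_weaken (K := i.+1 + K)); first lia.
  exact: evpoly_xmul (IHK (j.+1 + i)%N).
have P2 : evpoly (fun N u => riemann j.+1 N u -
    \rsum_(i < K) ((-1) ^ i / INR (fact i.+2) * u ^ i.+1 * riemann (j.+2 + i) N u)) K.+1.
  exists [:: - H j 0]; apply: evapprox_ext em => // u _ /=; ring.
have [l lP] := evpoly_plus P2 P1; exists l.
by apply: evapprox_ext lP => // N u _; ring.
Qed.

Lemma riemann_poly1 j K : exists l,
  evapprox (riemann j.+1) (fun u => - H j 0 + u * pe l u) K.+1.
Proof.
have em := euler_maclaurin j K.
have [l lP] : evpoly (fun N u =>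
    \rsum_(i < K) ((-1) ^ i / INR (fact i.+2) * u ^ i * riemann (j.+2 + i) N u)) K.
  apply: (@evpoly_rsum K (fun i N u => (-1) ^ i / INR (fact i.+2) * u ^ i * riemann (j.+2 + i) N u)) => i.
  apply: (evpoly_weaken (K := i + K)); first lia.
  exact: evpoly_xmul (riemann_poly _ _).
exists l; apply: evapprox_ext (evapprox_plus em (evapprox_xmul 1 1 lP)) => [N u _|u _].
  rewrite (_ : \rsum_(i < K) _ = 1 * u ^ 1 *
      \rsum_(i < K) ((-1) ^ i / INR (fact i.+2) * u ^ i * riemann (j.+2 + i) N u)); first ring.
  by rewrite big_distrr; apply: eq_bigr => i _ /=; ring.
by rewrite /=; ring.
Qed.

(** The coefficient of [u] comes from the first correction [u / 2] times the Riemann sum of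
    [H j.+2], whose limit is [- H j.+1 0] by [riemann_poly1]. *)
Lemma riemann_poly2 j K : exists l,
  evapprox (riemann j.+1) (fun u => - H j 0 - H j.+1 0 / 2 * u + u ^ 2 * pe l u) K.+2.
Proof.
have em := euler_maclaurin j K.+1.
have [l1 lP1] := riemann_poly1 j.+1 K.
have [l lP] : evpoly (fun N u =>
    \rsum_(i < K) ((-1) ^ i.+1 / INR (fact i.+3) * u ^ i * riemann (j.+3 + i) N u)) K.
  apply: (@evpoly_rsum K (fun i N u => (-1) ^ i.+1 / INR (fact i.+3) * u ^ i * riemann (j.+3 + i) N u)) => i.
  apply: (evpoly_weaken (K := i + K)); first lia.
  exact: evpoly_xmul (riemann_poly _ _).
have [l2 l2E] := pe_scal (1 / 2) l1; have [m mE] := pe_add l2 l.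
exists m; apply: evapprox_ext (evapprox_plus em
  (evapprox_plus (evapprox_xmul (1 / 2) 1 lP1) (evapprox_xmul 1 2 lP))) => [N u _|u _].
  rewrite big_ord_recl addn0 (_ : \rsum_(i < K) _ = 1 * u ^ 2 *
      \rsum_(i < K) ((-1) ^ i.+1 / INR (fact i.+3) * u ^ i * riemann (j.+3 + i) N u)).
    by rewrite (_ : fact 2 = 2%N) // (_ : INR 2 = 2) //=; field.
  rewrite big_distrr; apply: eq_bigr => i _.
  rewrite lift0 (_ : (j.+2 + i.+1)%N = (j.+3 + i)%N); last lia.
  by rewrite /=; ring.
by rewrite mE l2E /=; field.
Qed.
End EulerMaclaurin.

(** * The Basel sum *)

Section Basel.

(* Daners' proof: integrations by parts give
   [1 / m^2 = 2 (J (m-1) / I (m-1) - J m / I m)], which telescopes. *)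
Let I m : R := RInt (fun x => cos x ^ (2 * m)) 0 (PI / 2).
Let J m : R := RInt (fun x => x ^ 2 * cos x ^ (2 * m)) 0 (PI / 2).

Let exI m a b : ex_RInt (fun x => cos x ^ (2 * m)) a b.
Proof. by apply: ex_RInt_derivable => t; auto_derive. Qed.

Let exJ m a b : ex_RInt (fun x => x ^ 2 * cos x ^ (2 * m)) a b.
Proof. by apply: ex_RInt_derivable => t; auto_derive. Qed.

Let I_rec m : 2 * INR m.+1 * I m.+1 = (2 * INR m + 1) * I m.
Proof.
pose F x := sin x * cos x ^ (2 * m).+1.
pose f x := 2 * INR m.+1 * cos x ^ (2 * m.+1) - (2 * INR m + 1) * cos x ^ (2 * m).
have dF x : is_derive F x (f x).
  rewrite /F; auto_derive => //.
  rewrite /f (_ : (2 * m.+1)%N = (2 * m).+2); last lia.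
  rewrite -/(INR (2 * m).+1) (S_INR (2 * m)) mult_INR (S_INR m) (_ : INR 2 = 2) //.
  move: (sin2_cos2 x); rewrite /Rsqr /= => sc.
  have -> : sin x * (1 * - sin x * ((2 * INR m + 1) * cos x ^ (2 * m))) =
     - (sin x * sin x) * ((2 * INR m + 1) * cos x ^ (2 * m)) by ring.
  have -> : sin x * sin x = 1 - cos x * cos x by lra.
  ring.
have iF : is_RInt f 0 (PI / 2) (minus (F (PI / 2)) (F 0)).
  apply: is_RInt_derive => x _; first exact: dF.
  by apply: ex_derive_continuous; rewrite /f; auto_derive.
have F0 : minus (F (PI / 2)) (F 0) = 0.
  by rewrite /minus /plus /opp /F /= cos_PI2 sin_0; ring.
rewrite F0 in iF.
have iF2 : is_RInt f 0 (PI / 2) (2 * INR m.+1 * I m.+1 - (2 * INR m + 1) * I m).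
  apply: (is_RInt_minus (V := R_NormedModule)); apply: (is_RInt_scal (V := R_NormedModule));
  by apply: RInt_correct; apply: exI.
have := is_RInt_unique _ _ _ _ iF; rewrite (is_RInt_unique _ _ _ _ iF2); lra.
Qed.

Let J_rec m : I m.+1 + 2 * INR m.+1 ^ 2 * J m.+1 = INR m.+1 * (2 * INR m + 1) * J m.
Proof.
pose F x := x * cos x ^ (2 * m.+1) + INR m.+1 * x ^ 2 * (sin x * cos x ^ (2 * m).+1).
pose f x := cos x ^ (2 * m.+1) + (2 * INR m.+1 ^ 2 * (x ^ 2 * cos x ^ (2 * m.+1))
   - INR m.+1 * (2 * INR m + 1) * (x ^ 2 * cos x ^ (2 * m))).
have dF x : is_derive F x (f x).
  rewrite /F /f (_ : (2 * m.+1)%N = (2 * m).+2); last lia.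
  auto_derive => //.
  rewrite -/(INR (2 * m).+1) -/(INR (2 * m).+2) (S_INR (2 * m).+1) (S_INR (2 * m)) mult_INR (S_INR m) (_ : INR 2 = 2) //.
  move: (sin2_cos2 x); rewrite /Rsqr /= => sc.
  move: (INR m) (cos x ^ (2 * m)) (sin x) (cos x) sc => n c s d sc.
  have ss : s * s = 1 - d * d by lra.
  ring_simplify; rewrite (_ : s ^ 2 = 1 - d * d); last by rewrite -ss; ring.
  ring.
have iF : is_RInt f 0 (PI / 2) (minus (F (PI / 2)) (F 0)).
  apply: is_RInt_derive => x _; first exact: dF.
  by apply: ex_derive_continuous; rewrite /f; auto_derive.
have F0 : minus (F (PI / 2)) (F 0) = 0.
  rewrite /minus /plus /opp /F (_ : (2 * m.+1)%N = (2 * m).+2); last lia.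
  by rewrite /= cos_PI2; ring.
rewrite F0 in iF.
have iF2 : is_RInt f 0 (PI / 2) (I m.+1 + (2 * INR m.+1 ^ 2 * J m.+1 - INR m.+1 * (2 * INR m + 1) * J m)).
  apply: (is_RInt_plus (V := R_NormedModule)); first by apply: RInt_correct; apply: exI.
  apply: (is_RInt_minus (V := R_NormedModule)); apply: (is_RInt_scal (V := R_NormedModule));
  by apply: RInt_correct; apply: exJ.
have := is_RInt_unique _ _ _ _ iF; rewrite (is_RInt_unique _ _ _ _ iF2); lra.
Qed.

Let I0 : I 0 = PI / 2.
Proof.
rewrite /I (RInt_ext _ (fun=> 1)) => [|x _]; last by rewrite muln0.
by rewrite RInt_const /scal /= /mult /=; ring.
Qed.

Let I_gt0 m : 0 < I m.
Proof.
elim: m => [|m IHm]; first by rewrite I0; have := PI_RGT_0; lra.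
have m0 := pos_INR m; have := I_rec m; rewrite S_INR => h.
have h2 : 0 < (2 * INR m + 1) * I m by apply: Rmult_lt_0_compat => //; lra.
rewrite -h in h2; apply: (Rmult_lt_reg_l (2 * (INR m + 1))); lra.
Qed.

Let J0 : J 0 = (PI / 2) ^ 3 / 3.
Proof.
rewrite /J (RInt_ext _ (fun x => x ^ 2)) => [|x _]; last by rewrite muln0 /= Rmult_1_r.
apply: is_RInt_unique.
have -> : (PI / 2) ^ 3 / 3 = minus ((PI / 2) ^ 3 / 3) (0 ^ 3 / 3).
  by rewrite /minus /plus /opp /=; field.
apply: (is_RInt_derive (fun x => x ^ 3 / 3)) => x _; first by auto_derive => //; rewrite /INR; field.
by apply: ex_derive_continuous; auto_derive.
Qed.

Let J_ge0 m : 0 <= J m.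
Proof.
have P0 := PI_RGT_0; apply: RInt_ge_0; [lra|exact: exJ|move=> x x0].
by apply: Rmult_le_pos; [nra|rewrite pow_mult; apply: pow_le; nra].
Qed.

(** The derivative of [sin x - x cos x] is [x sin x], which is nonnegative here. *)
Let x_cos_le x : 0 <= x <= PI / 2 -> 0 <= x * cos x <= sin x.
Proof.
move=> x0; have P0 := PI_RGT_0; split.
  by apply: Rmult_le_pos; [lra|apply: cos_ge_0; lra].
have [t [tx]] : exists c, Rmin 0 x <= c <= Rmax 0 x /\
   (sin x - x * cos x) - (sin 0 - 0 * cos 0) = (c * sin c) * (x - 0).
  apply: (MVT_gen (fun x => sin x - x * cos x) 0 x (fun c => c * sin c)) => c cx.
    by auto_derive => //; ring.
  by apply: ex_derive_continuity_pt; auto_derive.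
rewrite Rmin_left ?Rmax_right in tx; try lra.
rewrite sin_0; have : 0 <= sin t by apply: sin_ge_0; lra.
move=> s0; have := Rmult_le_pos _ _ (proj1 tx) s0; nra.
Qed.

(** By [x_cos_le], [x^2 cos^(2m+2) <= sin^2 cos^(2m) = cos^(2m) - cos^(2m+2)] under the integral. *)
Let J_le m : J m.+1 <= I m - I m.+1.
Proof.
have P0 := PI_RGT_0.
have <- : RInt (fun x => cos x ^ (2 * m) - cos x ^ (2 * m.+1)) 0 (PI / 2) = I m - I m.+1.
  apply: is_RInt_unique; apply: (is_RInt_minus (V := R_NormedModule));
  by apply: RInt_correct; apply: exI.
apply: RInt_le; [lra|exact: exJ| |].
  by apply: ex_RInt_derivable => t; auto_derive.
move=> x x0; rewrite (_ : (2 * m.+1)%N = (2 * m).+2); last lia.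
have [h1 h2] := @x_cos_le x (ltac:(lra)).
have q0 : 0 <= cos x ^ (2 * m) by rewrite pow_mult; apply: pow_le; nra.
rewrite (_ : _ ^ 2 * _ = (x * cos x) ^ 2 * cos x ^ (2 * m)); last by rewrite /=; ring.
rewrite (_ : _ - _ = sin x ^ 2 * cos x ^ (2 * m)); last first.
  rewrite (_ : sin x ^ 2 = 1 - cos x ^ 2); last by have := sin2_cos2 x; rewrite /Rsqr /=; lra.
  by rewrite /=; ring.
by apply: Rmult_le_compat_r => //; apply: pow_incr.
Qed.

Lemma basel_sum N : \rsum_(k < N) (/ INR k.+1 ^ 2) = PI ^ 2 / 6 - 2 * J N / I N.
Proof.
have P0 := PI_RGT_0.
elim: N => [|N IHN]; first by rewrite big_ord0 I0 J0; field; lra.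
rewrite big_ord_recr /= in IHN *; rewrite IHN.
have n0 := pos_INR N; have := I_rec N; have := J_rec N; rewrite S_INR => hJ hI.
have i0 := I_gt0 N; have i1 := I_gt0 N.+1.
have IE : I N = 2 * (INR N + 1) * I N.+1 / (2 * INR N + 1) by rewrite hI; field; lra.
have JE : J N = (I N.+1 + 2 * (INR N + 1) ^ 2 * J N.+1) / ((INR N + 1) * (2 * INR N + 1)).
  by rewrite hJ; field; lra.
rewrite IE JE; field; lra.
Qed.

(** The remainder is [2 J / I] at [N.+1]. By [I_rec], [(2N+1) (I N - I N.+1) = I N.+1], so [J_le]
    gives [(2N+1) J N.+1 <= I N.+1]. *)
Lemma basel_bound N : 0 <= PI ^ 2 / 6 - \rsum_(k < N.+1) (/ INR k.+1 ^ 2) <= 2 / (2 * INR N + 1).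
Proof.
rewrite basel_sum; have n0 := pos_INR N; have i1 := I_gt0 N.+1.
have -> : PI ^ 2 / 6 - (PI ^ 2 / 6 - 2 * J N.+1 / I N.+1) = 2 * J N.+1 / I N.+1 by ring.
split; first by apply: Rdiv_le_0_compat => //; have := J_ge0 N.+1; lra.
have := J_le N; have := I_rec N; rewrite S_INR => hI hJ.
apply: (Rmult_le_reg_r (I N.+1 * (2 * INR N + 1))); first nra.
have -> : 2 * J N.+1 / I N.+1 * (I N.+1 * (2 * INR N + 1)) = 2 * J N.+1 * (2 * INR N + 1) by field; lra.
have -> : 2 / (2 * INR N + 1) * (I N.+1 * (2 * INR N + 1)) = 2 * I N.+1 by field; lra.
have : (2 * INR N + 1) * J N.+1 <= (2 * INR N + 1) * (I N - I N.+1) by apply: Rmult_le_compat_l; lra.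
lra.
Qed.

(** Equivalent to [zeta(2) < 2]. The partial sums are at most [7 / 4 - 1 / N], because [1 / k^2] is
    at most [1 / (k-1) - 1 / k] and the first two terms add up to [7 / 4 - 1 / 2]; [basel_bound]
    then adds at most [2 / 21] to the sum of 11 terms. *)
Lemma PI_sqr_lt : PI ^ 2 / 12 < 1.
Proof.
suff : forall N, \rsum_(k < N.+2) (/ INR k.+1 ^ 2) <= 7 / 4 - / INR N.+2.
  move=> h; have := basel_bound 9.+1; have := h 9%N.
  rewrite (_ : INR 10 = 10); last by rewrite INR_IZR_INZ.
  rewrite (_ : INR 11 = 11); last by rewrite INR_IZR_INZ.
  lra.
elim=> [|N IHN].
  rewrite !big_ord_recl big_ord0 /= (_ : INR 1 = 1) // (_ : INR 2 = 2) //; lra.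
rewrite big_ord_recr; rewrite /= in IHN *.
apply: Rle_trans (Rplus_le_compat_r _ _ _ IHN) _.
rewrite (S_INR N.+2); have n0 : 0 < INR N.+2 by apply: lt_0_INR; lia.
move: (INR N.+2) n0 => x x0.
have -> : / ((x + 1) * ((x + 1) * 1)) = / (x + 1) * / (x + 1) by field; lra.
have -> : / x = / (x + 1) + / (x + 1) * / x by field; lra.
have : / (x + 1) <= / x by apply: Rinv_le_contravar; lra.
have : 0 < / (x + 1) by apply: Rinv_0_lt_compat; lra.
nra.
Qed.
End Basel.

(** * The function u / (exp u - 1) *)

Lemma Series_ge0 (a : nat -> R) : (forall n, 0 <= a n) -> ex_series a -> 0 <= Series a.
Proof.
move=> a0 ea; rewrite -(Rmult_0_l (Series a)) -Series_scal_l.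
by apply: Series_le => // n; rewrite Rmult_0_l; split; [exact: Rle_refl|exact: a0].
Qed.

(* [expq i u] is the integral of [t ^ i * exp (t * u)] over [0, 1], as a power
   series; in particular [expq 0 u = (exp u - 1) / u]. *)
Definition expq_coef (i n : nat) : R := / (INR (fact n) * INR (n + i).+1).
Definition expq (i : nat) (u : R) : R := PSeries (expq_coef i) u.

Lemma expq_coef_gt0 i n : 0 < expq_coef i n.
Proof.
apply: Rinv_0_lt_compat; apply: Rmult_lt_0_compat; first exact: INR_fact_lt_0.
by apply: lt_0_INR; lia.
Qed.

Lemma CV_radius_expq i : CV_radius (expq_coef i) = p_infty.
Proof.
apply: CV_radius_infinite_DAlembert => [n|]; first by have := expq_coef_gt0 i n; lra.
apply: (is_lim_seq_le_le (fun=> 0) _ (fun n => / INR n.+1)).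
- move=> n; have a0 := expq_coef_gt0 i n; have a1 := expq_coef_gt0 i n.+1.
  rewrite Rabs_pos_eq; last by apply: Rdiv_le_0_compat => //; lra.
  split; first by apply: Rdiv_le_0_compat => //; lra.
  apply: (Rmult_le_reg_r (expq_coef i n)) => //.
  have -> : expq_coef i n.+1 / expq_coef i n * expq_coef i n = expq_coef i n.+1 by field; lra.
  have f0 := INR_fact_lt_0 n.
  have n0 : 0 < INR n.+1 by apply: lt_0_INR; lia.
  rewrite /expq_coef (_ : fact n.+1 = (n.+1 * fact n)%N) // mult_INR -Rinv_mult.
  apply: Rinv_le_contravar.
    by do 2!apply: Rmult_lt_0_compat => //; apply: lt_0_INR; lia.
  rewrite Rmult_assoc; apply: Rmult_le_compat_l; first lra.
  by apply: Rmult_le_compat_l; [lra|apply: le_INR; lia].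
- exact: is_lim_seq_const.
- apply: (proj1 (is_lim_seq_incr_1 (fun n => / INR n) 0)).
  apply: (is_lim_seq_inv _ p_infty) => //; exact: is_lim_seq_INR.
Qed.

Lemma ex_pseries_expq i u : ex_pseries (expq_coef i) u.
Proof. by apply: CV_radius_inside; rewrite CV_radius_expq. Qed.

Lemma is_derive_expq i u : is_derive (expq i) u (expq i.+1 u).
Proof.
have -> : expq i.+1 u = PSeries (PS_derive (expq_coef i)) u.
  apply: PSeries_ext => n; rewrite /PS_derive /expq_coef.
  rewrite (_ : fact n.+1 = (n.+1 * fact n)%N) // mult_INR.
  rewrite (_ : (n + i.+1)%N = (n.+1 + i)%N); last lia.
  have f0 := INR_fact_neq_0 n.
  have n0 : INR n.+1 <> 0 by apply: not_0_INR; lia.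
  have m0 : INR (n.+1 + i).+1 <> 0 by apply: not_0_INR; lia.
  by field.
by apply: is_derive_PSeries; rewrite CV_radius_expq.
Qed.

Lemma expq_le i u : 0 <= u -> 0 <= expq i u <= expq 0 u.
Proof.
move=> u0; have ex j := proj1 (ex_pseries_R _ _) (ex_pseries_expq j u).
have pos j n : 0 <= expq_coef j n * u ^ n.
  by apply: Rmult_le_pos; [have := expq_coef_gt0 j n; lra|exact: pow_le].
split.
  by apply: Series_ge0 => //; exact: ex.
apply: Series_le => [n|]; last exact: ex.
split; first exact: pos.
apply: Rmult_le_compat_r; first exact: pow_le.
have f0 := INR_fact_lt_0 n.
apply: Rinv_le_contravar.
  by apply: Rmult_lt_0_compat => //; apply: lt_0_INR; lia.
by apply: Rmult_le_compat_l; [lra|apply: le_INR; lia].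
Qed.

Lemma expq0E u : u * expq 0 u = exp u - 1.
Proof.
have E := is_exp_Reals u; rewrite -(is_pseries_unique _ _ _ E).
rewrite PSeries_decr_1; last by eexists; exact: E.
rewrite (_ : / INR (fact 0) = 1); last by rewrite /fact /= Rinv_1.
rewrite (_ : PSeries (PS_decr_1 _) u = expq 0 u); first ring.
apply: PSeries_ext => n; rewrite /PS_decr_1 /expq_coef addn0 -mult_INR; congr (/ INR _).
by rewrite Nat.mul_comm.
Qed.

Lemma expq0_gt0 u : 0 < expq 0 u.
Proof.
have [u0|[->|u0]] := Rtotal_order u 0.
- have := expq0E u; have : exp u < exp 0 by apply: exp_increasing.
  rewrite exp_0; nra.
- by rewrite /expq PSeries_0; exact: expq_coef_gt0.
- have := expq0E u; have : exp 0 < exp u by apply: exp_increasing.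
  rewrite exp_0; nra.
Qed.

(** The series starts with [1 + u / 2 + u^2 / 6], which dominates [(1 + u)^2 / 6], and its other
    terms are nonnegative. This is the source of the quadratic decay of [bose]. *)
Lemma expq0_ge u : 0 <= u -> (1 + u) ^ 2 / 6 <= expq 0 u.
Proof.
move=> u0.
have ex := ex_pseries_expq 0 u.
have ex1 : ex_pseries (PS_decr_1 (expq_coef 0)) u.
  by apply: CV_radius_inside; rewrite !CV_radius_decr_1 CV_radius_expq.
have ex2 : ex_pseries (PS_decr_1 (PS_decr_1 (expq_coef 0))) u.
  by apply: CV_radius_inside; rewrite !CV_radius_decr_1 CV_radius_expq.
have ex3 : ex_pseries (PS_decr_1 (PS_decr_1 (PS_decr_1 (expq_coef 0)))) u.
  by apply: CV_radius_inside; rewrite !CV_radius_decr_1 CV_radius_expq.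
rewrite /expq PSeries_decr_1 // (PSeries_decr_1 (PS_decr_1 (expq_coef 0))) //.
rewrite (PSeries_decr_1 (PS_decr_1 (PS_decr_1 (expq_coef 0)))) //.
set S := PSeries _ _.
have S0 : 0 <= S.
  apply: Series_ge0 => [n|]; last by apply/ex_pseries_R.
  by apply: Rmult_le_pos; [apply/Rlt_le/expq_coef_gt0|exact: pow_le].
rewrite /PS_decr_1 /expq_coef /fact /INR /=.
have := Rmult_le_pos _ _ u0 S0; nra.
Qed.

(* The derivatives of [u / (exp u - 1)] are polynomials in the ratios
   [expq i / expq 0], which lie in [0, 1], times the function itself; hence they
   all decay like it. *)
Inductive rexp := RCst of R | RVar of nat | RAdd of rexp & rexp | RMul of rexp & rexp.

Fixpoint reval (e : rexp) (u : R) : R :=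
  match e with
  | RCst c => c
  | RVar i => expq i u / expq 0 u
  | RAdd a b => reval a u + reval b u
  | RMul a b => reval a u * reval b u
  end.

Fixpoint rderiv (e : rexp) : rexp :=
  match e with
  | RCst c => RCst 0
  | RVar i => RAdd (RVar i.+1) (RMul (RCst (- 1)) (RMul (RVar i) (RVar 1)))
  | RAdd a b => RAdd (rderiv a) (rderiv b)
  | RMul a b => RAdd (RMul (rderiv a) b) (RMul a (rderiv b))
  end.

Fixpoint rbound (e : rexp) : R :=
  match e with
  | RCst c => Rabs c
  | RVar i => 1
  | RAdd a b => rbound a + rbound b
  | RMul a b => rbound a * rbound b
  end.

Lemma is_derive_reval e u : is_derive (reval e) u (reval (rderiv e) u).
Proof.
elim: e => [c|i|a IHa b IHb|a IHa b IHb] /=; first exact: is_derive_const.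
- have h0 := expq0_gt0 u; have d0 := is_derive_expq 0 u; have di := is_derive_expq i u.
  auto_derive.
    by split; [eexists; exact: di|split; [eexists; exact: d0|split => //; lra]].
  rewrite (is_derive_unique _ _ _ d0 : Derive (fun x => expq 0 x) u = _).
  rewrite (is_derive_unique _ _ _ di : Derive (fun x => expq i x) u = _).
  by field; lra.
- exact: is_derive_plus.
- have := is_derive_mult _ _ _ _ _ IHa IHb (fun x y => Rmult_comm x y).
  rewrite /plus /mult /=; exact.
Qed.

Lemma reval_bound e u : 0 <= u -> Rabs (reval e u) <= rbound e.
Proof.
move=> u0; elim: e => [c|i|a IHa b IHb|a IHa b IHb] /=; first exact: Rle_refl.
- have h0 := expq0_gt0 u; have [h1 h2] := expq_le i u0.
  rewrite Rabs_pos_eq; last exact: Rdiv_le_0_compat.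
  by apply: (Rmult_le_reg_r (expq 0 u)) => //; rewrite /Rdiv Rmult_assoc Rinv_l; lra.
- by apply: Rle_trans (Rabs_triang _ _) _; lra.
- by rewrite Rabs_mult; apply: Rmult_le_compat => //; exact: Rabs_pos.
Qed.

(** The function [u / (exp u - 1)]; dividing by the entire function [expq 0], which has no zero,
    makes it smooth at 0 without a case distinction. *)
Definition bose (u : R) : R := / expq 0 u.

(** The [j]-th derivative of [bose] is this expression times [bose]; the recursion is the product
    rule together with [bose' = - bose * (expq 1 / expq 0)]. *)
Fixpoint bose_exp (j : nat) : rexp :=
  if j is j'.+1 then RAdd (rderiv (bose_exp j')) (RMul (RCst (- 1)) (RMul (bose_exp j') (RVar 1)))
  else RCst 1.

Definition bose_deriv (j : nat) (u : R) : R := reval (bose_exp j) u * bose u.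

Lemma is_derive_bose_deriv j u : is_derive (bose_deriv j) u (bose_deriv j.+1 u).
Proof.
have h0 := expq0_gt0 u; have d0 := is_derive_expq 0 u; have dj := is_derive_reval (bose_exp j) u.
rewrite /bose_deriv /bose; auto_derive.
  by split; [eexists; exact: dj|split; [eexists; exact: d0|split => //; lra]].
rewrite (is_derive_unique _ _ _ d0 : Derive (fun x => expq 0 x) u = _).
rewrite (is_derive_unique _ _ _ dj : Derive (fun x => reval (bose_exp j) x) u = _).
by rewrite /=; field; lra.
Qed.

Lemma bose_deriv0 u : bose_deriv 0 u = bose u.
Proof. by rewrite /bose_deriv /= Rmult_1_l. Qed.

Lemma bose_gt0 u : 0 < bose u.
Proof. by apply: Rinv_0_lt_compat; exact: expq0_gt0. Qed.

Lemma bose_le u : 0 <= u -> bose u <= 6 / (1 + u) ^ 2.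
Proof.
move=> u0; have -> : 6 / (1 + u) ^ 2 = / ((1 + u) ^ 2 / 6) by field; nra.
by apply: Rinv_le_contravar; [nra|exact: expq0_ge].
Qed.

Lemma bose_deriv_le j u : 0 <= u ->
  Rabs (bose_deriv j u) <= 6 * rbound (bose_exp j) / (1 + u) ^ 2.
Proof.
move=> u0; rewrite Rabs_mult (Rabs_pos_eq (bose u)); last exact/Rlt_le/bose_gt0.
have b0 := bose_gt0 u.
rewrite (_ : 6 * _ / _ = rbound (bose_exp j) * (6 / (1 + u) ^ 2)); last by rewrite /Rdiv; ring.
apply: Rmult_le_compat; [exact: Rabs_pos|lra|exact: reval_bound|exact: bose_le].
Qed.

Lemma bose0 : bose 0 = 1.
Proof. by rewrite /bose /expq PSeries_0 /expq_coef /fact /INR /=; field. Qed.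

Lemma boseE u : 0 < u -> bose u = u * exp (- u) / (1 - exp (- u)).
Proof.
move=> u0; have := expq0E u; have h := expq0_gt0 u; rewrite exp_Ropp.
have e1 : 1 < exp u by rewrite -exp_0; exact: exp_increasing.
move=> E; rewrite /bose (_ : expq 0 u = (exp u - 1) / u); last by rewrite -E; field; lra.
by field; lra.
Qed.

Lemma bose_le1 u : 0 <= u -> 0 <= bose u <= 1.
Proof.
move=> u0; split; first exact/Rlt_le/bose_gt0.
have [u1|<-] := u0; last by rewrite bose0; lra.
have h := expq0_gt0 u; have := expq0E u; have := exp_ineq1_le u => e1 E.
rewrite /bose -Rinv_1; apply: Rinv_le_contravar; nra.
Qed.

Lemma ex_RInt_bose a b : ex_RInt bose a b.
Proof.
apply: ex_RInt_derivable => t; apply: (ex_derive_ext (bose_deriv 0)) => [u|].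
  exact: bose_deriv0.
by eexists; exact: is_derive_bose_deriv.
Qed.

(** A finite geometric series with its exact remainder. It links the inner sums over [e] to [bose],
    both in the cumulants and in the evaluation of the integral. *)
Lemma bose_geom M u : 0 <= u ->
  bose u = \rsum_(e < M) (u * exp (- (INR e.+1 * u))) + exp (- (INR M * u)) * bose u.
Proof.
elim: M => [|M IHM] u0.
  by rewrite big_ord0 (_ : INR 0 = 0) // Rmult_0_l Ropp_0 exp_0; ring.
rewrite {1}IHM // big_ord_recr /= Rplus_assoc; congr (_ + _).
have [u1|<-] := u0; last first.
  by rewrite !Rmult_0_r Ropp_0 exp_0; ring.
rewrite boseE // S_INR.
have -> : - ((INR M + 1) * u) = - (INR M * u) + - u by ring.
rewrite exp_plus; have e1 : exp (- u) < 1 by rewrite -exp_0; apply: exp_increasing; lra.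
by field; lra.
Qed.

(** Integrating the geometric series term by term gives [sum 1 / e^2] up to boundary terms at [U].
    Those are dominated by [2 * bose U], which decays quadratically. *)
Lemma RInt_bose U : 1 <= U -> Rabs (RInt bose 0 U - PI ^ 2 / 6) <= 12 / (1 + U) ^ 2.
Proof.
move=> U1; apply: le_epsilon => eps eps0.
(* The geometric remainder costs at most [1 / M] and the Basel remainder at most [2 / M], together
   less than [4 / M <= eps]. *)
pose M := (Z.to_nat (up (4 / eps))).+1.
have M1 : 4 / eps <= INR M.
  have [u1 _] := archimed (4 / eps).
  by apply: Rle_trans (Rlt_le _ _ u1) _; rewrite INR_IZR_INZ; apply: IZR_le; rewrite /M; lia.
have M0 : 0 < INR M by apply: lt_0_INR; rewrite /M; lia.
have Me : 4 / INR M <= eps.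
  apply: (Rmult_le_reg_r (INR M)) => //.
  have -> : 4 / INR M * INR M = 4 by field; lra.
  have := Rmult_le_compat_r eps _ _ (ltac:(lra)) M1.
  have -> : 4 / eps * eps = 4 by field; lra.
  lra.
pose tail := RInt (fun u => exp (- (INR M * u)) * bose u) 0 U.
have ext : ex_RInt (fun u => exp (- (INR M * u)) * bose u) 0 U.
  apply: ex_RInt_derivable => t; apply: (ex_derive_ext (fun u => exp (- (INR M * u)) * bose_deriv 0 u)).
    by move=> u; rewrite bose_deriv0.
  apply: ex_derive_mult; first by auto_derive.
  by eexists; exact: is_derive_bose_deriv.
have exM : is_RInt (fun u => exp (- (INR M * u))) 0 U (minus (- exp (- (INR M * U)) / INR M) (- exp (- (INR M * 0)) / INR M)).
  apply: (is_RInt_derive (fun u => - exp (- (INR M * u)) / INR M)) => x _.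
    by auto_derive => //; field; lra.
  by apply: ex_derive_continuous; auto_derive.
have tail0 : 0 <= tail.
  apply: RInt_ge_0; [lra|exact: ext|move=> x x0].
  by apply: Rmult_le_pos; [exact/Rlt_le/exp_pos|exact/Rlt_le/bose_gt0].
have tail1 : tail <= 1 / INR M.
  apply: Rle_trans (RInt_le _ (fun u => exp (- (INR M * u))) 0 U _ ext _ _) _; first lra.
  - by eexists; exact: exM.
  - move=> x x0; have e0 := exp_pos (- (INR M * x)); have := bose_le1 (u := x); nra.
  rewrite (is_RInt_unique _ _ _ _ exM) /minus /plus /opp /= Rmult_0_r Ropp_0 exp_0.
  have := exp_pos (- (INR M * U)); have := Rinv_0_lt_compat _ M0; rewrite /Rdiv; nra.
have part : is_RInt bose 0 U (\rsum_(e < M) ((/ INR e.+1 ^ 2) - (U / INR e.+1 + / INR e.+1 ^ 2) * exp (- (INR e.+1 * U))) + tail).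
  apply: (is_RInt_ext (fun u => \rsum_(e < M) (u * exp (- (INR e.+1 * u))) + exp (- (INR M * u)) * bose u)).
    by move=> x; rewrite Rmin_left ?Rmax_right; try lra; move=> x0; rewrite -bose_geom //; lra.
  apply: (is_RInt_plus (V := R_NormedModule)); last by apply: RInt_correct.
  refine (is_RInt_rsum (F := fun (e : 'I_M) u => u * exp (- (INR e.+1 * u))) _) => e.
  have e0 : 0 < INR e.+1 by apply: lt_0_INR; lia.
  pose F u := - (u / INR e.+1 + / INR e.+1 ^ 2) * exp (- (INR e.+1 * u)).
  have -> : / INR e.+1 ^ 2 - (U / INR e.+1 + / INR e.+1 ^ 2) * exp (- (INR e.+1 * U)) = minus (F U) (F 0).
    by rewrite /F /minus /plus /opp /= Rmult_0_r Ropp_0 exp_0; field; lra.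
  apply: is_RInt_derive => x _.
    by rewrite /F; move: (INR e.+1) e0 => a a0; auto_derive => //; field; lra.
  by apply: ex_derive_continuous; auto_derive.
rewrite (is_RInt_unique _ _ _ _ part) rsum_minus.
have Mb := basel_bound (Z.to_nat (up (4 / eps))); rewrite -/M in Mb.
set S1 := \rsum_(e < M) (/ INR e.+1 ^ 2) in Mb *; set S2 := \rsum_(e < M) _.
have S2_0 : 0 <= S2.
  apply: rsum_ge0 => e; have e0 : 0 < INR e.+1 by apply: lt_0_INR; lia.
  apply: Rmult_le_pos; last exact/Rlt_le/exp_pos.
  have := Rinv_0_lt_compat _ (pow_lt _ 2 e0); have := Rdiv_lt_0_compat U _ (ltac:(lra)) e0; lra.
(* As [U >= 1], the factor [U / e + 1 / e^2] is at most [2 U], and the sum of [U exp (- e U)] is a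
   partial sum of [bose U]. *)
have S2_1 : S2 <= 12 / (1 + U) ^ 2.
  have : S2 <= \rsum_(e < M) (2 * (U * exp (- (INR e.+1 * U)))).
    apply: rsum_le => e; have e0 : 1 <= INR e.+1 by apply: (le_INR 1); lia.
    rewrite -Rmult_assoc; apply: Rmult_le_compat_r; first exact/Rlt_le/exp_pos.
    have i1 : / INR e.+1 <= 1 by rewrite -Rinv_1; apply: Rinv_le_contravar; lra.
    have i0 : 0 < / INR e.+1 by apply: Rinv_0_lt_compat; lra.
    rewrite /= Rmult_1_r Rinv_mult /Rdiv; nra.
  rewrite -big_distrr => h; apply: Rle_trans h _.
  have -> : 12 / (1 + U) ^ 2 = 2 * (6 / (1 + U) ^ 2) by rewrite /Rdiv; ring.
  apply: Rmult_le_compat_l; first lra.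
  apply: Rle_trans _ (@bose_le U (ltac:(lra))).
  rewrite (@bose_geom M U); last lra.
  have := Rmult_lt_0_compat _ _ (exp_pos (- (INR M * U))) (bose_gt0 U).
  rewrite /=; lra.
have n0 := pos_INR (Z.to_nat (up (4 / eps))).
have Mb2 : 2 / (2 * INR (Z.to_nat (up (4 / eps))) + 1) <= 2 / INR M.
  by apply: Rmult_le_compat_l; [lra|apply: Rinv_le_contravar => //; rewrite /M S_INR; lra].
have E2 : 2 / INR M = 2 * / INR M by [].
have E1 : 1 / INR M = 1 * / INR M by [].
have E4 : 4 / INR M = 4 * / INR M by [].
have iM := Rinv_0_lt_compat _ M0.
apply: Rabs_le; split; lra.
Qed.

(** * Cumulants *)

Lemma rsum_const n (c : R) : \rsum_(i < n) c = INR n * c.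
Proof.
elim: n => [|n IHn]; first by rewrite big_ord0 /INR; ring.
by rewrite big_ord_recr /= IHn S_INR; ring.
Qed.

(** The family fed to the Euler-Maclaurin section: index 0 is the antiderivative of [bose] that
    vanishes at infinity, so the derivatives of [bose] are shifted by one. *)
Definition bose_int (j : nat) (u : R) : R :=
  if j is j'.+1 then bose_deriv j' u else RInt bose 0 u - PI ^ 2 / 6.

Lemma is_derive_bose_int j u : is_derive (bose_int j) u (bose_int j.+1 u).
Proof.
case: j => [|j]; last exact: is_derive_bose_deriv.
rewrite /= -[bose_deriv 0 u]Rminus_0_r; apply: is_derive_minus; last exact: is_derive_const.
rewrite bose_deriv0; apply: (is_derive_RInt _ _ 0).
  by apply: filter_forall => x; apply: RInt_correct; exact: ex_RInt_bose.
apply: ex_derive_continuous; apply: (ex_derive_ext (bose_deriv 0)) => [v|].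
  exact: bose_deriv0.
by eexists; exact: is_derive_bose_deriv.
Qed.

Definition bose_int_bound (j : nat) : R :=
  if j is j'.+1 then 6 * rbound (bose_exp j') else 0.

Lemma bose_int_le j u : 0 <= u ->
  Rabs (bose_int j.+1 u) <= bose_int_bound j.+1 / (1 + u) ^ 2.
Proof. exact: bose_deriv_le. Qed.

Lemma bose_int_lim e : 0 < e -> exists U, forall u, U <= u -> Rabs (bose_int 0 u) <= e.
Proof.
move=> e0; exists (1 + 12 / e) => u Uu.
have d0 : 0 < 12 / e by apply: Rdiv_lt_0_compat; lra.
apply: Rle_trans (@RInt_bose u _) _; first lra.
apply: (Rmult_le_reg_r ((1 + u) ^ 2)); first nra.
have -> : 12 / (1 + u) ^ 2 * (1 + u) ^ 2 = 12 by field; nra.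
have h : 12 <= e * u.
  have : 12 / e <= u by lra.
  move=> /(Rmult_le_compat_r e _ _ (ltac:(lra))).
  have -> : 12 / e * e = 12 by field; lra.
  lra.
nra.
Qed.

(** [kap 0] is the truncated logarithm of the Euler product of [1 / (1 - exp (- d u))], and [kap j]
    is [(-1)^j] times its [j]-th derivative. *)
Definition kap (j N : nat) (u : R) : R :=
  \rsum_(d < N) \rsum_(e < N) (exp (- (INR (d.+1 * e.+1) * u)) / INR e.+1 * INR (d.+1 * e.+1) ^ j).

Lemma exp_ge_sqr x : 0 <= x -> x ^ 2 / 4 <= exp x.
Proof.
move=> x0; rewrite (_ : x = x / 2 + x / 2); last field.
rewrite exp_plus; have := exp_ineq1_le (x / 2); nra.
Qed.

(** For [j = 1] the weight [d e / e] does not depend on [e], so the inner sum is geometric and the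
    outer one is a Riemann sum of [bose]. No other cumulant has this form. *)
Lemma kap1_riemann N u : 0 < u -> u ^ 2 * kap 1 N u =
  riemann bose_int 1 N u - \rsum_(d < N) (u * (exp (- (INR N * (INR d.+1 * u))) * bose (INR d.+1 * u))).
Proof.
move=> u0; rewrite /riemann -rsum_minus /kap big_distrr; apply: eq_bigr => d _ /=.
rewrite bose_deriv0.
have d0 : 0 < INR d.+1 by apply: lt_0_INR; lia.
have := @bose_geom N (INR d.+1 * u) (ltac:(nra)).
set S := \rsum_(e < N) _ => hS.
rewrite (_ : u * bose _ - _ = u * S); last by rewrite {1}hS; ring.
rewrite /S !big_distrr; apply: eq_bigr => e _ /=.
have e0 : 0 < INR e.+1 by apply: lt_0_INR; lia.
rewrite mult_INR (_ : INR d.+1 * INR e.+1 * u = INR e.+1 * (INR d.+1 * u)); last ring.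
by field; lra.
Qed.

(** The leading terms are [- bose_int 0 0 = PI^2 / 6] and [bose 0 / 2 = 1 / 2]; the term [- u / 2]
    is what integrates to [(ln u) / 2] in [kap0_asym]. *)
Lemma kap1_approx K : exists l,
  evapprox (fun N u => u ^ 2 * kap 1 N u) (fun u => PI ^ 2 / 6 - u / 2 + u ^ 2 * pe l u) K.+2.
Proof.
have [l hl] := riemann_poly2 (fun j u _ => is_derive_bose_int j u) bose_int_le bose_int_lim 0 K.
have err : evapprox (fun N u => - \rsum_(d < N) (u * (exp (- (INR N * (INR d.+1 * u))) * bose (INR d.+1 * u))))
   (fun=> 0) K.+2.
  exists 1 => [|s s01]; first lra.
  have s4 : 0 < s ^ K.+4 by apply: pow_lt; lra.
  (* The truncation error is at most [N exp (- N s) <= 4 / (N s^2)], and this choice brings it below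
     [s ^ K.+2]. *)
  exists (Z.to_nat (up (4 / s ^ K.+4))).+1 => N NN u su.
  have N1 : 4 / s ^ K.+4 <= INR N.
    have [u1 _] := archimed (4 / s ^ K.+4).
    by apply: Rle_trans (Rlt_le _ _ u1) _; rewrite INR_IZR_INZ; apply: IZR_le; lia.
  have N0 : 0 < INR N by apply: lt_0_INR; lia.
  rewrite Rminus_0_r Rabs_Ropp Rmult_1_l.
  apply: Rle_trans (_ : \rsum_(d < N) exp (- (INR N * s)) <= _).
    apply: Rabs_rsum_le => d; have d1 : 1 <= INR d.+1 by apply: (le_INR 1); lia.
    have [b0 b1] := @bose_le1 (INR d.+1 * u) (ltac:(nra)).
    have e0 := exp_pos (- (INR N * (INR d.+1 * u))).
    rewrite Rabs_pos_eq; last by apply: Rmult_le_pos; [lra|nra].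
    apply: Rle_trans (_ : exp (- (INR N * (INR d.+1 * u))) <= _); last first.
      by apply: exp_le; apply: Ropp_le_contravar; apply: Rmult_le_compat_l; nra.
    have : exp (- (INR N * (INR d.+1 * u))) * bose (INR d.+1 * u) <= exp (- (INR N * (INR d.+1 * u))) * 1.
      by apply: Rmult_le_compat_l; lra.
    move: (exp _ * bose _) => q; nra.
  rewrite rsum_const.
  apply: Rle_trans (_ : s ^ K.+2 <= _); last by apply: pow_incr; lra.
  rewrite exp_Ropp; have ns : 0 < INR N * s by nra.
  have := exp_ge_sqr (Rlt_le _ _ ns) => ge.
  apply: Rle_trans (_ : INR N * / ((INR N * s) ^ 2 / 4) <= _).
    apply: Rmult_le_compat_l; first lra.
    by apply: Rinv_le_contravar => //; nra.
  have -> : INR N * / ((INR N * s) ^ 2 / 4) = 4 / (INR N * s ^ 2) by field; nra.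
  apply: (Rmult_le_reg_r (INR N * s ^ 2)); first nra.
  have -> : 4 / (INR N * s ^ 2) * (INR N * s ^ 2) = 4 by field; nra.
  have := Rmult_le_compat_r (s ^ K.+4) _ _ (ltac:(lra)) N1.
  have -> : 4 / s ^ K.+4 * s ^ K.+4 = 4 by field; lra.
  rewrite /=; lra.
exists l; apply: evapprox_ext (evapprox_plus hl err) => [N u u0|u u0].
  by rewrite kap1_riemann; lra.
rewrite /= bose_deriv0 bose0 RInt_point /zero /=; lra.
Qed.

(* As [evapprox], but pointwise in [u] and for small [u] only. *)
Definition asym (f : nat -> R -> R) (p : R -> R) (K : nat) : Prop :=
  exists C b, [/\ 0 <= C, 0 < b <= 1 & forall u, 0 < u <= b -> exists N0, forall N, (N0 <= N)%N ->
    Rabs (f N u - p u) <= C * u ^ K].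

Lemma evapprox_asym f p K : evapprox f p K -> asym f p K.
Proof.
move=> [C C0 hC]; exists C, 1; split => //; first lra.
by move=> u u01; have [N0 h] := hC u u01; exists N0 => N NN; apply: h => //; lra.
Qed.

(** The new numerator is [m p - v p'], hence its value [m p(0)] at 0. Following this value through
    all derivatives produces the factorials in [kap_asym]. *)
Lemma pe_div_deriv l m : exists l', pe l' 0 = INR m * pe l 0 /\
  forall u, 0 < u -> is_derive (fun v => pe l v / v ^ m) u (- (pe l' u / u ^ m.+1)).
Proof.
elim: l => [|a l [l' [_ dl]]].
  exists [::]; split => [|u u0] /=; first ring.
  apply: (is_derive_ext (fun=> 0)) => [v|]; first by rewrite /Rdiv Rmult_0_l.
  by rewrite /Rdiv Rmult_0_l Ropp_0; exact: is_derive_const.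
have [l1 l1E] := pe_scal (-1) l; have [l2 l2E] := pe_add l' l1.
exists (INR m * a :: l2); split => [|u u0] /=; first ring.
have d0 := dl u u0; have um : 0 < u ^ m by apply: pow_lt.
have E v : a / v ^ m + v * (pe l v / v ^ m) = pe (a :: l) v / v ^ m by rewrite /Rdiv /=; ring.
apply: (is_derive_ext _ _ _ _ E).
have dm : is_derive (fun v => a / v ^ m) u (- (INR m * a / u ^ m.+1)).
  case: m um {dl d0 E} => [|m] um.
    have -> : - (INR 0 * a / u ^ 1) = 0 by rewrite (_ : INR 0 = 0) //; field; lra.
    have E0 v : a = a / v ^ 0 by rewrite /=; field.
    by apply: (is_derive_ext _ _ _ _ E0); exact: is_derive_const.
  have -> : - (INR m.+1 * a / u ^ m.+2) = a * (- (INR m.+1 * 1 * u ^ m) / (u ^ m.+1) ^ 2).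
    have um' : 0 < u ^ m by apply: pow_lt.
    by rewrite /=; move: (u ^ m) um' => x x0; field; lra.
  apply: is_derive_scal; apply: (is_derive_inv (fun v => v ^ m.+1)); last lra.
  by apply: (is_derive_pow (fun v => v) m.+1 u 1); exact: is_derive_id.
have dv : is_derive (fun v => v * (pe l v / v ^ m)) u
    (1 * (pe l u / u ^ m) + u * - (pe l' u / u ^ m.+1)).
  exact: (is_derive_mult (fun v => v) _ u 1 _ (is_derive_id u) d0 (fun x y => Rmult_comm x y)).
have -> : - (pe (INR m * a :: l2) u / u ^ m.+1) =
    - (INR m * a / u ^ m.+1) + (1 * (pe l u / u ^ m) + u * - (pe l' u / u ^ m.+1)).
  rewrite /= l2E l1E; move: (INR m) (pe l u) (pe l' u) (u ^ m) um => x y z t t0.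
  by field; lra.
exact: is_derive_plus dm dv.
Qed.

(** The constraints on [h] and [u] keep every point between [u / 2] and [2 u <= 1], where numerators
    are bounded and powers of the argument are comparable to those of [u]. *)
Lemma pe_div_taylor l m : exists l' C, [/\ pe l' 0 = INR m * pe l 0, 0 <= C &
  forall u h, 0 < u <= / 2 -> - (u / 2) <= h <= u ->
  Rabs (pe l (u + h) / (u + h) ^ m - pe l u / u ^ m + h * (pe l' u / u ^ m.+1)) <=
    C * h ^ 2 / u ^ m.+2].
Proof.
have [l1 [l1E d1]] := pe_div_deriv l m; have [l2 [_ d2]] := pe_div_deriv l1 m.+1.
have [C C0 hC] := pe_bounded l2.
exists l1, (C * 2 ^ m.+2); split => //.
  by apply: Rmult_le_pos => //; apply: pow_le; lra.
move=> u h u0 uh; pose v := u + h.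
have [uv hE] : u / 2 <= v <= 2 * u /\ h = v - u by rewrite /v; split; lra.
rewrite -/v hE; clearbody v; move: uv {uh} => uv; clear h hE.
have box t : Rmin u v <= t <= Rmax u v -> u / 2 <= t <= 2 * u.
  by rewrite /Rmin /Rmax; case: Rle_dec; lra.
have um : 0 < u ^ m.+2 by apply: pow_lt; lra.
have dd t : Rmin u v <= t <= Rmax u v -> Rabs (pe l2 t / t ^ m.+2) <= C * 2 ^ m.+2 / u ^ m.+2.
  move=> /box tb; have tm : 0 < t ^ m.+2 by apply: pow_lt; lra.
  rewrite /Rdiv Rabs_mult (Rabs_pos_eq (/ _)); last exact/Rlt_le/Rinv_0_lt_compat.
  rewrite Rmult_assoc; apply: Rmult_le_compat; [exact: Rabs_pos|exact/Rlt_le/Rinv_0_lt_compat| |].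
    by apply: hC; rewrite Rabs_pos_eq; lra.
  have -> : 2 ^ m.+2 * / u ^ m.+2 = / (u / 2) ^ m.+2.
    by rewrite Rpow_mult_distr pow_inv Rinv_mult Rinv_inv Rmult_comm.
  by apply: Rinv_le_contravar; [apply: pow_lt; lra|apply: pow_incr; lra].
have s1 t : Rmin u v <= t <= Rmax u v ->
    Rabs (pe l1 t / t ^ m.+1 - pe l1 u / u ^ m.+1) <= C * 2 ^ m.+2 / u ^ m.+2 * Rabs (v - u).
  move=> tuv; have sub s : Rmin u t <= s <= Rmax u t -> Rmin u v <= s <= Rmax u v.
    by move: tuv; rewrite /Rmin /Rmax; do 2!case: Rle_dec; lra.
  apply: Rle_trans (mvt_bound (f := fun t => pe l1 t / t ^ m.+1)
    (df := fun t => - (pe l2 t / t ^ m.+2)) (M := C * 2 ^ m.+2 / u ^ m.+2) _ _) _.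
  - by move=> s /sub /box sb; apply: d2; lra.
  - by move=> s /sub sb; rewrite Rabs_Ropp; exact: dd.
  apply: Rmult_le_compat_l.
    apply: Rmult_le_pos; last exact/Rlt_le/Rinv_0_lt_compat.
    by apply: Rmult_le_pos => //; apply: pow_le; lra.
  by move: tuv; rewrite /Rmin /Rmax /Rabs; case: Rle_dec; do 2!case: Rcase_abs; lra.
have := mvt_bound (f := fun t => pe l t / t ^ m + t * (pe l1 u / u ^ m.+1))
  (df := fun t => - (pe l1 t / t ^ m.+1) + pe l1 u / u ^ m.+1) (a := u) (b := v)
  (M := C * 2 ^ m.+2 / u ^ m.+2 * Rabs (v - u)).
move=> /(_ _ _) mvb.
rewrite (_ : _ + _ = pe l v / v ^ m + v * (pe l1 u / u ^ m.+1) - (pe l u / u ^ m + u * (pe l1 u / u ^ m.+1))); last ring.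
apply: Rle_trans (mvb _ _) _.
- move=> t /box tb; apply: (is_derive_plus (fun t => pe l t / t ^ m)); first by apply: d1; lra.
  by move: (pe l1 u / u ^ m.+1) => k; auto_derive => //; ring.
- move=> t tb; rewrite Rplus_comm -/(Rminus _ _) Rabs_minus_sym; exact: s1.
have sq : Rabs (v - u) * Rabs (v - u) = (v - u) ^ 2.
  by rewrite -Rabs_mult Rabs_pos_eq; [ring|exact: Rle_0_sqr].
by rewrite Rmult_assoc sq; apply: Req_le; rewrite /Rdiv; ring.
Qed.

(* Since [f] is convex, its difference quotients with step [h = u ^ K.+2] enclose
   the derivative, so an expansion of [f] can be differentiated. *)
Lemma asym_deriv (f g : nat -> R -> R) m l K :
  (forall N u, 0 < u -> is_derive (f N) u (- g N u)) ->
  (forall N u v, 0 < u <= v -> g N v <= g N u) ->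
  asym (fun N u => u ^ m * f N u) (pe l) (2 * K).+1 ->
  exists l', pe l' 0 = INR m * pe l 0 /\ asym (fun N u => u ^ m.+1 * g N u) (pe l') K.
Proof.
move=> df mg [C [b [C0 b0 hC]]].
have [l' [C3 [l'0 C30 hT]]] := pe_div_taylor l m.
exists l'; split => //.
pose C2 := C * 2 ^ (2 * K).+1 * 2 ^ m.
have C20 : 0 <= C2 by do 2!(apply: Rmult_le_pos; last by apply: pow_le; lra).
exists (C3 + 2 * C2), (b / 2); split; [lra|lra|move=> u u0].
have [h hE] : exists h, h = u ^ K.+2 by eexists.
have h0 : 0 < h by rewrite hE; apply: pow_lt; lra.
have hu : h <= u / 2.
  have u1 : u ^ K <= 1 by rewrite -(pow1 K); apply: pow_incr; lra.
  have u2 : 0 < u ^ K by apply: pow_lt; lra.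
  by rewrite hE /=; nra.
have [N1 hN1] := hC (u + - h) (ltac:(lra)).
have [N2 hN2] := hC u (ltac:(lra)).
have [N3 hN3] := hC (u + h) (ltac:(lra)).
exists (maxn N1 (maxn N2 N3)) => N NN.
have {}hN1 := hN1 N (ltac:(lia)); have {}hN2 := hN2 N (ltac:(lia)); have {}hN3 := hN3 N (ltac:(lia)).
pose E := C2 * u ^ (2 * K).+1 / u ^ m.
have um : 0 < u ^ m by apply: pow_lt; lra.
have near v : u / 2 <= v <= 2 * u -> Rabs (v ^ m * f N v - pe l v) <= C * v ^ (2 * K).+1 ->
    Rabs (f N v - pe l v / v ^ m) <= E.
  move=> uv hv; have vm : 0 < v ^ m by apply: pow_lt; lra.
  have -> : f N v - pe l v / v ^ m = (v ^ m * f N v - pe l v) * / v ^ m by field; lra.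
  rewrite Rabs_mult (Rabs_pos_eq (/ _)); last exact/Rlt_le/Rinv_0_lt_compat.
  have -> : E = (C * (2 * u) ^ (2 * K).+1) * / (u / 2) ^ m.
    rewrite /E /C2 !Rpow_mult_distr pow_inv Rinv_mult Rinv_inv /Rdiv; ring.
  apply: Rmult_le_compat; [exact: Rabs_pos|exact/Rlt_le/Rinv_0_lt_compat| |].
    by apply: Rle_trans hv _; apply: Rmult_le_compat_l => //; apply: pow_incr; lra.
  by apply: Rinv_le_contravar; [apply: pow_lt; lra|apply: pow_incr; lra].
have e1 := near (u + - h) (ltac:(lra)) hN1.
have e2 := near u (ltac:(lra)) hN2.
have e3 := near (u + h) (ltac:(lra)) hN3.
have mv a c : 0 < a <= c -> exists2 x, a <= x <= c & f N c - f N a = - g N x * (c - a).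
  move=> ac; have [x [xa xE]] : exists x, Rmin a c <= x <= Rmax a c /\ f N c - f N a = - g N x * (c - a).
    apply: (MVT_gen (f N) a c (fun x => - g N x)) => x; rewrite Rmin_left ?Rmax_right; try lra => xac.
      by move=> xac; apply: df; lra.
    by move=> xac; apply: ex_derive_continuity_pt; eexists; apply: df; lra.
  by rewrite Rmin_left ?Rmax_right in xa; try lra; exists x.
have [x1 x1b x1E] := mv (u + - h) u (ltac:(lra)).
have [x3 x3b x3E] := mv u (u + h) (ltac:(lra)).
have g1 := mg N x1 u (ltac:(lra)).
have g3 := mg N u x3 (ltac:(lra)).
have -> : u ^ m.+1 * g N u - pe l' u = (h * g N u + - h * (pe l' u / u ^ m.+1)) * (u ^ m.+1 / h).
  have um1 : 0 < u ^ m.+1 by apply: pow_lt; lra.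
  by move: (u ^ m.+1) um1 => x x0; field; lra.
set p := pe l' u / u ^ m.+1.
set T := C3 * h ^ 2 / u ^ m.+2.
have t1 := hT u (- h) (ltac:(lra)) (ltac:(lra)).
have t3 := hT u h (ltac:(lra)) (ltac:(lra)).
have sqN : (- h) ^ 2 = h ^ 2 by ring.
rewrite sqN -/p -/T in t1; rewrite -/p -/T in t3.
move/Rabs_le_between: e1 => e1; move/Rabs_le_between: e2 => e2; move/Rabs_le_between: e3 => e3.
move/Rabs_le_between: t1 => t1; move/Rabs_le_between: t3 => t3.
have x1E' : f N (u + - h) - f N u = g N x1 * h by lra.
have x3E' : f N u - f N (u + h) = g N x3 * h by lra.
have g1' := Rmult_le_compat_r h _ _ (Rlt_le _ _ h0) g1.
have g3' := Rmult_le_compat_r h _ _ (Rlt_le _ _ h0) g3.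
have main : Rabs (h * g N u + - h * p) <= T + 2 * E by apply: Rabs_le; lra.
rewrite Rabs_mult (Rabs_pos_eq (_ / h)); last first.
  by apply: Rdiv_le_0_compat => //; apply: pow_le; lra.
apply: Rle_trans (_ : (T + 2 * E) * (u ^ m.+1 / h) <= _).
  by apply: Rmult_le_compat_r => //; apply: Rdiv_le_0_compat => //; apply: pow_le; lra.
(* The Taylor error contributes [h / u = u ^ K.+1], the error of the given expansion
   [u^(2K+2) / h = u^K]; this is why order [2K+1] is consumed to reach order [K]. *)
have -> : (T + 2 * E) * (u ^ m.+1 / h) = C3 * u ^ K.+1 + 2 * C2 * u ^ K.
  rewrite /T /E hE (_ : (2 * K).+1 = (K + K.+1)%N); last lia.
  rewrite pow_add /=; have uK : 0 < u ^ K by apply: pow_lt; lra.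
  by move: (u ^ K) (u ^ m) uK um => x y x0 y0; field; lra.
have uK : 0 <= u ^ K by apply: pow_le; lra.
have : C3 * (u * u ^ K) <= C3 * u ^ K by apply: Rmult_le_compat_l => //; nra.
by rewrite /=; lra.
Qed.

Lemma is_derive_kap j N u : is_derive (kap j N) u (- kap j.+1 N u).
Proof.
pose F (d e : nat) k v := exp (- (INR (d.+1 * e.+1) * v)) / INR e.+1 * INR (d.+1 * e.+1) ^ k.
have -> : - kap j.+1 N u = \rsum_(d < N) \rsum_(e < N) (- F d e j.+1 u).
  rewrite -(Rmult_1_l (kap _ _ _)) Ropp_mult_distr_l /kap.
  rewrite big_distrr; apply: eq_bigr => d _; rewrite big_distrr; apply: eq_bigr => e _.
  by rewrite /F /=; ring.
refine (is_derive_rsum _ (F := fun (d : 'I_N) u => \rsum_(e < N) F d e j u)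
   (F' := fun (d : 'I_N) u => \rsum_(e < N) - F d e j.+1 u) _) => d.
refine (is_derive_rsum _ (F := fun (e : 'I_N) u => F d e j u)
   (F' := fun (e : 'I_N) u => - F d e j.+1 u) _) => e.
rewrite /F; move: (INR (d.+1 * e.+1)) (INR e.+1) => a b.
by auto_derive => //; rewrite /= /Rdiv; ring.
Qed.

Lemma kap_term_ge0 j (d e : nat) u :
  0 <= exp (- (INR (d.+1 * e.+1) * u)) / INR e.+1 * INR (d.+1 * e.+1) ^ j.
Proof.
apply: Rmult_le_pos; last by apply: pow_le; exact: pos_INR.
by apply: Rdiv_le_0_compat; [exact/Rlt_le/exp_pos|apply: lt_0_INR; lia].
Qed.

Lemma kap_ge0 j N u : 0 <= kap j N u.
Proof. by do 2!apply: rsum_ge0 => ?; exact: kap_term_ge0. Qed.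

Lemma kap_decr j N u v : u <= v -> kap j N v <= kap j N u.
Proof.
move=> uv; apply: rsum_le => d; apply: rsum_le => e.
apply: Rmult_le_compat_r; first by apply: pow_le; exact: pos_INR.
apply: Rmult_le_compat_r; first by apply/Rlt_le/Rinv_0_lt_compat/lt_0_INR; lia.
apply: exp_le; apply: Ropp_le_contravar; apply: Rmult_le_compat_l => //; exact: pos_INR.
Qed.

Lemma kap_incr j N u : kap j N u <= kap j N.+1 u.
Proof.
rewrite /kap big_ord_recr /=.
apply: Rle_trans (_ : \rsum_(d < N) \rsum_(e < N.+1)
    (exp (- (INR (d.+1 * e.+1) * u)) / INR e.+1 * INR (d.+1 * e.+1) ^ j) <= _).
  apply: rsum_le => d; rewrite [X in _ <= X]big_ord_recr /=.
  have := kap_term_ge0 j d N u; rewrite /=; lra.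
have : 0 <= \rsum_(e < N.+1) (exp (- (INR (N.+1 * e.+1) * u)) / INR e.+1 * INR (N.+1 * e.+1) ^ j).
  by apply: rsum_ge0 => e; exact: kap_term_ge0.
rewrite /=; lra.
Qed.

Lemma kap_exp_le j N u : kap j N u <= kap j.+1 N u.
Proof.
apply: rsum_le => d; apply: rsum_le => e.
apply: Rmult_le_compat_l.
  by apply: Rdiv_le_0_compat; [exact/Rlt_le/exp_pos|apply: lt_0_INR; lia].
have a1 : 1 <= INR (d.+1 * e.+1) by apply: (le_INR 1); lia.
rewrite /=; have := pow_le (INR (d.+1 * e.+1)) j (ltac:(lra)); nra.
Qed.

(** Each differentiation roughly halves the order, so the induction on [j] ranges over all [K].
    Convexity of [kap j.+1 N] is the monotonicity of [kap j.+2 N]. *)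
Lemma kap_asym j K : exists l, pe l 0 = INR (fact j.+1) * (PI ^ 2 / 6) /\
  asym (fun N u => u ^ j.+2 * kap j.+1 N u) (pe l) K.
Proof.
elim: j K => [|j IHj] K.
  have [l hl] := kap1_approx K; exists [:: PI ^ 2 / 6, - / 2 & l]; split.
    by rewrite /= /fact /INR /=; ring.
  apply: evapprox_asym; apply: evapprox_weaken (_ : (K <= K.+2)%N) _; first lia.
  by apply: evapprox_ext hl => // u _ /=; field.
have [l [l0 hl]] := IHj (2 * K).+1.
have mono N u v : 0 < u <= v -> kap j.+2 N v <= kap j.+2 N u.
  by move=> uv; apply: kap_decr; lra.
have [l' [l'0 hl']] := asym_deriv (fun N u _ => is_derive_kap j.+1 N u) mono hl.
exists l'; split => //; rewrite l'0 l0.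
have -> : INR (fact j.+2) = INR j.+2 * INR (fact j.+1) by rewrite -mult_INR.
by rewrite Rmult_assoc.
Qed.

(** A Cauchy condition at 0 yields a limit there, with the same rate. It supplies integration
    constants and, after inverting the variable, integrals over a half-line. *)
Lemma cauchy_at0 (D : R -> R) b C K : 0 < b <= 1 -> 0 <= C ->
  (forall u v, 0 < u <= v -> v <= b -> Rabs (D v - D u) <= C * v ^ K.+1) ->
  exists c, forall v, 0 < v <= b -> Rabs (D v - c) <= C * v ^ K.+1.
Proof.
move=> b0 C0 hD; pose x n := b / INR n.+1.
have n0 n : 1 <= INR n.+1 by apply: (le_INR 1); lia.
have x0 n : 0 < x n <= b.
  have i0 := Rinv_0_lt_compat _ (Rlt_le_trans _ _ _ Rlt_0_1 (n0 n)).
  have i1 : / INR n.+1 <= 1 by rewrite -Rinv_1; apply: Rinv_le_contravar; [lra|exact: n0].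
  by rewrite /x /Rdiv; split; nra.
have xs e : 0 < e -> exists N, forall n, (N <= n)%N -> x n <= e.
  move=> e0; exists (Z.to_nat (up (/ e))) => n Nn; have [u1 _] := archimed (/ e).
  have h : / e <= INR n.+1.
    by apply: Rle_trans (Rlt_le _ _ u1) _; rewrite INR_IZR_INZ; apply: IZR_le; lia.
  have i := Rinv_le_contravar _ _ (Rinv_0_lt_compat _ e0) h; rewrite Rinv_inv in i.
  have i0 := Rinv_0_lt_compat _ (Rlt_le_trans _ _ _ Rlt_0_1 (n0 n)).
  by rewrite /x /Rdiv; nra.
have small v : 0 < v <= b -> C * v ^ K.+1 <= C * v.
  move=> vb; apply: Rmult_le_compat_l => //; rewrite -{2}(pow_1 v); apply: pow_le_pow => //; lra.
have [c hc] : ex_finite_lim_seq (fun n => D (x n)).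
  apply/ex_lim_seq_cauchy_corr => e.
  have e1 : 0 < e / (C + 1) by apply: Rdiv_lt_0_compat; [exact: cond_pos|lra].
  have [N hN] := xs _ e1.
  have key v : 0 < v <= b -> v <= e / (C + 1) -> C * v ^ K.+1 < e.
    move=> vb ve; apply: Rle_lt_trans (small v vb) _.
    have : C * v < (C + 1) * v by nra.
    have := Rmult_le_compat_l (C + 1) _ _ (ltac:(lra)) ve.
    have -> : (C + 1) * (e / (C + 1)) = e by field; lra.
    lra.
  exists N => n m Nn Nm.
  have [xnm|xnm] := Rle_lt_dec (x n) (x m).
    rewrite Rabs_minus_sym; apply: Rle_lt_trans (hD _ _ _ _) _; [by have := x0 n; lra|by have := x0 m; lra|].
    by apply: key => //; apply: hN; lia.
  apply: Rle_lt_trans (hD _ _ _ _) _; [by have := x0 m; lra|by have := x0 n; lra|].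
  by apply: key => //; apply: hN; lia.
exists c => v v0; apply: le_epsilon => e e0.
have [N1 h1] := xs v (proj1 v0).
have [N2 h2] := proj2 (is_lim_seq_spec _ _) hc (mkposreal e e0).
have [n nN1 nN2] : exists2 n, (N1 <= n)%N & (N2 <= n)%N by exists (maxn N1 N2); lia.
have xn := h1 n nN1; have {h2} yn : Rabs (D (x n) - c) < e by apply: h2; lia.
have zn := hD (x n) v (ltac:(have := x0 n; lra)) (proj2 v0).
rewrite (_ : D v - c = (D v - D (x n)) + (D (x n) - c)); last ring.
by apply: Rle_trans (Rabs_triang _ _) _; lra.
Qed.

Lemma pe_antideriv l : exists l', forall u, is_derive (pe l') u (pe l u).
Proof.
suff [l' hl'] : exists l', forall u, is_derive (fun u => u * pe l' u) u (pe l u).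
  exists (0 :: l') => u; apply: (is_derive_ext (fun u => u * pe l' u)) => // v.
  by rewrite /= Rplus_0_l.
suff H m : exists l', forall u, is_derive (fun u => u ^ m.+1 * pe l' u) u (u ^ m * pe l u).
  have [l' hl'] := H 0%N; exists l' => u; have := hl' u.
  rewrite /= Rmult_1_l; apply: is_derive_ext => v; by rewrite Rmult_1_r.
elim: l m => [|a l IHl] m.
  exists [::] => u; rewrite /= Rmult_0_r; apply: (is_derive_ext (fun=> 0)) => [v|].
    by rewrite Rmult_0_r.
  exact: is_derive_const.
have [l' hl'] := IHl m.+1; exists (a / INR m.+1 :: l') => u.
have m0 : INR m.+1 <> 0 by apply: not_0_INR.
have E v : a / INR m.+1 * v ^ m.+1 + v ^ m.+2 * pe l' v = v ^ m.+1 * pe (a / INR m.+1 :: l') v.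
  by rewrite /=; ring.
apply: (is_derive_ext _ _ _ _ E).
have -> : u ^ m * pe (a :: l) u = a / INR m.+1 * (INR m.+1 * 1 * u ^ m) + u ^ m.+1 * pe l u.
  by rewrite /=; field.
apply: (is_derive_plus (fun v => a / INR m.+1 * v ^ m.+1)); last exact: hl'.
apply: is_derive_scal; apply: (is_derive_pow (fun v => v) m.+1 u 1); exact: is_derive_id.
Qed.

(** Integrating the expansion of [kap 1] determines [kap 0] up to a constant. For fixed [N] the sum
    stays bounded as [u] tends to 0, so the constant is only visible in the limit [L] as [N] grows;
    it is obtained from [cauchy_at0] and not evaluated. *)
Lemma kap0_asym K : exists l,
  asym (kap 0) (fun u => PI ^ 2 / 6 / u + ln u / 2 + pe l u) K.+1.
Proof.
have [l [C C0 hC]] := kap1_approx K; have [l' dl'] := pe_antideriv l.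
pose A u := PI ^ 2 / 6 / u + ln u / 2 - pe l' u.
have dA u : 0 < u -> is_derive A u (- (PI ^ 2 / 6 / u ^ 2) + / (2 * u) - pe l u).
  move=> u0; rewrite /A; apply: is_derive_minus; last exact: dl'.
  by auto_derive; [split; [lra|split => //; lra]|field; lra].
have step s : 0 < s <= 1 -> exists N0, forall N, (N0 <= N)%N -> forall u v, s <= u <= v -> v <= 1 ->
    Rabs ((kap 0 N v - A v) - (kap 0 N u - A u)) <= C * v ^ K.+1.
  move=> s0; have [N0 hN] := hC s s0; exists N0 => N NN u v su v1.
  apply: Rle_trans (mvt_bound (f := fun t => kap 0 N t - A t)
    (df := fun t => - kap 1 N t - (- (PI ^ 2 / 6 / t ^ 2) + / (2 * t) - pe l t)) (M := C * v ^ K) _ _) _.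
  - move=> t; rewrite Rmin_left ?Rmax_right => [tuv||]; try lra.
    by apply: is_derive_minus; [exact: is_derive_kap|apply: dA; lra].
  - move=> t; rewrite Rmin_left ?Rmax_right => [tuv||]; try lra.
    have t2 : 0 < t ^ 2 by apply: pow_lt; lra.
    rewrite (_ : _ - _ = - ((t ^ 2 * kap 1 N t - (PI ^ 2 / 6 - t / 2 + t ^ 2 * pe l t)) * / t ^ 2)); last by field; lra.
    rewrite Rabs_Ropp Rabs_mult (Rabs_pos_eq (/ _)); last exact/Rlt_le/Rinv_0_lt_compat.
    apply: (Rmult_le_reg_r (t ^ 2)) => //; rewrite Rmult_assoc Rinv_l ?Rmult_1_r; last lra.
    apply: Rle_trans (hN N NN t _) _; first lra.
    rewrite (_ : t ^ K.+2 = t ^ K * t ^ 2); last by rewrite /=; ring.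
    rewrite -Rmult_assoc; apply: Rmult_le_compat_r; first lra.
    by apply: Rmult_le_compat_l => //; apply: pow_incr; lra.
  rewrite Rabs_pos_eq; last lra.
  rewrite (_ : C * v ^ K.+1 = C * v ^ K * v); last by rewrite /=; ring.
  apply: Rmult_le_compat_l; last lra.
  by apply: Rmult_le_pos => //; apply: pow_le; lra.
(* Boundedness at [u = 1] comes from [kap 0 <= kap 1]; [step] carries it to every smaller [u], and
   monotonicity in [N] gives the limit. *)
have [B hB] : exists B, exists N0, forall N, (N0 <= N)%N -> kap 0 N 1 <= B.
  have [N0 hN] := hC 1 (ltac:(lra)); eexists; exists N0 => N NN.
  apply: Rle_trans (kap_exp_le _ _ _) _.
  have := hN N NN 1 (ltac:(lra)); rewrite !pow1 Rmult_1_l => /Rabs_le_between h.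
  have h2 := proj2 h; apply: (Rle_trans _ (C * 1 + (PI ^ 2 / 6 - 1 / 2 + 1 * pe l 1))); last exact: Rle_refl.
  lra.
have lim u : 0 < u <= 1 -> ex_finite_lim_seq (fun N => kap 0 N u).
  move=> u0; have [N1 h1] := hB; have [N2 h2] := step u u0.
  apply: (ex_finite_lim_seq_incr _ (B - A 1 + A u + C)) => [N|N]; first exact: kap_incr.
  have mono n : kap 0 N u <= kap 0 (N + n) u.
    elim: n => [|n IHn]; first by rewrite addn0; lra.
    by apply: Rle_trans IHn _; rewrite addnS; exact: kap_incr.
  apply: Rle_trans (mono (N1 + N2)%N) _.
  have := h2 (N + (N1 + N2))%N (ltac:(lia)) u 1 (ltac:(lra)) (ltac:(lra)).
  rewrite pow1 => /Rabs_le_between; have := h1 (N + (N1 + N2))%N (ltac:(lia)); lra.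
pose L u := real (Lim_seq (fun N => kap 0 N u)).
have Llim u : 0 < u <= 1 -> forall e, 0 < e -> exists N0, forall N, (N0 <= N)%N -> Rabs (kap 0 N u - L u) <= e.
  move=> u0 e e0; have := Lim_seq_correct' _ (lim u u0) => hL.
  have [N0 h] := proj2 (is_lim_seq_spec _ _) hL (mkposreal e e0).
  by exists N0 => N NN; apply: Rlt_le; apply: h; lia.
have cau u v : 0 < u <= v -> v <= 1 -> Rabs ((L v - A v) - (L u - A u)) <= C * v ^ K.+1.
  move=> uv v1; apply: le_epsilon => e e0.
  have [N1 h1] := Llim u (ltac:(lra)) (e / 2) (ltac:(lra)).
  have [N2 h2] := Llim v (ltac:(lra)) (e / 2) (ltac:(lra)).
  have [N3 h3] := step u (ltac:(lra)).
  pose N := (N1 + N2 + N3)%N.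
  move: (h1 N (ltac:(lia))) (h2 N (ltac:(lia))) (h3 N (ltac:(lia)) u v (ltac:(lra)) v1).
  move=> /Rabs_le_between g1 /Rabs_le_between g2 /Rabs_le_between g3.
  by apply: Rabs_le; lra.
have [c hc] := @cauchy_at0 (fun u => L u - A u) 1 C K (ltac:(lra)) C0 cau.
have [m mE] := pe_scal (-1) l'; have [m' m'E] := pe_add [:: c] m.
exists m', (C + 1), 1; split; [lra|lra|move=> u u0].
have uK : 0 < u ^ K.+1 by apply: pow_lt; lra.
have [N0 h] := Llim u u0 _ uK; exists N0 => N NN.
move: (h N NN) (hc u u0) => /Rabs_le_between g1 /Rabs_le_between g2.
have -> : pe m' u = c - pe l' u by rewrite m'E mE /=; ring.
by move: g2; rewrite /A => g2; apply: Rabs_le; lra.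
Qed.

(** * Uniform expansions in two variables *)

(** The logarithm of the Euler product at [exp (- u + i t)] as a trigonometric sum. Pairs [(d, e)]
    with the same product stay separate, matching [npart_rec]; the predecessor reflects that an
    entry [k] denotes the frequency [k.+1]. *)
Definition pcoefs (N : nat) (u : R) : seq (nat * R) :=
  [seq ((d.+1 * e.+1).-1, exp (- (INR (d.+1 * e.+1) * u)) / INR e.+1) | d <- seq.iota 0 N, e <- seq.iota 0 N].

Lemma sum_pcoefs N u (F : nat -> R -> R) :
  \rsum_(p <- pcoefs N u) F p.1.+1 p.2 =
  \rsum_(d < N) \rsum_(e < N) F (d.+1 * e.+1)%N (exp (- (INR (d.+1 * e.+1) * u)) / INR e.+1).
Proof.
have iotaE : seq.iota 0 N = index_iota 0 N by rewrite /index_iota subn0.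
rewrite /pcoefs big_flatten big_map iotaE big_mkord; apply: eq_bigr => d _.
by rewrite big_map big_mkord; apply: eq_bigr => e _.
Qed.

Lemma moment_pcoefs j N u : \rsum_(p <- pcoefs N u) (p.2 * INR p.1.+1 ^ j) = kap j N u.
Proof. exact: (sum_pcoefs N u (fun k a => a * INR k ^ j)). Qed.

Definition cos_deriv (j : nat) (t : R) : R := cos (t + INR j * (PI / 2)).

Lemma is_derive_cos_deriv j t : is_derive (cos_deriv j) t (cos_deriv j.+1 t).
Proof.
rewrite /cos_deriv S_INR; move: (INR j) => {}j.
auto_derive => //; rewrite (_ : t + (j + 1) * (PI / 2) = (t + j * (PI / 2)) + PI / 2); last ring.
by rewrite cos_plus cos_PI2 sin_PI2; ring.
Qed.

(* The shift [q] covers the cosine ([q = 0]) and the sine ([q = 3]) at once. *)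
Lemma cos_taylor q J t :
  Rabs (cos_deriv q t - \rsum_(i < J) (cos_deriv (q + i) 0 * t ^ i / INR (fact i))) <= Rabs t ^ J.
Proof.
have := @taylor_bound (fun i => cos_deriv (q + i)) J 0 t 1.
rewrite addn0 Rminus_0_r Rmult_1_l; apply => [j s _|s _].
  by rewrite addnS; exact: is_derive_cos_deriv.
by apply: Rabs_le; have := COS_bound (s + INR (q + J) * (PI / 2)); rewrite /cos_deriv; lra.
Qed.

Lemma cos_derivE t : cos_deriv 0 t = cos t.
Proof. by rewrite /cos_deriv (_ : INR 0 = 0) // Rmult_0_l Rplus_0_r. Qed.

Lemma sin_derivE t : cos_deriv 3 t = sin t.
Proof.
rewrite /cos_deriv (_ : INR 3 = 3); last by rewrite INR_IZR_INZ.
rewrite (_ : t + _ = (t + PI / 2) + PI); last field.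
by rewrite neg_cos cos_plus cos_PI2 sin_PI2; ring.
Qed.

Definition trig_sum q s t := \rsum_(p <- s) (p.2 * cos_deriv q (INR p.1.+1 * t)).

(** Taylor expansion of each cosine or sine; the moments of the frequencies that appear are exactly
    the cumulants. *)
Lemma trig_sum_taylor q J N u t : 0 <= t ->
  Rabs (trig_sum q (pcoefs N u) t
    - \rsum_(i < J) (cos_deriv (q + i) 0 / INR (fact i) * t ^ i * kap i N u)) <= t ^ J * kap J N u.
Proof.
move=> t0.
have -> : \rsum_(i < J) (cos_deriv (q + i) 0 / INR (fact i) * t ^ i * kap i N u) =
  \rsum_(p <- pcoefs N u) (p.2 * \rsum_(i < J) (cos_deriv (q + i) 0 * (INR p.1.+1 * t) ^ i / INR (fact i))).
  rewrite (eq_bigr (fun i : 'I_J => \rsum_(p <- pcoefs N u) (p.2 * (cos_deriv (q + i) 0 * (INR p.1.+1 * t) ^ i / INR (fact i))))).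
    by rewrite exchange_big; apply: eq_bigr => p _; rewrite big_distrr.
  move=> i _; rewrite -moment_pcoefs big_distrr; apply: eq_bigr => p _ /=.
  by rewrite Rpow_mult_distr /Rdiv; ring.
rewrite -moment_pcoefs -rsum_minus big_distrr.
rewrite (sum_pcoefs N u (fun k a => t ^ J * (a * INR k ^ J))).
rewrite (sum_pcoefs N u (fun k a => a * cos_deriv q (INR k * t) -
   a * \rsum_(i < J) (cos_deriv (q + i) 0 * (INR k * t) ^ i / INR (fact i)))).
apply: Rabs_rsum_le => d; apply: Rabs_rsum_le => e.
rewrite -Rmult_minus_distr_l Rabs_mult; move: (INR _) (pos_INR (d.+1 * e.+1)) => k k0.
have a0 : 0 <= exp (- (k * u)) / INR e.+1.
  by apply: Rdiv_le_0_compat; [exact/Rlt_le/exp_pos|apply: lt_0_INR; lia].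
rewrite Rabs_pos_eq // (_ : t ^ J * _ = exp (- (k * u)) / INR e.+1 * (k * t) ^ J); last first.
  by rewrite Rpow_mult_distr; ring.
apply: Rmult_le_compat_l => //; apply: Rle_trans (cos_taylor _ _ _) _.
by rewrite Rabs_pos_eq; [exact: Rle_refl|nra].
Qed.

(** * Polynomial functions of one and of two variables *)

Definition ispoly (f : R -> R) := exists l, forall x, f x = pe l x.

Lemma ispoly_const c : ispoly (fun=> c).
Proof. by exists [:: c] => x /=; ring. Qed.

Lemma ispoly_id : ispoly (fun x => x).
Proof. by exists [:: 0; 1] => x /=; ring. Qed.

Lemma ispoly_add f g : ispoly f -> ispoly g -> ispoly (fun x => f x + g x).
Proof. by move=> [l fl] [m gm]; have [n nE] := pe_add l m; exists n => x; rewrite nE fl gm. Qed.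

Lemma ispoly_mul f g : ispoly f -> ispoly g -> ispoly (fun x => f x * g x).
Proof. by move=> [l fl] [m gm]; have [n nE] := pe_mul l m; exists n => x; rewrite nE fl gm. Qed.

Lemma ispoly_pow f k : ispoly f -> ispoly (fun x => f x ^ k).
Proof. by move=> pf; elim: k => [|k IHk]; [exact: ispoly_const|exact: ispoly_mul]. Qed.

Lemma ispoly_pe l f : ispoly f -> ispoly (fun x => pe l (f x)).
Proof.
move=> pf; elim: l => [|a l IHl]; first exact: ispoly_const.
by apply: ispoly_add (ispoly_const a) (ispoly_mul pf IHl).
Qed.

Fixpoint pe2 (l : seq (seq R)) (x y : R) : R := if l is a :: l' then pe a x + y * pe2 l' x y else 0.

Definition ispoly2 (f : R -> R -> R) := exists l, forall x y, f x y = pe2 l x y.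

Lemma ispoly2_fst f : ispoly f -> ispoly2 (fun x _ => f x).
Proof. by move=> [l fl]; exists [:: l] => x y /=; rewrite fl; ring. Qed.

Lemma ispoly2_snd : ispoly2 (fun _ y => y).
Proof. by exists [:: [::]; [:: 1]] => x y /=; ring. Qed.

Lemma ispoly2_add f g : ispoly2 f -> ispoly2 g -> ispoly2 (fun x y => f x y + g x y).
Proof.
move=> [l fl] [m gm]; suff [n nE] : exists n, forall x y, pe2 n x y = pe2 l x y + pe2 m x y.
  by exists n => x y; rewrite fl gm nE.
elim: l m {fl gm} => [|a l IHl] m; first by exists m => x y /=; ring.
case: m => [|b m]; first by exists (a :: l) => x y /=; ring.
have [n nE] := IHl m; have [c cE] := pe_add a b; exists (c :: n) => x y /=; rewrite nE cE; ring.
Qed.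

Lemma ispoly2_mul f g : ispoly2 f -> ispoly2 g -> ispoly2 (fun x y => f x y * g x y).
Proof.
move=> [l fl] [m gm]; suff [n nE] : ispoly2 (fun x y => pe2 l x y * pe2 m x y).
  by exists n => x y; rewrite fl gm nE.
elim: l {fl} => [|a l [n nE]]; first by exists [::] => x y /=; ring.
have [c cE] : ispoly2 (fun x y => pe a x * pe2 m x y).
  elim: m {gm n nE} => [|b m [c cE]]; first by exists [::] => x y /=; ring.
  by have [d dE] := pe_mul a b; exists (d :: c) => x y /=; rewrite dE -cE; ring.
have P1 : ispoly2 (fun x y => pe a x * pe2 m x y) by exists c.
have P2 : ispoly2 (fun x y => y * (pe2 l x y * pe2 m x y)).
  by exists ([::] :: n) => x y /=; rewrite -nE; ring.
have [k kE] := ispoly2_add P1 P2; exists k => x y; rewrite -kE /=; ring.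
Qed.

Lemma ispoly2_pow f k : ispoly2 f -> ispoly2 (fun x y => f x y ^ k).
Proof.
move=> pf; elim: k => [|k IHk]; first by apply: ispoly2_fst; exact: ispoly_const.
exact: ispoly2_mul.
Qed.

Lemma ispoly2_sum m (f : nat -> R -> R -> R) : (forall i, ispoly2 (f i)) ->
  ispoly2 (fun x y => \rsum_(i < m) f i x y).
Proof.
move=> pf; elim: m => [|m IHm].
  by exists [::] => x y; rewrite big_ord0.
have [l lE] := ispoly2_add IHm (pf m); exists l => x y.
by rewrite big_ord_recr /= -lE.
Qed.

(* As [asym], but uniformly in [0 <= y <= 1 / w]. *)
Definition asym2 (f : nat -> R -> R -> R) (q : R -> R -> R) (K : nat) : Prop :=
  exists C b, [/\ 0 <= C, 0 < b <= 1 & forall w, 0 < w <= b -> exists N0, forall N, (N0 <= N)%N ->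
    forall y, 0 <= y <= / w -> Rabs (f N w y - q w y) <= C * w ^ K].

(** An exponent of size [w] on the whole range of [y] has its [K]-th power of size [w^K], so [K]
    Taylor terms of [exp] and [cos] suffice. *)
Definition vanishing (q : R -> R -> R) : Prop :=
  exists2 C, 0 <= C & forall w y, 0 < w <= 1 -> 0 <= y <= / w -> Rabs (q w y) <= C * w.

Definition expansion2 (f : nat -> R -> R -> R) (K : nat) : Prop :=
  exists q, [/\ ispoly2 q, vanishing q & asym2 f q K].

Lemma expansion2_ext f g K :
  (forall N w y, 0 < w <= 1 -> f N w y = g N w y) -> expansion2 f K -> expansion2 g K.
Proof.
move=> fg [q [pq vq [C [b [C0 b0 hC]]]]]; exists q; split => //; exists C, b; split => // w wb.
have [N0 h] := hC w wb; exists N0 => N NN y yw; rewrite -fg; last lra.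
exact: h.
Qed.

Lemma expansion2_add f g K : expansion2 f K -> expansion2 g K ->
  expansion2 (fun N w y => f N w y + g N w y) K.
Proof.
move=> [p [pp [Cp Cp0 vp] [C [b [C0 b0 hC]]]]] [q [pq [Cq Cq0 vq] [D [c [D0 c0 hD]]]]].
exists (fun w y => p w y + q w y); split; first exact: ispoly2_add.
  exists (Cp + Cq) => [|w y w0 y0]; first lra.
  by apply: Rle_trans (Rabs_triang _ _) _; have := vp w y w0 y0; have := vq w y w0 y0; lra.
exists (C + D), (Rmin b c); have m1 := Rmin_l b c; have m2 := Rmin_r b c.
split; [lra|split; [apply: Rmin_glb_lt; lra|lra]|move=> w wb].
have [N1 h1] := hC w (ltac:(lra)); have [N2 h2] := hD w (ltac:(lra)).
exists (maxn N1 N2) => N NN y yw.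
rewrite (_ : _ - _ = (f N w y - p w y) + (g N w y - q w y)); last ring.
apply: Rle_trans (Rabs_triang _ _) _; rewrite Rmult_plus_distr_r.
by apply: Rplus_le_compat; [apply: h1|apply: h2] => //; lia.
Qed.

Lemma expansion2_small f K :
  (exists C b, [/\ 0 <= C, 0 < b <= 1 & forall w, 0 < w <= b -> exists N0, forall N, (N0 <= N)%N ->
    forall y, 0 <= y <= / w -> Rabs (f N w y) <= C * w ^ K]) -> expansion2 f K.
Proof.
move=> [C [b [C0 b0 hC]]]; exists (fun _ _ => 0); split.
- by exists [::].
- by exists 0 => [|w y _ _]; rewrite ?Rabs_R0; lra.
exists C, b; split => // w wb; have [N0 h] := hC w wb; exists N0 => N NN y yw.
by rewrite Rminus_0_r; exact: h.
Qed.

(* Here [w ^ a * y ^ i <= w ^ (a - i)], so [i < a] makes the term vanish with [w]. *)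
Lemma expansion2_term c a i (k : nat -> R -> R) l K : (i < a)%N -> asym k (pe l) K ->
  expansion2 (fun N w y => c * w ^ a * y ^ i * k N (w ^ 8)) K.
Proof.
move=> ia [C [b [C0 b0 hC]]].
have wy w y : 0 < w <= 1 -> 0 <= y <= / w -> 0 <= w ^ a * y ^ i <= w.
  move=> w0 y0; have w1 : 0 <= w ^ (a - i) <= w.
    split; first by apply: pow_le; lra.
    by rewrite -{2}(pow_1 w); apply: pow_le_pow; [lra|lia].
  have -> : w ^ a * y ^ i = w ^ (a - i) * (w * y) ^ i.
    by rewrite -{1}(subnK (ltnW ia)) pow_add Rpow_mult_distr; ring.
  have z0 : 0 <= w * y <= 1.
    split; first nra.
    by have := Rmult_le_compat_l w y (/ w) (ltac:(lra)) (proj2 y0); rewrite Rinv_r; lra.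
  have := pow_incr (w * y) 1 i z0; rewrite pow1; have := pow_le (w * y) i (proj1 z0).
  by move: ((w * y) ^ i) => x; nra.
have [D D0 hD] := pe_bounded l.
have w8 w : 0 < w <= 1 -> 0 < w ^ 8 <= w.
  move=> w0; split; first by apply: pow_lt; lra.
  by rewrite -{2}(pow_1 w); apply: pow_le_pow => //; lra.
have c0 := Rabs_pos c.
exists (fun w y => c * w ^ a * y ^ i * pe l (w ^ 8)); split.
- apply: ispoly2_mul; last by apply: ispoly2_fst; apply: ispoly_pe; apply: ispoly_pow; exact: ispoly_id.
  apply: ispoly2_mul; last by apply: ispoly2_pow; exact: ispoly2_snd.
  apply: ispoly2_fst; apply: ispoly_mul; first exact: ispoly_const.
  by apply: ispoly_pow; exact: ispoly_id.
- exists (Rabs c * D) => [|w y w0 y0]; first nra.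
  have [h1 h2] := wy w y w0 y0; have := w8 w w0 => h8.
  rewrite (_ : c * _ * _ * _ = c * ((w ^ a * y ^ i) * pe l (w ^ 8))); last ring.
  rewrite Rabs_mult (Rmult_assoc (Rabs c)); apply: Rmult_le_compat_l => //.
  rewrite Rabs_mult (Rabs_pos_eq (_ * _)) // Rmult_comm.
  apply: Rmult_le_compat => //; first exact: Rabs_pos.
  by apply: hD; rewrite Rabs_pos_eq; lra.
exists (Rabs c * C), b; split; [nra|lra|move=> w w0].
have h8 := w8 w (ltac:(lra)); have [N0 h] := hC (w ^ 8) (ltac:(lra)).
exists N0 => N NN y y0; have [h1 h2] := wy w y (ltac:(lra)) y0.
rewrite -Rmult_minus_distr_l (_ : c * _ * _ * _ = c * ((w ^ a * y ^ i) * (k N (w ^ 8) - pe l (w ^ 8)))); last ring.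
rewrite Rabs_mult (Rmult_assoc (Rabs c)); apply: Rmult_le_compat_l => //.
rewrite Rabs_mult (Rabs_pos_eq (_ * _)) //.
have g1 := h N NN.
have g2 : (w ^ 8) ^ K <= w ^ K by apply: pow_incr; lra.
have g3 := Rabs_pos (k N (w ^ 8) - pe l (w ^ 8)).
have g4 : Rabs (k N (w ^ 8) - pe l (w ^ 8)) <= C * w ^ K.
  by apply: Rle_trans g1 _; apply: Rmult_le_compat_l.
nra.
Qed.

Lemma expansion2_sum m (f : nat -> nat -> R -> R -> R) K : (forall i, expansion2 (f i) K) ->
  expansion2 (fun N w y => \rsum_(i < m) f i N w y) K.
Proof.
move=> pf; elim: m => [|m IHm].
  apply: expansion2_small; exists 0, 1; split; [lra|lra|move=> w _; exists 0%N => N _ y _].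
  by rewrite big_ord0 Rabs_R0; lra.
apply: expansion2_ext (expansion2_add IHm (pf m)) => N w y _.
by rewrite big_ord_recr.
Qed.

Lemma asym_bounded f l K : asym f (pe l) K -> exists C b, [/\ 0 <= C, 0 < b <= 1 &
  forall u, 0 < u <= b -> exists N0, forall N, (N0 <= N)%N -> Rabs (f N u) <= C].
Proof.
move=> [C [b [C0 b0 hC]]]; have [D D0 hD] := pe_bounded l.
exists (C + D), b; split => //; first lra.
move=> u u0; have [N0 h] := hC u u0; exists N0 => N NN.
rewrite (_ : f N u = (f N u - pe l u) + pe l u); last ring.
apply: Rle_trans (Rabs_triang _ _) _; apply: Rplus_le_compat.
  apply: Rle_trans (h N NN) _; rewrite -{2}(Rmult_1_r C); apply: Rmult_le_compat_l => //.
  by rewrite -(pow1 K); apply: pow_incr; lra.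
by apply: hD; rewrite Rabs_pos_eq; lra.
Qed.

Lemma asym_div f l c K : asym f (pe l) K.+1 -> pe l 0 = c ->
  exists l', asym (fun N u => (f N u - c) / u) (pe l') K.
Proof.
move=> [C [b [C0 b0 hC]]] l0.
have [l' lE] : exists l', forall u, pe l u = c + u * pe l' u.
  case: l l0 {hC} => [|a l] <- /=; first by exists [::] => u /=; ring.
  by exists l => u; ring.
exists l', C, b; split => // u u0; have [N0 h] := hC u u0; exists N0 => N NN.
rewrite (_ : _ - _ = (f N u - pe l u) * / u); last by rewrite lE; field; lra.
rewrite Rabs_mult (Rabs_pos_eq (/ u)); last by apply/Rlt_le/Rinv_0_lt_compat; lra.
apply: (Rmult_le_reg_r u); first lra.
rewrite Rmult_assoc Rinv_l ?Rmult_1_r; last lra.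
by apply: Rle_trans (h N NN) _; rewrite /=; apply: Req_le; ring.
Qed.

(** In degree [i] one has [t^i kap i = w^(4i-8) y^i (u^(i+1) kap i)], where the last factor is
    polynomial in [u]; for [i >= 3] the exponent of [w] exceeds that of [y], as [expansion2_term]
    requires. *)
Lemma trig_tail q K : expansion2 (fun N w y => trig_sum q (pcoefs N (w ^ 8)) (w ^ 12 * y)
  - \rsum_(i < 3) (cos_deriv (q + i) 0 / INR (fact i) * (w ^ 12 * y) ^ i * kap i N (w ^ 8))) K.
Proof.
pose T i N w y := cos_deriv (q + i) 0 / INR (fact i) * (w ^ 12 * y) ^ i * kap i N (w ^ 8).
have P1 : expansion2 (fun N w y => \rsum_(i < K) T i.+3 N w y) K.
  apply: (@expansion2_sum K (fun i => T i.+3)) => i.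
  have [l [_ hl]] := kap_asym i.+2 K.
  apply: expansion2_ext (expansion2_term (cos_deriv (q + i.+3) 0 / INR (fact i.+3)) (a := 4 * i + 4) (i := i.+3) _ hl); last lia.
  move=> N w y w0; have E : (w ^ 12 * y) ^ i.+3 = w ^ (4 * i + 4) * y ^ i.+3 * (w ^ 8) ^ i.+4.
    rewrite Rpow_mult_distr -!pow_mult (_ : (12 * i.+3)%coq_nat = (4 * i + 4 + (8 * i.+4)%coq_nat)%N); last lia.
    by rewrite (pow_add _ (4 * i + 4)); ring.
  by rewrite /T E; ring.
have P2 : expansion2 (fun N w y => trig_sum q (pcoefs N (w ^ 8)) (w ^ 12 * y) - \rsum_(i < K.+3) T i N w y) K.
  apply: expansion2_small.
  have [l [_ hl]] := kap_asym K.+2 K; have [C [b [C0 b0 hC]]] := asym_bounded hl.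
  exists C, b; split => // w w0.
  have w8 : 0 < w ^ 8 <= b.
    split; first by apply: pow_lt; lra.
    apply: Rle_trans (_ : w ^ 1 <= _); last by rewrite pow_1; lra.
    by apply: pow_le_pow => //; lra.
  have [N0 h] := hC (w ^ 8) w8; exists N0 => N NN y y0.
  have wy : 0 <= w ^ 12 * y by apply: Rmult_le_pos; [apply: pow_le; lra|lra].
  apply: Rle_trans (trig_sum_taylor q K.+3 N (w ^ 8) wy) _.
  have {}h := h N NN; rewrite Rabs_mult !Rabs_pos_eq in h; last first.
    - by apply: pow_le; lra.
    - exact: kap_ge0.
  have z0 : 0 <= w * y <= 1.
    split; first nra.
    by have := Rmult_le_compat_l w y (/ w) (ltac:(lra)) (proj2 y0); rewrite Rinv_r; lra.
  have -> : (w ^ 12 * y) ^ K.+3 * kap K.+3 N (w ^ 8) =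
     w ^ (3 * K + 1) * (w * y) ^ K.+3 * ((w ^ 8) ^ K.+4 * kap K.+3 N (w ^ 8)).
    rewrite (Rpow_mult_distr (w ^ 12)) (Rpow_mult_distr w y) -!pow_mult.
    rewrite (_ : (12 * K.+3)%coq_nat = (3 * K + 1 + (K.+3 + (8 * K.+4)%coq_nat))%N); last lia.
    by rewrite (pow_add _ (3 * K + 1)) (pow_add _ K.+3); ring.
  rewrite Rmult_comm; apply: Rmult_le_compat => //.
  + by apply: Rmult_le_pos; [apply: pow_le; apply: pow_le; lra|exact: kap_ge0].
  + by apply: Rmult_le_pos; apply: pow_le; lra.
  have e1 : w ^ (3 * K + 1) <= w ^ K by apply: pow_le_pow; [lra|lia].
  have e2 := pow_incr (w * y) 1 K.+3 z0; rewrite pow1 in e2.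
  have e3 := pow_le (w * y) K.+3 (proj1 z0).
  have e4 : 0 <= w ^ (3 * K + 1) by apply: pow_le; lra.
  by move: e1 e2 e3 e4; move: (w ^ (3 * K + 1)) ((w * y) ^ K.+3) (w ^ K) => A B D; nra.
apply: expansion2_ext (expansion2_add P2 P1) => N w y _.
rewrite -/(T _ _ _ _) (_ : \rsum_(i < K.+3) T i N w y = \rsum_(i < 3) T i N w y + \rsum_(i < K) T i.+3 N w y).
  by rewrite /T; ring.
by rewrite -[K.+3]/(3 + K)%N big_split_ord.
Qed.

Lemma cos_deriv_SS j t : cos_deriv j.+2 t = - cos_deriv j t.
Proof.
rewrite /cos_deriv !S_INR (_ : t + _ = t + INR j * (PI / 2) + PI); last field.
by rewrite neg_cos.
Qed.

Lemma cos_deriv00 : cos_deriv 0 0 = 1.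
Proof. by rewrite cos_derivE cos_0. Qed.

Lemma cos_deriv10 : cos_deriv 1 0 = 0.
Proof. by rewrite /cos_deriv (_ : INR 1 = 1) // Rplus_0_l Rmult_1_l cos_PI2. Qed.

Lemma cos_taylor3 t (k : nat -> R) :
  \rsum_(i < 3) (cos_deriv (0 + i) 0 / INR (fact i) * t ^ i * k i) = k 0%N - / 2 * t ^ 2 * k 2%N.
Proof.
rewrite !big_ord_recr big_ord0 /= !cos_deriv_SS cos_deriv00 cos_deriv10 /fact /INR /=.
by field.
Qed.

Lemma sin_taylor3 t (k : nat -> R) :
  \rsum_(i < 3) (cos_deriv (3 + i) 0 / INR (fact i) * t ^ i * k i) = t * k 1%N.
Proof.
rewrite !big_ord_recr big_ord0 /= !cos_deriv_SS cos_deriv00 cos_deriv10 /fact /INR /=.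
by field.
Qed.

(** Since [u^3 kap 2] tends to [2 PI^2 / 6] and [t^2 = u^3 y^2], the quadratic term tends to
    [- PI^2 / 6 y^2], which is compensated here; the defect is a term in [w^8 y^2]. *)
Lemma log_modulus_expansion K : expansion2 (fun N w y =>
  trig_sum 0 (pcoefs N (w ^ 8)) (w ^ 12 * y) - kap 0 N (w ^ 8) + PI ^ 2 / 6 * y ^ 2) K.
Proof.
have [l [l0 hl]] := kap_asym 1 K.+1; have [l' hl'] := asym_div hl l0.
have P := expansion2_term (- / 2) (a := 8) (i := 2) (ltac:(lia)) hl'.
apply: expansion2_ext (expansion2_add (trig_tail 0 K) P) => N w y w0.
rewrite (cos_taylor3 _ (fun i => kap i N (w ^ 8))) (_ : INR (fact 2) = 2); last by rewrite /fact INR_IZR_INZ.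
move: (trig_sum _ _ _) (kap _ _ _) (kap _ _ _) => a c d.
by field; lra.
Qed.

(** The saddle point equation [n = kap 1] holds only to leading order, as [n = PI^2 / (6 u^2)]. The
    mismatch leaves a phase of order [w^4 y], which becomes part of the polynomial correction. *)
Lemma phase_expansion K : expansion2 (fun N w y =>
  trig_sum 3 (pcoefs N (w ^ 8)) (w ^ 12 * y) - PI ^ 2 / 6 / w ^ 16 * (w ^ 12 * y)) K.
Proof.
have [l [l0 hl]] := kap_asym 0 K.+1; have [l' hl'] := asym_div hl l0.
have P := expansion2_term 1 (a := 4) (i := 1) (ltac:(lia)) hl'.
apply: expansion2_ext (expansion2_add (trig_tail 3 K) P) => N w y w0.
rewrite (sin_taylor3 _ (fun i => kap i N (w ^ 8))) (_ : INR (fact 1) = 1); last by rewrite /fact INR_IZR_INZ.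
move: (trig_sum _ _ _) (kap _ _ _) => a c.
by field; lra.
Qed.

Lemma expansion2_bounds f K : expansion2 f K -> exists q C b, [/\ ispoly2 q, 0 <= C, 0 < b <= 1 &
  forall w, 0 < w <= b -> exists N0, forall N, (N0 <= N)%N -> forall y, 0 <= y <= / w ->
    Rabs (f N w y - q w y) <= C * w ^ K /\ Rabs (q w y) <= C * w].
Proof.
move=> [q [pq [D D0 hD] [C [b [C0 b0 hC]]]]]; exists q, (C + D), b; split => //; first lra.
move=> w w0; have [N0 h] := hC w w0; exists N0 => N NN y y0.
have wK : 0 <= w ^ K by apply: pow_le; lra.
by have := h N NN y y0; have := hD w y (ltac:(lra)) y0; split; nra.
Qed.

Lemma exp_near p q A : Rabs p <= A -> Rabs q <= A -> Rabs (exp p - exp q) <= exp A * Rabs (p - q).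
Proof.
move=> /Rabs_le_between pA /Rabs_le_between qA.
apply: (mvt_bound (f := exp) (df := exp)) => t tb; first by auto_derive => //; ring.
rewrite Rabs_pos_eq; last exact/Rlt_le/exp_pos.
by apply: exp_le; move: tb; rewrite /Rmin /Rmax; case: Rle_dec; lra.
Qed.

Lemma cos_near p q : Rabs (cos p - cos q) <= Rabs (p - q).
Proof.
rewrite -(Rmult_1_l (Rabs (p - q))).
apply: (mvt_bound (f := cos) (df := fun t => - sin t)) => t tb; first by auto_derive => //; ring.
by rewrite Rabs_Ropp; apply: Rabs_le; have := SIN_bound t; lra.
Qed.

Lemma exp_taylor J p A : Rabs p <= A ->
  Rabs (exp p - \rsum_(i < J) (p ^ i / INR (fact i))) <= exp A * Rabs p ^ J.
Proof.
move=> /Rabs_le_between pA; have := @taylor_bound (fun _ => exp) J 0 p (exp A).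
rewrite Rminus_0_r exp_0 (eq_bigr (fun i : 'I_J => p ^ i / INR (fact i))) => [|i _]; last by rewrite Rmult_1_l.
apply=> [_ t _|t tb]; first by auto_derive => //; ring.
rewrite Rabs_pos_eq; last exact/Rlt_le/exp_pos.
by apply: exp_le; move: tb; rewrite /Rmin /Rmax; case: Rle_dec; lra.
Qed.

Lemma exp_cos_expansion f g K : expansion2 f K -> expansion2 g K -> exists q, ispoly2 q /\
  asym2 (fun N w y => exp (f N w y) * cos (g N w y)) q K.
Proof.
move=> /expansion2_bounds [p [C [b [pp C0 b0 hC]]]] /expansion2_bounds [q [D [c [pq D0 c0 hD]]]].
exists (fun w y => (\rsum_(i < K) (p w y ^ i / INR (fact i))) *
   (\rsum_(i < K) (cos_deriv i 0 * q w y ^ i / INR (fact i)))); split.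
  apply: ispoly2_mul.
    apply: (ispoly2_sum K (f := fun i w y => p w y ^ i / INR (fact i))) => i; apply: ispoly2_mul.
      exact: ispoly2_pow.
    by apply: ispoly2_fst; exact: ispoly_const.
  apply: (ispoly2_sum K (f := fun i w y => cos_deriv i 0 * q w y ^ i / INR (fact i))) => i; apply: ispoly2_mul.
    by apply: ispoly2_mul; [apply: ispoly2_fst; exact: ispoly_const|exact: ispoly2_pow].
  by apply: ispoly2_fst; exact: ispoly_const.
pose A := 2 * C; pose E := exp A * (C + C ^ K); pose F := D + D ^ K.
have eA := exp_pos A; have CK : 0 <= C ^ K by apply: pow_le.
have DK : 0 <= D ^ K by apply: pow_le.
have E0 : 0 <= E by apply: Rmult_le_pos; lra.
have F0 : 0 <= F by rewrite /F; lra.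
exists (E + (exp A + E) * F), (Rmin b c); have m1 := Rmin_l b c; have m2 := Rmin_r b c.
split; [nra|split; [apply: Rmin_glb_lt; lra|lra]|move=> w wb].
have [N1 h1] := hC w (ltac:(lra)); have [N2 h2] := hD w (ltac:(lra)).
exists (maxn N1 N2) => N NN y yw.
have [h3 h4] := h1 N (ltac:(lia)) y yw; have [h5 h6] := h2 N (ltac:(lia)) y yw.
have wK0 : 0 < w ^ K by apply: pow_lt; lra.
have wK1 : w ^ K <= 1 by rewrite -(pow1 K); apply: pow_incr; lra.
have pA : Rabs (p w y) <= A by rewrite /A; nra.
have fA : Rabs (f N w y) <= A.
  rewrite (_ : f N w y = (f N w y - p w y) + p w y); last ring.
  by apply: Rle_trans (Rabs_triang _ _) _; rewrite /A; nra.
have x1 := exp_near fA pA; have x2 := exp_taylor K pA.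
have y1 := cos_near (g N w y) (q w y); have y2 := cos_taylor 0 K (q w y).
rewrite cos_derivE in y2.
have x3 : Rabs (p w y) ^ K <= C ^ K * w ^ K.
  by rewrite -Rpow_mult_distr; apply: pow_incr; split => //; exact: Rabs_pos.
have y3 : Rabs (q w y) ^ K <= D ^ K * w ^ K.
  by rewrite -Rpow_mult_distr; apply: pow_incr; split => //; exact: Rabs_pos.
set P := \rsum_(i < K) _ in x2 *; set Q := \rsum_(i < K) _ in y2 *.
have X : Rabs (exp (f N w y) - P) <= E * w ^ K.
  rewrite (_ : _ - _ = (exp (f N w y) - exp (p w y)) + (exp (p w y) - P)); last ring.
  apply: Rle_trans (Rabs_triang _ _) _; rewrite /E.
  have := Rmult_le_compat_l _ _ _ (Rlt_le _ _ eA) h3; have := Rmult_le_compat_l _ _ _ (Rlt_le _ _ eA) x3; lra.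
have Y : Rabs (cos (g N w y) - Q) <= F * w ^ K.
  rewrite (_ : _ - _ = (cos (g N w y) - cos (q w y)) + (cos (q w y) - Q)); last ring.
  by apply: Rle_trans (Rabs_triang _ _) _; rewrite /F; lra.
have PB : Rabs P <= exp A + E.
  rewrite (_ : P = exp (f N w y) - (exp (f N w y) - P)); last ring.
  apply: Rle_trans (Rabs_triang _ _) _; rewrite Rabs_Ropp; apply: Rplus_le_compat; last nra.
  rewrite Rabs_pos_eq; last exact/Rlt_le/exp_pos.
  by apply: exp_le; apply: Rle_trans (Rle_abs _) fA.
have cB : Rabs (cos (g N w y)) <= 1 by apply: Rabs_le; have := COS_bound (g N w y); lra.
rewrite (_ : _ - _ = (exp (f N w y) - P) * cos (g N w y) + P * (cos (g N w y) - Q)); last ring.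
apply: Rle_trans (Rabs_triang _ _) _; rewrite !Rabs_mult Rmult_plus_distr_r.
apply: Rplus_le_compat.
  have := Rmult_le_compat _ _ _ _ (Rabs_pos _) (Rabs_pos _) X cB; lra.
have := Rmult_le_compat _ _ _ _ (Rabs_pos _) (Rabs_pos _) PB Y; lra.
Qed.

(** A crude lower bound on the correction factor, from which the main integral is seen to stay away
    from zero. *)
Lemma exp_cos_ge f g : expansion2 f 1 -> expansion2 g 1 -> exists b, 0 < b <= 1 /\
  forall w, 0 < w <= b -> exists N0, forall N, (N0 <= N)%N -> forall y, 0 <= y <= / w ->
    / 2 <= exp (f N w y) * cos (g N w y).
Proof.
move=> /expansion2_bounds [p [C [b [pp C0 b0 hC]]]] /expansion2_bounds [q [D [c [pq D0 c0 hD]]]].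
(* This bound on [w] gives [f >= - 1 / 4] and [|g| <= 1 / 4], so the product is at least
   [(3 / 4)^2 > 1 / 2]. *)
pose B := Rmin (Rmin b c) (/ (8 * (C + D + 1))).
have i0 : 0 < / (8 * (C + D + 1)) by apply: Rinv_0_lt_compat; lra.
have m1 := Rmin_l b c; have m2 := Rmin_r b c.
have m3 : B <= Rmin b c by exact: Rmin_l.
have m4 : B <= / (8 * (C + D + 1)) by exact: Rmin_r.
exists B; split; first by split; [do 2!(apply: Rmin_glb_lt => //); lra|lra].
move=> w wB; have [N1 h1] := hC w (ltac:(lra)); have [N2 h2] := hD w (ltac:(lra)).
exists (maxn N1 N2) => N NN y yw.
have [h3 h4] := h1 N (ltac:(lia)) y yw; have [h5 h6] := h2 N (ltac:(lia)) y yw.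
rewrite pow_1 in h3 h5.
have ww : w * (8 * (C + D + 1)) <= 1.
  have := Rmult_le_compat_r (8 * (C + D + 1)) w _ (ltac:(lra)) (Rle_trans _ _ _ (proj2 wB) m4).
  by rewrite Rinv_l; lra.
have f4 : - / 4 <= f N w y.
  by move/Rabs_le_between: h3 => h3; move/Rabs_le_between: h4 => h4; nra.
have g4 : Rabs (g N w y) <= / 4.
  move/Rabs_le_between: h5 => h5; move/Rabs_le_between: h6 => h6.
  by apply: Rabs_le; split; nra.
have e1 := exp_ineq1_le (f N w y).
have := cos_near (g N w y) 0; rewrite cos_0 Rminus_0_r => /Rabs_le_between c1.
nra.
Qed.

(** * Gaussian integrals and the major arc *)

Lemma exp_INR_mul n x : exp (INR n * x) = exp x ^ n.
Proof.
elim: n => [|n IHn]; first by rewrite (_ : INR 0 = 0) // Rmult_0_l exp_0.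
by rewrite S_INR Rmult_plus_distr_r exp_plus IHn Rmult_1_l /= Rmult_comm.
Qed.

Lemma pow_le_exp q y : 0 <= y -> y ^ q <= INR q ^ q * exp y.
Proof.
move=> y0; case: q => [|q].
  by rewrite /= Rmult_1_l -exp_0; exact: exp_le.
have q0 : 0 < INR q.+1 by apply: lt_0_INR; lia.
have -> : exp y = exp (y / INR q.+1) ^ q.+1 by rewrite -exp_INR_mul; congr exp; field; lra.
rewrite -Rpow_mult_distr; apply: pow_incr; split => //.
have e1 := exp_ineq1_le (y / INR q.+1).
have := Rmult_le_compat_l _ _ _ (Rlt_le _ _ q0) e1.
have -> : INR q.+1 * (1 + y / INR q.+1) = INR q.+1 + y by field; lra.
lra.
Qed.

Lemma zeta2_ge1 : 1 <= PI ^ 2 / 6.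
Proof. have := PI2_3_2; rewrite /=; nra. Qed.

Definition gauss (y : R) : R := exp (- (PI ^ 2 / 6 * y ^ 2)).

Lemma ex_derive_gauss y : ex_derive gauss y.
Proof. by rewrite /gauss; auto_derive. Qed.

(** As a function of [w] the truncated integral has derivative [- f (1 / w) / w^2], smaller than any
    power of [w]. So [cauchy_at0] produces the complete moment [M] without improper integrals. *)
Lemma gauss_moment m K : exists M C, 0 <= C /\ forall w, 0 < w <= 1 ->
  Rabs (RInt (fun y => y ^ m * gauss y) 0 (/ w) - M) <= C * w ^ K.+1.
Proof.
pose f y := y ^ m * gauss y.
have df y : ex_derive f y.
  by apply: ex_derive_mult; [auto_derive|exact: ex_derive_gauss].
pose D w := RInt f 0 (/ w).
pose q := (m + 2 + K)%N; pose C := INR q ^ q.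
have C0 : 0 <= C by apply: pow_le; exact: pos_INR.
have dD w : 0 < w -> is_derive D w (f (/ w) * - / w ^ 2).
  move=> w0.
  have h1 : is_derive (fun x => RInt f 0 x) (/ w) (f (/ w)).
    apply: (is_derive_RInt _ _ 0); last exact: ex_derive_continuous.
    by apply: filter_forall => x; apply: RInt_correct; exact: ex_RInt_derivable.
  have h2 : is_derive Rinv w (- / w ^ 2) by auto_derive; [lra|field; lra].
  have := is_derive_comp (fun x => RInt f 0 x) Rinv w _ _ h1 h2.
  by rewrite /scal /= /mult /= Rmult_comm.
have bD w : 0 < w <= 1 -> Rabs (f (/ w) * - / w ^ 2) <= C * w ^ K.
  move=> w0; have [y yE] : exists y, y = / w by eexists.
  have wE : w = / y by rewrite yE Rinv_inv.
  have y1 : 1 <= y by rewrite yE -Rinv_1; apply: Rinv_le_contravar; lra.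
  rewrite wE Rinv_inv !pow_inv Rinv_inv.
  have yK : 0 < y ^ K by apply: pow_lt; lra.
  rewrite Ropp_mult_distr_r_reverse Rabs_Ropp Rabs_pos_eq; last first.
    apply: Rmult_le_pos; last by apply: pow_le; lra.
    by apply: Rmult_le_pos; [apply: pow_le; lra|exact/Rlt_le/exp_pos].
  apply: (Rmult_le_reg_r (y ^ K)) => //.
  have -> : C * / y ^ K * y ^ K = C by field; lra.
  have -> : f y * y ^ 2 * y ^ K = y ^ q * gauss y by rewrite /f /q !pow_add; ring.
  apply: Rle_trans (_ : y ^ q * exp (- y) <= _).
    apply: Rmult_le_compat_l; first by apply: pow_le; lra.
    apply: exp_le; have z1 := zeta2_ge1; apply: Ropp_le_contravar.
    have yy : y <= y ^ 2 by rewrite /=; nra.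
    nra.
  have := Rmult_le_compat_r (exp (- y)) _ _ (Rlt_le _ _ (exp_pos _)) (@pow_le_exp q y (ltac:(lra))).
  by rewrite Rmult_assoc -exp_plus Rplus_opp_r exp_0 Rmult_1_r.
have cau u v : 0 < u <= v -> v <= 1 -> Rabs (D v - D u) <= C * v ^ K.+1.
  move=> uv v1.
  apply: Rle_trans (mvt_bound (f := D) (df := fun w => f (/ w) * - / w ^ 2) (M := C * v ^ K) _ _) _.
  - by move=> t; rewrite Rmin_left ?Rmax_right; try lra; move=> tb; apply: dD; lra.
  - move=> t; rewrite Rmin_left ?Rmax_right; try lra; move=> tb.
    apply: Rle_trans (bD t _) _; first lra.
    by apply: Rmult_le_compat_l => //; apply: pow_incr; lra.
  rewrite Rabs_pos_eq; last lra.
  rewrite (_ : C * v ^ K.+1 = C * v ^ K * v); last by rewrite /=; ring.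
  apply: Rmult_le_compat_l; last lra.
  by apply: Rmult_le_pos => //; apply: pow_le; lra.
have [M hM] := @cauchy_at0 D 1 C K (ltac:(lra)) C0 cau.
by exists M, C.
Qed.

Lemma ex_derive_pe2 l w y : ex_derive (pe2 l w) y.
Proof.
elim: l => [|a l IHl] /=; first exact: ex_derive_const.
apply: ex_derive_plus; first exact: ex_derive_const.
by apply: ex_derive_mult => //; exact: ex_derive_id.
Qed.

Lemma gauss_pe2 l K : exists b C, 0 <= C /\ forall w, 0 < w <= 1 ->
  Rabs (RInt (fun y => gauss y * pe2 l w y) 0 (/ w) - pe b w) <= C * w ^ K.+1.
Proof.
suff H m : exists b C, 0 <= C /\ forall w, 0 < w <= 1 ->
    Rabs (RInt (fun y => y ^ m * gauss y * pe2 l w y) 0 (/ w) - pe b w) <= C * w ^ K.+1.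
  have [b [C [C0 hC]]] := H 0%N; exists b, C; split => // w w0.
  rewrite (RInt_ext _ (fun y => y ^ 0 * gauss y * pe2 l w y)) => [|y _]; first exact: hC.
  by rewrite /= Rmult_1_l.
elim: l m => [|a l IHl] m.
  exists [::], 0; split => [|w w0]; first lra.
  rewrite (RInt_ext _ (fun=> 0)) => [|y _]; last by rewrite /= Rmult_0_r.
  by rewrite RInt_const /scal /= /mult /= Rmult_0_r Rminus_0_r Rabs_R0 Rmult_0_l; lra.
have [b [C [C0 hC]]] := IHl m.+1; have [M [D [D0 hD]]] := gauss_moment m K.
have [c cE] := pe_scal M a; have [d dE] := pe_add c b.
have [A A0 hA] := pe_bounded a.
exists d, (A * D + C); split => [|w w0]; first nra.
have -> : RInt (fun y => y ^ m * gauss y * pe2 (a :: l) w y) 0 (/ w) =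
   pe a w * RInt (fun y => y ^ m * gauss y) 0 (/ w) + RInt (fun y => y ^ m.+1 * gauss y * pe2 l w y) 0 (/ w).
  apply: is_RInt_unique; apply: (is_RInt_ext (fun y => pe a w * (y ^ m * gauss y) + y ^ m.+1 * gauss y * pe2 l w y)).
    by move=> y _; rewrite /=; ring.
  apply: (is_RInt_plus (V := R_NormedModule)).
    apply: (is_RInt_scal (V := R_NormedModule)); apply: RInt_correct; apply: ex_RInt_derivable => y.
    by apply: ex_derive_mult; [auto_derive|exact: ex_derive_gauss].
  apply: RInt_correct; apply: ex_RInt_derivable => y; apply: ex_derive_mult; last exact: ex_derive_pe2.
  by apply: ex_derive_mult; [auto_derive|exact: ex_derive_gauss].
rewrite dE cE (_ : _ - _ = pe a w * (RInt (fun y => y ^ m * gauss y) 0 (/ w) - M)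
  + (RInt (fun y => y ^ m.+1 * gauss y * pe2 l w y) 0 (/ w) - pe b w)); last ring.
apply: Rle_trans (Rabs_triang _ _) _; rewrite Rabs_mult Rmult_plus_distr_r.
apply: Rplus_le_compat; last exact: hC.
rewrite Rmult_assoc; apply: Rmult_le_compat; try exact: Rabs_pos; last exact: hD.
by apply: hA; rewrite Rabs_pos_eq; lra.
Qed.

(** The Fourier integrand at [t = w^12 y], divided by its value at [t = 0], with the frequency
    written as [n = PI^2 / 6 / w^16]. *)
Definition major_fun (N : nat) (w y : R) : R :=
  exp (trig_sum 0 (pcoefs N (w ^ 8)) (w ^ 12 * y) - kap 0 N (w ^ 8)) *
  cos (trig_sum 3 (pcoefs N (w ^ 8)) (w ^ 12 * y) - PI ^ 2 / 6 / w ^ 16 * (w ^ 12 * y)).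

Lemma ex_derive_trig_sum q s t : ex_derive (trig_sum q s) t.
Proof.
eexists; refine (is_derive_rsum s (F := fun p t => p.2 * cos_deriv q (INR p.1.+1 * t))
  (F' := fun p t => p.2 * (INR p.1.+1 * cos_deriv q.+1 (INR p.1.+1 * t))) _) => p.
apply: is_derive_scal; move: (INR p.1.+1) => k.
have h : is_derive (fun t => k * t) t k by auto_derive => //; ring.
exact: (is_derive_comp _ _ t _ _ (is_derive_cos_deriv q (k * t)) h).
Qed.

Lemma ex_derive_major_fun N w y : ex_derive (major_fun N w) y.
Proof.
have h q : ex_derive (fun y => trig_sum q (pcoefs N (w ^ 8)) (w ^ 12 * y)) y.
  apply: (ex_derive_comp (trig_sum q (pcoefs N (w ^ 8)))); first exact: ex_derive_trig_sum.
  by auto_derive.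
have h0 := h 0%N; have h3 := h 3%N.
apply: ex_derive_mult.
  apply: (ex_derive_comp exp); first by auto_derive.
  by apply: ex_derive_minus => //; exact: ex_derive_const.
apply: (ex_derive_comp cos); first by auto_derive.
by apply: ex_derive_minus => //; auto_derive.
Qed.

Lemma major_arc K : exists l, 0 < pe l 0 /\
  asym (fun N w => RInt (major_fun N w) 0 (/ w)) (pe l) K.+1.
Proof.
have majorE N w y : major_fun N w y = gauss y *
   (exp (trig_sum 0 (pcoefs N (w ^ 8)) (w ^ 12 * y) - kap 0 N (w ^ 8) + PI ^ 2 / 6 * y ^ 2) *
    cos (trig_sum 3 (pcoefs N (w ^ 8)) (w ^ 12 * y) - PI ^ 2 / 6 / w ^ 16 * (w ^ 12 * y))).
  rewrite -Rmult_assoc /gauss -exp_plus /major_fun; congr (exp _ * _); ring.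
have [q [[lq qE] [C [b [C0 b0 hC]]]]] := exp_cos_expansion (log_modulus_expansion K.+2) (phase_expansion K.+2).
have [b1 [b10 hb1]] := exp_cos_ge (log_modulus_expansion 1) (phase_expansion 1).
have [l [D [D0 hD]]] := gauss_pe2 lq K.
have g0 y : 0 < gauss y by exact: exp_pos.
have g1 y : gauss y <= 1.
  rewrite -exp_0; apply: exp_le; have := zeta2_ge1 => z1; have := pow2_ge_0 y; nra.
have iw w : 0 < w -> 0 < / w by exact: Rinv_0_lt_compat.
have exg w : ex_RInt (fun y => gauss y * pe2 lq w y) 0 (/ w).
  by apply: ex_RInt_derivable => y; apply: ex_derive_mult; [exact: ex_derive_gauss|exact: ex_derive_pe2].
have exm N w c d : ex_RInt (major_fun N w) c d.
  by apply: ex_RInt_derivable => y; exact: ex_derive_major_fun.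
have key : asym (fun N w => RInt (major_fun N w) 0 (/ w)) (pe l) K.+1.
  exists (C + D), b; split => //; first lra.
  move=> w w0; have [N0 h] := hC w w0; exists N0 => N NN.
  have i0 := iw w (proj1 w0).
  have diff : RInt (fun y => major_fun N w y - gauss y * pe2 lq w y) 0 (/ w) =
      RInt (major_fun N w) 0 (/ w) - RInt (fun y => gauss y * pe2 lq w y) 0 (/ w).
    apply: is_RInt_unique; apply: (is_RInt_minus (V := R_NormedModule)); apply: RInt_correct => //.
  rewrite (_ : _ - _ = RInt (fun y => major_fun N w y - gauss y * pe2 lq w y) 0 (/ w)
     + (RInt (fun y => gauss y * pe2 lq w y) 0 (/ w) - pe l w)); last by rewrite diff; ring.
  apply: Rle_trans (Rabs_triang _ _) _; rewrite Rmult_plus_distr_r.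
  apply: Rplus_le_compat; last by apply: hD; lra.
  apply: Rle_trans (Rabs_RInt_le (M := C * w ^ K.+2) _ _ _) _; first lra.
  - apply: (ex_RInt_minus (V := R_NormedModule)) => //.
  - move=> y y0; rewrite majorE -Rmult_minus_distr_l Rabs_mult -qE (Rabs_pos_eq (gauss y)); last exact: Rlt_le.
    have := h N NN y y0; have := Rabs_pos (exp (trig_sum 0 (pcoefs N (w ^ 8)) (w ^ 12 * y) - kap 0 N (w ^ 8) + PI ^ 2 / 6 * y ^ 2) *
      cos (trig_sum 3 (pcoefs N (w ^ 8)) (w ^ 12 * y) - PI ^ 2 / 6 / w ^ 16 * (w ^ 12 * y)) - q w y).
    by move: (Rabs _) => z z0 z1; have := g1 y; have := g0 y; nra.
  by apply: Req_le; rewrite Rminus_0_r /=; field; lra.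
exists l; split => //.
(* Positivity of the constant term, which the logarithm requires, follows without computing a
   Gaussian integral: the integrand is at least [gauss / 2], and already [[0, 1]] contributes
   [c]. *)
pose c := / 2 * gauss 1.
have c0 : 0 < c by rewrite /c; have := g0 1; lra.
have low w : 0 < w <= b1 -> exists N0, forall N, (N0 <= N)%N -> c <= RInt (major_fun N w) 0 (/ w).
  move=> w0; have [N0 h] := hb1 w w0; exists N0 => N NN.
  have i1 : 1 <= / w by rewrite -Rinv_1; apply: Rinv_le_contravar; lra.
  have pos y : 0 <= y <= / w -> / 2 * gauss y <= major_fun N w y.
    by move=> y0; rewrite majorE; have := h N NN y y0; have := g0 y; nra.
  rewrite -(RInt_Chasles _ 0 1 (/ w)) // /plus /=.
  have r0 : 0 <= RInt (major_fun N w) 1 (/ w).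
    apply: RInt_ge_0; [lra|exact: exm|move=> y y0].
    by have := pos y (ltac:(lra)); have := g0 y; lra.
  suff : c <= RInt (major_fun N w) 0 1 by lra.
  have -> : c = RInt (fun=> c) 0 1 by rewrite RInt_const /scal /= /mult /=; ring.
  apply: RInt_le; [lra|exact: ex_RInt_const|exact: exm|move=> y y0].
  apply: Rle_trans (pos y _); last lra.
  apply: Rmult_le_compat_l; first lra.
  apply: exp_le; apply: Ropp_le_contravar; have z1 := zeta2_ge1.
  by apply: Rmult_le_compat_l; [lra|apply: pow_incr; lra].
have [E [e [E0 e0 hE]]] := key.
have [A A0 hA] := pe_bounded (behead l).
have peE w : pe l w = pe l 0 + w * pe (behead l) w by case: (l) => [|a l'] /=; ring.
(* With this [w], everything that separates the integral from [pe l 0] is less than [c]. *)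
pose w := Rmin (Rmin e b1) (c / (2 * (E + A + 1))).
have c1 : 0 < c / (2 * (E + A + 1)) by apply: Rdiv_lt_0_compat; lra.
have w1 : w <= Rmin e b1 by exact: Rmin_l.
have w2 : w <= c / (2 * (E + A + 1)) by exact: Rmin_r.
have m1 := Rmin_l e b1; have m2 := Rmin_r e b1.
have w0 : 0 < w by do 2!(apply: Rmin_glb_lt => //); lra.
clearbody w.
have [N1 h1] := low w (ltac:(lra)); have [N2 h2] := hE w (ltac:(lra)).
have := h1 (N1 + N2)%N (ltac:(lia)); have := h2 (N1 + N2)%N (ltac:(lia)).
move: (RInt _ _ _) => I /Rabs_le_between hI cI.
have wK : w ^ K.+1 <= w by rewrite -{2}(pow_1 w); apply: pow_le_pow => //; lra.
have := hA w (ltac:(rewrite Rabs_pos_eq; lra)) => /Rabs_le_between hA'.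
have := peE w => pw.
have w3 := Rmult_le_compat_r (2 * (E + A + 1)) _ _ (ltac:(lra)) w2.
have w4 : c / (2 * (E + A + 1)) * (2 * (E + A + 1)) = c by field; lra.
rewrite w4 in w3.
have EK := Rmult_le_compat_l E _ _ E0 wK.
nra.
Qed.

(** * The minor arc *)

Lemma INR_sum (I : Type) (s : seq I) (F : I -> nat) :
  INR (\sum_(i <- s) F i) = \rsum_(i <- s) INR (F i).
Proof. by apply: (big_morph INR) => // x y; rewrite plus_INR. Qed.

(** The weighted partition numbers satisfy the recurrence of Fourier coefficients: this is
    [npart_rec] multiplied by [exp (- m u)]. Only products [d e <= n] matter, so truncation at
    [N >= n] is exact. *)
Lemma partition_fourier N n u : (n <= N)%N ->
  fourier (pcoefs N u) (Z.of_nat n) = 2 * PI * (INR (npart n) * exp (- (INR n * u))).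
Proof.
pose c m := INR (npart m) * exp (- (INR m * u)).
move=> nN; apply: (fourier_coef (c := c) (N := N)) => //.
  by rewrite /c npart0 (_ : INR 0 = 0) // Rmult_0_l Ropp_0 exp_0 /INR; ring.
move=> m mN.
rewrite (sum_pcoefs N u (fun k a => a * INR k * (if (k.-1 < m)%N then c (m - k)%N else 0))).
rewrite /c -Rmult_assoc -mult_INR (_ : (m * npart m)%coq_nat = (m * npart m)%N) // (npart_rec mN).
rewrite INR_sum big_distrl; apply: eq_bigr => d _.
rewrite INR_sum big_distrl; apply: eq_bigr => e _ /=.
have -> : ((d.+1 * e.+1).-1 < m)%N = (d.+1 * e.+1 <= m)%N by lia.
rewrite /shiftn; case: ifP => de; last by rewrite muln0 (_ : INR 0 = 0) //; ring.
rewrite !mult_INR minus_INR; last lia.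
have -> : exp (- (INR m * u)) = exp (- (INR (d.+1 * e.+1) * u)) * exp (- ((INR m - INR (d.+1 * e.+1)) * u)).
  by rewrite -exp_plus; congr exp; ring.
rewrite !mult_INR; have e0 : INR e.+1 <> 0 by apply: not_0_INR.
by field.
Qed.

Lemma trig_sum0 s t : trig_sum 0 s t = cos_sum s t.
Proof. by apply: eq_bigr => p _; rewrite cos_derivE. Qed.

Lemma trig_sum3 s t : trig_sum 3 s t = sin_sum s t.
Proof. by apply: eq_bigr => p _; rewrite sin_derivE. Qed.

Lemma fourier_half s z : fourier s z = 2 * RInt (fourier_fun s z) 0 PI.
Proof.
have even t : fourier_fun s z (- t) = fourier_fun s z t.
  have cE : cos_sum s (- t) = cos_sum s t.
    by apply: eq_bigr => p _; rewrite Ropp_mult_distr_r_reverse cos_neg.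
  have sE : sin_sum s (- t) = - sin_sum s t.
    rewrite -(Rmult_1_l (sin_sum s t)) Ropp_mult_distr_l /sin_sum big_distrr.
    by apply: eq_bigr => p _ /=; rewrite Ropp_mult_distr_r_reverse sin_neg; ring.
  rewrite /fourier_fun cE sE (_ : - sin_sum s t - _ = - (sin_sum s t - IZR z * t)); last ring.
  by rewrite cos_neg.
have ex a b := ex_RInt_fourier s z a b.
rewrite /fourier -(RInt_Chasles _ (- PI) 0 PI) // /plus /=.
suff -> : RInt (fourier_fun s z) (- PI) 0 = RInt (fourier_fun s z) 0 PI by ring.
have := RInt_comp_lin (fourier_fun s z) (-1) 0 PI 0 (ex _ _).
have -> : -1 * PI + 0 = - PI by ring.
have -> : -1 * 0 + 0 = 0 by ring.
move=> <-; rewrite -(opp_RInt_swap (V := R_CompleteNormedModule)); last first.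
  apply: ex_RInt_scal; apply: (ex_RInt_ext (fourier_fun s z)) => // x _.
  by rewrite -even; congr fourier_fun; ring.
rewrite -RInt_opp; last first.
  apply: ex_RInt_scal; apply: (ex_RInt_ext (fourier_fun s z)) => // x _.
  by rewrite -even; congr fourier_fun; ring.
apply: RInt_ext => x _; rewrite /opp /scal /= /mult /= (_ : -1 * x + 0 = - x); last ring.
by rewrite even; ring.
Qed.

(** The real part of the geometric sum of [(r e^(i t))^k], cleared of its denominator
    [|1 - r e^(i t)|^2]. *)
Lemma geom_cos_sum r t N :
  (1 - 2 * r * cos t + r ^ 2) * (\rsum_(k < N) (r ^ k.+1 * cos (INR k.+1 * t))) =
  r * cos t - r ^ 2 - r ^ N.+1 * cos (INR N.+1 * t) + r ^ N.+2 * cos (INR N * t).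
Proof.
elim: N => [|N IHN].
  by rewrite big_ord0 (_ : INR 1 = 1) // (_ : INR 0 = 0) // Rmult_0_l Rmult_1_l cos_0; ring.
rewrite big_ord_recr Rmult_plus_distr_l IHN.
have -> : cos (INR N.+2 * t) = 2 * cos t * cos (INR N.+1 * t) - cos (INR N * t).
  rewrite (_ : INR N.+2 * t = INR N.+1 * t + t); last by rewrite !S_INR; ring.
  rewrite (_ : INR N * t = INR N.+1 * t - t); last by rewrite !S_INR; ring.
  by rewrite cos_plus cos_minus; ring.
by rewrite /=; ring.
Qed.

Lemma geom_sum r N : (1 - r) * (\rsum_(k < N) r ^ k.+1) = r - r ^ N.+1.
Proof.
elim: N => [|N IHN]; first by rewrite big_ord0; ring.
by rewrite big_ord_recr Rmult_plus_distr_l IHN /=; ring.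
Qed.

(** With [s = 1 - r] and [d = 1 - cos t], the infinite sum is [r (1 + r) d / (s (s^2 + 2 r d))], and
    [r >= 1 / 2] simplifies it. The subtracted term absorbs the truncation. *)
Lemma geom_gap r t N : / 2 <= r < 1 ->
  / 2 * (1 - cos t) / ((1 - r) * ((1 - r) ^ 2 + 2 * (1 - cos t))) - 3 * r ^ N / (1 - r) ^ 2
  <= \rsum_(k < N) (r ^ k.+1 * (1 - cos (INR k.+1 * t))).
Proof.
move=> r0.
have -> : \rsum_(k < N) (r ^ k.+1 * (1 - cos (INR k.+1 * t))) =
    \rsum_(k < N) r ^ k.+1 - \rsum_(k < N) (r ^ k.+1 * cos (INR k.+1 * t)).
  by rewrite -rsum_minus; apply: eq_bigr => k _; ring.
have := geom_cos_sum r t N; have := geom_sum r N.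
move: (\rsum_(k < N) _) (\rsum_(k < N) _) => T S hS hT.
have hc := COS_bound t; have hc1 := COS_bound (INR N.+1 * t); have hc2 := COS_bound (INR N * t).
move: hT hc; have [d dE] : exists d, d = 1 - cos t by eexists.
rewrite -dE (_ : cos t = 1 - d); last by lra.
move: (cos (INR N.+1 * t)) (cos (INR N * t)) hc1 hc2 => c1 c2 hc1 hc2 hT hd.
have [s sE] : exists s, s = 1 - r by eexists.
rewrite -sE; have rE : r = 1 - s by lra.
have s0 : 0 < s <= / 2 by lra.
have q0 : 0 <= r ^ N by apply: pow_le; lra.
have D0 : 0 < s ^ 2 + 2 * r * d by rewrite /=; nra.
have SE : S = r / s - r ^ N.+1 / s.
  by apply: (Rmult_eq_reg_l (1 - r)); [rewrite hS -sE; field; lra|lra].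
have TE : T = (r * (1 - d) - r ^ 2) / (s ^ 2 + 2 * r * d)
   - (r ^ N.+1 * c1 - r ^ N.+2 * c2) / (s ^ 2 + 2 * r * d).
  apply: (Rmult_eq_reg_l (1 - 2 * r * (1 - d) + r ^ 2)); last by rewrite rE; move: D0; rewrite rE /=; nra.
  rewrite hT (_ : 1 - 2 * r * (1 - d) + r ^ 2 = s ^ 2 + 2 * r * d); last by rewrite sE; ring.
  by field; lra.
have main : S - T = r * (1 + r) * d / (s * (s ^ 2 + 2 * r * d)) - r ^ N.+1 / s
   + (r ^ N.+1 * c1 - r ^ N.+2 * c2) / (s ^ 2 + 2 * r * d).
  rewrite SE TE (_ : r * (1 + r) * d = r * (s ^ 2 + 2 * r * d) - s * (r * (1 - d) - r ^ 2)); last by rewrite sE; ring.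
  by field; lra.
have m1 : / 2 * d / (s * (s ^ 2 + 2 * d)) <= r * (1 + r) * d / (s * (s ^ 2 + 2 * r * d)).
  apply: Rmult_le_compat; [nra| |nra|].
    by apply/Rlt_le/Rinv_0_lt_compat; apply: Rmult_lt_0_compat; [lra|rewrite /=; nra].
  apply: Rinv_le_contravar; first by apply: Rmult_lt_0_compat; lra.
  by apply: Rmult_le_compat_l; [lra|nra].
have m2 : r ^ N.+1 / s <= r ^ N / s ^ 2.
  apply: (Rmult_le_reg_r (s ^ 2)); first by apply: pow_lt; lra.
  have -> : r ^ N.+1 / s * s ^ 2 = r ^ N * (r * s) by rewrite /=; field; lra.
  have -> : r ^ N / s ^ 2 * s ^ 2 = r ^ N by field; lra.
  nra.
have m3 : - (2 * r ^ N / s ^ 2) <= (r ^ N.+1 * c1 - r ^ N.+2 * c2) / (s ^ 2 + 2 * r * d).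
  have b1 : - (2 * r ^ N) <= r ^ N.+1 * c1 - r ^ N.+2 * c2.
    have x1 : r * c1 - r ^ 2 * c2 >= -2 by rewrite /=; nra.
    have -> : r ^ N.+1 * c1 - r ^ N.+2 * c2 = r ^ N * (r * c1 - r ^ 2 * c2) by rewrite /=; ring.
    nra.
  have i0 := Rinv_0_lt_compat _ D0.
  have i1 : / (s ^ 2 + 2 * r * d) <= / s ^ 2.
    by apply: Rinv_le_contravar; [apply: pow_lt; lra|nra].
  rewrite /Rdiv; nra.
rewrite main (_ : 3 * r ^ N / s ^ 2 = r ^ N / s ^ 2 + 2 * r ^ N / s ^ 2); last by field; lra.
lra.
Qed.

(** All terms of the difference are nonpositive. Keeping only those with [e = 1] leaves a geometric
    series in [exp (- u)]. *)
Lemma cos_sum_gap N u t : (0 < N)%N ->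
  cos_sum (pcoefs N u) t - kap 0 N u <= - \rsum_(k < N) (exp (- u) ^ k.+1 * (1 - cos (INR k.+1 * t))).
Proof.
move=> N0.
rewrite /cos_sum (sum_pcoefs N u (fun k a => a * cos (INR k * t))) /kap -rsum_minus.
rewrite -[X in _ <= - X]Rmult_1_l Ropp_mult_distr_l big_distrr; apply: rsum_le => d.
case: N N0 d => // N _ d; rewrite -exp_INR_mul -rsum_minus big_ord_recl /= muln1.
have h1 := COS_bound (INR d.+1 * t).
rewrite (_ : INR 1 = 1) // !Rdiv_1_r Rmult_1_r.
rewrite (_ : INR d.+1 * - u = - (INR d.+1 * u)); last ring.
suff H (e : nat) : exp (- (INR (d.+1 * e.+1) * u)) / INR e.+1 * cos (INR (d.+1 * e.+1) * t)
   - exp (- (INR (d.+1 * e.+1) * u)) / INR e.+1 * 1 <= 0.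
  have := rsum_le (index_enum 'I_N) (fun e : 'I_N => H (bump 0 e)); rewrite [X in _ <= X]big1 // => H'.
  by apply: Rle_trans (Rplus_le_compat_l _ _ _ H') _; lra.
have h2 := COS_bound (INR (d.+1 * e.+1) * t).
have a0 : 0 <= exp (- (INR (d.+1 * e.+1) * u)) / INR e.+1.
  by apply: Rdiv_le_0_compat; [exact/Rlt_le/exp_pos|apply: lt_0_INR; lia].
nra.
Qed.

(** The cosine decreases on [[0, PI]], and [cos x <= 1 - x^2 / 2 + x^4] with [x^4 <= x^2 / 4]. *)
Lemma one_minus_cos_ge x t : 0 <= x <= / 2 -> x <= t <= PI -> x ^ 2 / 4 <= 1 - cos t.
Proof.
move=> x0 xt.
have c1 : cos t <= cos x.
  have [xt'|->] := proj1 xt; last exact: Rle_refl.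
  by apply: Rlt_le; apply: cos_decreasing_1 => //; lra.
have := cos_taylor 0 4 x; rewrite cos_derivE.
have -> : \rsum_(i < 4) (cos_deriv (0 + i) 0 * x ^ i / INR (fact i)) = 1 - x ^ 2 / 2.
  rewrite !big_ord_recr big_ord0 /= !cos_deriv_SS cos_deriv00 cos_deriv10 /fact /INR /=.
  by field.
rewrite (Rabs_pos_eq x) /=; last lra.
move=> /Rabs_le_between [h1 h2].
have x2 : x * (x * (x * (x * 1))) <= / 4 * (x * (x * 1)).
  rewrite (_ : x * (x * (x * (x * 1))) = (x * x) * (x * (x * 1))); last ring.
  by apply: Rmult_le_compat_r; nra.
lra.
Qed.

Lemma minor_arc K : exists C b, [/\ 0 <= C, 0 < b <= 1 & forall w, 0 < w <= b -> exists N0, forall N, (N0 <= N)%N ->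
  forall t, w ^ 11 <= t <= PI -> exp (cos_sum (pcoefs N (w ^ 8)) t - kap 0 N (w ^ 8)) <= C * w ^ K].
Proof.
have q0 : 0 <= INR K ^ K by apply: pow_le; exact: pos_INR.
exists (exp 1 * (INR K ^ K * 12 ^ K)), (/ 2); split; [|lra|].
  by apply: Rmult_le_pos; [exact/Rlt_le/exp_pos|apply: Rmult_le_pos => //; apply: pow_le; lra].
move=> w w0; pose u := w ^ 8; pose r := exp (- u).
have u0 : 0 < u by apply: pow_lt; lra.
have u1 : u <= / 2.
  apply: Rle_trans (_ : w ^ 1 <= _); last by rewrite pow_1; lra.
  by apply: pow_le_pow => //; lra.
have r0 : / 2 <= r < 1.
  split; last by rewrite -exp_0; apply: exp_increasing; lra.
  by have := exp_ineq1_le (- u); rewrite /r; lra.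
have r1 : 1 - r <= u by have := exp_ineq1_le (- u); rewrite /r; lra.
have e0 : 0 < (1 - r) ^ 2 / 3 by apply: Rdiv_lt_0_compat; [apply: pow_lt|]; lra.
have [N0 hN] := pow_lt_1_zero r (ltac:(rewrite Rabs_pos_eq; lra)) _ e0.
exists N0.+1 => N NN t tb.
apply: Rle_trans (exp_le (cos_sum_gap _ _ _)) _; first lia.
have x0 : 0 <= w ^ 11 <= / 2.
  split; first by apply: pow_le; lra.
  apply: Rle_trans (_ : w ^ 1 <= _); last by rewrite pow_1; lra.
  by apply: pow_le_pow => //; lra.
have d0 := one_minus_cos_ge x0 tb.
have gap := geom_gap t N r0.
have err : 3 * r ^ N / (1 - r) ^ 2 <= 1.
  have := hN N (ltac:(lia)); rewrite Rabs_pos_eq; last by apply: pow_le; lra.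
  move=> h; apply: (Rmult_le_reg_r ((1 - r) ^ 2)); first by apply: pow_lt; lra.
  by rewrite /Rdiv Rmult_assoc Rinv_l; [lra|apply: pow_nonzero; lra].
(* Here [1 - r <= u = w^8] and [1 - cos t >= w^22 / 4], so [u^3 = w^24 <= 4 w^2 (1 - cos t)] and the
   gap is at least [1 / (12 w^2)]; [exp (- 1 / (12 w^2))] then beats every power of [w]. *)
have main : / (12 * w ^ 2) <= / 2 * (1 - cos t) / ((1 - r) * ((1 - r) ^ 2 + 2 * (1 - cos t))).
  have s0 : 0 < 1 - r by lra.
  move: (1 - cos t) d0 => d d0; move: (1 - r) r1 s0 => s s1 s0.
  have w2 : 0 < w ^ 2 by apply: pow_lt; lra.
  have d1 : 0 < d by apply: Rlt_le_trans d0; apply: Rdiv_lt_0_compat; [do 2!apply: pow_lt; lra|lra].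
  have p0 : 0 < s * (s ^ 2 + 2 * d) by apply: Rmult_lt_0_compat => //; have := pow2_ge_0 s; lra.
  have p1 : s * (s ^ 2 + 2 * d) <= 6 * w ^ 2 * d.
    apply: Rle_trans (_ : u * (u ^ 2 + 2 * d) <= _).
      apply: Rmult_le_compat; [lra|have := pow2_ge_0 s; lra|lra|].
      by apply: Rplus_le_compat_r; apply: pow_incr; lra.
    have -> : u * (u ^ 2 + 2 * d) = w ^ 2 * (4 * ((w ^ 11) ^ 2 / 4)) + 2 * u * d by rewrite /u; field.
    have u2 : u <= w ^ 2 by apply: pow_le_pow => //; lra.
    have := Rmult_le_compat_l _ _ _ (Rlt_le _ _ w2) d0; have := Rmult_le_compat_r _ _ _ (Rlt_le _ _ d1) u2.
    lra.
  apply: (Rmult_le_reg_r (12 * w ^ 2 * (s * (s ^ 2 + 2 * d)))); first by apply: Rmult_lt_0_compat; lra.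
  have -> : / (12 * w ^ 2) * (12 * w ^ 2 * (s * (s ^ 2 + 2 * d))) = s * (s ^ 2 + 2 * d) by field; lra.
  have -> : / 2 * d / (s * (s ^ 2 + 2 * d)) * (12 * w ^ 2 * (s * (s ^ 2 + 2 * d))) = 6 * w ^ 2 * d.
    by move: p0; move: (s * (s ^ 2 + 2 * d)) => p p0; field; lra.
  done.
apply: Rle_trans (exp_le (_ : _ <= 1 + - / (12 * w ^ 2))) _; first by rewrite -/r; lra.
rewrite exp_plus Rmult_assoc; apply: Rmult_le_compat_l; first exact/Rlt_le/exp_pos.
have y0 : 0 < / (12 * w ^ 2) by apply: Rinv_0_lt_compat; rewrite /=; nra.
have := pow_le_exp K (Rlt_le _ _ y0).
move=> h; rewrite exp_Ropp.
have yK : 0 < (/ (12 * w ^ 2)) ^ K by apply: pow_lt.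
have ye := exp_pos (/ (12 * w ^ 2)).
apply: (Rmult_le_reg_r (exp (/ (12 * w ^ 2)))) => //.
rewrite Rinv_l; last lra.
apply: Rle_trans (_ : INR K ^ K * 12 ^ K * (w ^ 2) ^ K * exp (/ (12 * w ^ 2)) <= _); last first.
  apply: Rmult_le_compat_r; first lra.
  apply: Rmult_le_compat_l; first by apply: Rmult_le_pos => //; apply: pow_le; lra.
  apply: pow_incr; split; first by apply: pow_le; lra.
  by rewrite /=; nra.
apply: (Rmult_le_reg_l ((/ (12 * w ^ 2)) ^ K)) => //; rewrite Rmult_1_r.
have -> : (/ (12 * w ^ 2)) ^ K * (INR K ^ K * 12 ^ K * (w ^ 2) ^ K * exp (/ (12 * w ^ 2))) =
   INR K ^ K * exp (/ (12 * w ^ 2)) * ((/ (12 * w ^ 2)) * (12 * w ^ 2)) ^ K.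
  by rewrite !Rpow_mult_distr; ring.
by rewrite Rinv_l ?pow1 ?Rmult_1_r //; rewrite /=; nra.
Qed.

(** * Expansion of the logarithm of the partition function *)

Lemma npart_circle K : exists l C b, [/\ 0 < pe l 0, 0 <= C, 0 < b <= 1 &
  forall w n, 0 < w <= b -> INR n * w ^ 16 = PI ^ 2 / 6 -> exists N0, forall N, (N0 <= N)%N ->
  Rabs (PI * INR (npart n) * exp (- (INR n * w ^ 8)) * exp (- kap 0 N (w ^ 8)) / w ^ 12 - pe l w)
    <= C * w ^ K.+1].
Proof.
have [l [l0 [C [b [C0 b0 hC]]]]] := major_arc K.
(* The additional 12 pays for the division by [w^12], the Jacobian of [t = w^12 y]. *)
have [D [c [D0 c0 hD]]] := minor_arc (12 + K.+1).
have P0 := PI_RGT_0.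
exists l, (C + PI * D), (Rmin b c); have m1 := Rmin_l b c; have m2 := Rmin_r b c.
split => //; [nra|split; [apply: Rmin_glb_lt; lra|lra]|move=> w n wb nw].
have [N1 h1] := hC w (ltac:(lra)); have [N2 h2] := hD w (ltac:(lra)).
exists (n + (N1 + N2))%N => N NN; pose s := pcoefs N (w ^ 8); pose k := kap 0 N (w ^ 8).
pose f t := exp (cos_sum s t - k) * cos (sin_sum s t - INR n * t).
have fE t : f t = exp (- k) * fourier_fun s (Z.of_nat n) t.
  by rewrite /f /fourier_fun /Rminus exp_plus -INR_IZR_INZ; ring.
have exf x y : ex_RInt f x y.
  apply: (ex_RInt_ext (fun t => exp (- k) * fourier_fun s (Z.of_nat n) t)) => [t _|]; first by rewrite fE.
  by apply: (ex_RInt_scal (V := R_NormedModule)); exact: ex_RInt_fourier.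
have w12 : 0 < w ^ 12 by apply: pow_lt; lra.
have tot : PI * INR (npart n) * exp (- (INR n * w ^ 8)) * exp (- k) = RInt f 0 PI.
  rewrite (RInt_ext _ (fun t => scal (exp (- k)) (fourier_fun s (Z.of_nat n) t))) => [|t _]; last exact: fE.
  rewrite RInt_scal; last exact: ex_RInt_fourier.
  have hI := @partition_fourier N n (w ^ 8) (ltac:(lia)); rewrite fourier_half -/s in hI.
  rewrite -[RHS]/(exp (- k) * RInt (fourier_fun s (Z.of_nat n)) 0 PI).
  by rewrite (_ : RInt _ 0 PI = PI * (INR (npart n) * exp (- (INR n * w ^ 8)))); [ring|lra].
have mid : RInt f 0 (w ^ 11) = w ^ 12 * RInt (major_fun N w) 0 (/ w).
  have w11 : w ^ 12 * / w = w ^ 11 by rewrite (_ : w ^ 12 = w ^ 11 * w); [field; lra|rewrite -[RHS]Rmult_comm].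
  have := RInt_comp_lin f (w ^ 12) 0 0 (/ w) (exf _ _).
  rewrite !Rplus_0_r Rmult_0_r w11 => <-.
  rewrite -[RHS](RInt_scal (V := R_CompleteNormedModule)); last first.
    by apply: ex_RInt_derivable => y; exact: ex_derive_major_fun.
  apply: RInt_ext => y _; congr scal; rewrite Rplus_0_r /f /major_fun trig_sum0 trig_sum3 -/s -/k.
  congr (_ * cos (_ - _ * _)).
  by rewrite -nw; field; lra.
have w110 : 0 < w ^ 11 by apply: pow_lt; lra.
have w11P : w ^ 11 <= PI.
  apply: Rle_trans (_ : 1 <= _); last by have := PI2_3_2; lra.
  by rewrite -(pow1 11); apply: pow_incr; lra.
have tail : Rabs (RInt f (w ^ 11) PI) <= PI * (D * w ^ (12 + K.+1)).
  apply: Rle_trans (Rabs_RInt_le (M := D * w ^ (12 + K.+1)) w11P (exf _ _) _) _.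
    move=> t tb; rewrite Rabs_mult Rabs_pos_eq; last exact/Rlt_le/exp_pos.
    have h := h2 N (ltac:(lia)) t tb; rewrite -/s -/k in h.
    have cB : Rabs (cos (sin_sum s t - INR n * t)) <= 1.
      by apply: Rabs_le; have := COS_bound (sin_sum s t - INR n * t); lra.
    have := exp_pos (cos_sum s t - k); have := Rabs_pos (cos (sin_sum s t - INR n * t)); nra.
  apply: Rmult_le_compat_r; last lra.
  by apply: Rmult_le_pos => //; apply: pow_le; lra.
rewrite tot -(RInt_Chasles f 0 (w ^ 11) PI) // mid /plus /=.
have h := h1 N (ltac:(lia)).
move: (RInt f _ _) tail (RInt _ _ _) h => J tail I h.
have -> : (w ^ 12 * I + J) / w ^ 12 - pe l w = (I - pe l w) + J / w ^ 12 by field; lra.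
apply: Rle_trans (Rabs_triang _ _) _; rewrite Rmult_plus_distr_r; apply: Rplus_le_compat => //.
rewrite /Rdiv Rabs_mult (Rabs_pos_eq (/ _)); last exact/Rlt_le/Rinv_0_lt_compat.
apply: (Rmult_le_reg_r (w ^ 12)) => //; rewrite Rmult_assoc Rinv_l ?Rmult_1_r; last lra.
apply: Rle_trans tail _; rewrite pow_add; apply: Req_le; rewrite -(tech_pow_Rmult w K); ring.
Qed.

Definition ln1p_deriv (j : nat) (t : R) : R :=
  if j is j'.+1 then (-1) ^ j' * INR (fact j') / (1 + t) ^ j'.+1 else ln (1 + t).

Lemma is_derive_ln1p_deriv j t : -1 < t -> is_derive (ln1p_deriv j) t (ln1p_deriv j.+1 t).
Proof.
move=> t1; case: j => [|j].
  by rewrite /ln1p_deriv; auto_derive; [lra|rewrite /fact /=; rewrite (_ : INR 1 = 1) //; field; lra].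
have f1 : INR (fact j.+1) = INR j.+1 * INR (fact j) by rewrite -mult_INR.
have p0 : 0 < (1 + t) ^ j by apply: pow_lt; lra.
have -> : ln1p_deriv j.+2 t = (-1) ^ j * INR (fact j) * (- (INR j.+1 * 1 * (1 + t) ^ j) / ((1 + t) ^ j.+1) ^ 2).
  by rewrite /ln1p_deriv f1 /=; field; lra.
apply: is_derive_scal; apply: (is_derive_inv (fun t => (1 + t) ^ j.+1)); last by apply: pow_nonzero; lra.
apply: (is_derive_pow (fun t => 1 + t) j.+1 t 1).
by auto_derive.
Qed.

Lemma ln_taylor J : exists2 C, 0 <= C & forall x, Rabs x <= / 2 ->
  Rabs (ln (1 + x) - \rsum_(i < J.+1) (ln1p_deriv i 0 * x ^ i / INR (fact i))) <= C * Rabs x ^ J.+1.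
Proof.
have f0 := INR_fact_lt_0 J.
have p2 : 0 < 2 ^ J.+1 by apply: pow_lt; lra.
exists (INR (fact J) * 2 ^ J.+1) => [|x /Rabs_le_between x2]; first nra.
have := @taylor_bound ln1p_deriv J.+1 0 x (INR (fact J) * 2 ^ J.+1).
rewrite Rminus_0_r; apply=> [j t tb|t tb].
  by apply: is_derive_ln1p_deriv; move: tb; rewrite /Rmin /Rmax; case: Rle_dec; lra.
have t2 : / 2 <= 1 + t by move: tb; rewrite /Rmin /Rmax; case: Rle_dec; lra.
have t0 : 0 < (1 + t) ^ J.+1 by apply: pow_lt; lra.
rewrite /ln1p_deriv /Rdiv !Rabs_mult pow_1_abs Rmult_1_l.
rewrite (Rabs_pos_eq (INR _)) ?(Rabs_pos_eq (/ _)); [|exact/Rlt_le/Rinv_0_lt_compat|lra].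
apply: Rmult_le_compat_l; first lra.
have -> : 2 ^ J.+1 = / (/ 2) ^ J.+1 by rewrite pow_inv Rinv_inv.
by apply: Rinv_le_contravar; [apply: pow_lt; lra|apply: pow_incr; lra].
Qed.

Lemma ispoly_sum m (f : nat -> R -> R) : (forall i, ispoly (f i)) ->
  ispoly (fun x => \rsum_(i < m) f i x).
Proof.
move=> pf; elim: m => [|m IHm].
  by exists [::] => x; rewrite big_ord0.
by have [l lE] := ispoly_add IHm (pf m); exists l => x; rewrite big_ord_recr /= -lE.
Qed.

(** Factor out the constant term [a] and compose with the Taylor polynomial of [ln (1 + x)]. The
    bound [b] keeps the relative deviation below one half, where [ln (1 + x)] has slope at most
    2. *)
Lemma ln_expansion l C K : 0 < pe l 0 -> 0 <= C -> exists m D b, [/\ 0 <= D, 0 < b <= 1 &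
  forall w g, 0 < w <= b -> Rabs (g - pe l w) <= C * w ^ K.+1 ->
  0 < g /\ Rabs (ln g - pe m w) <= D * w ^ K.+1].
Proof.
move=> l0 C0; have [A A0 hA] := pe_bounded (behead l).
have peE w : pe l w = pe l 0 + w * pe (behead l) w by case: (l) => [|a l'] /=; ring.
move: (pe l 0) l0 peE => a a0 peE.
pose x0 w := w * pe (behead l) w / a.
have [T T0 hT] := ln_taylor K.
have [m mE] : ispoly (fun w => ln a + \rsum_(i < K.+1) (ln1p_deriv i 0 * x0 w ^ i / INR (fact i))).
  apply: ispoly_add; first exact: ispoly_const.
  apply: (@ispoly_sum K.+1 (fun i w => ln1p_deriv i 0 * x0 w ^ i / INR (fact i))) => i.
  apply: ispoly_mul; last exact: ispoly_const.
  apply: ispoly_mul; first exact: ispoly_const.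
  apply: ispoly_pow; apply: ispoly_mul; last exact: ispoly_const.
  by apply: ispoly_mul; [exact: ispoly_id|exists (behead l)].
have ia : 0 < / a by exact: Rinv_0_lt_compat.
have Aa : 0 <= A / a by apply: Rdiv_le_0_compat.
have Ca : 0 <= C / a by apply: Rdiv_le_0_compat.
pose b := / (4 * (A / a + C / a + 1)).
have b0 : 0 < b <= 1.
  split; first by apply: Rinv_0_lt_compat; lra.
  by rewrite /b -Rinv_1; apply: Rinv_le_contravar; lra.
exists m, (2 * (C / a) + T * (A / a) ^ K.+1), b; split => //.
  by have := pow_le _ K.+1 Aa; nra.
move=> w g w0 hg.
have wb : w * (4 * (A / a + C / a + 1)) <= 1.
  have := Rmult_le_compat_r (4 * (A / a + C / a + 1)) _ _ (ltac:(lra)) (proj2 w0).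
  by rewrite /b Rinv_l; lra.
have wK : 0 <= w ^ K.+1 <= w.
  by split; [apply: pow_le; lra|rewrite -{2}(pow_1 w); apply: pow_le_pow => //; lra].
pose x := g / a - 1.
have gE : g = a * (1 + x) by rewrite /x; field; lra.
have x0b : Rabs (x0 w) <= A / a * w.
  have := hA w (ltac:(rewrite Rabs_pos_eq; lra)) => h.
  rewrite /x0 /Rdiv !Rabs_mult (Rabs_pos_eq w) ?(Rabs_pos_eq (/ a)); [|lra|lra].
  have := Rmult_le_compat_l (w * / a) _ _ (ltac:(nra)) h; lra.
have xb : Rabs (x - x0 w) <= C / a * w ^ K.+1.
  have -> : x - x0 w = (g - pe l w) * / a by rewrite /x /x0 peE; field; lra.
  rewrite Rabs_mult (Rabs_pos_eq (/ a)); last lra.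
  by have := Rmult_le_compat_r (/ a) _ _ (Rlt_le _ _ ia) hg; rewrite /Rdiv; lra.
have x04 : Rabs (x0 w) <= / 4 by nra.
have x4 : Rabs (x - x0 w) <= / 4 by nra.
move: (x04) (x4) => /Rabs_le_between y1 /Rabs_le_between y2.
have gpos : 0 < g by rewrite gE; apply: Rmult_lt_0_compat; lra.
split => //.
have lnE : ln g = ln a + ln (1 + x) by rewrite gE ln_mult //; lra.
have near : Rabs (ln (1 + x) - ln (1 + x0 w)) <= 2 * Rabs (x - x0 w).
  apply: (mvt_bound (f := fun t => ln (1 + t)) (df := fun t => / (1 + t))) => t tb.
    have t0 : 0 < 1 + t by move: tb; rewrite /Rmin /Rmax; case: Rle_dec; lra.
    by auto_derive; [|field; lra].
  have t0 : / 2 <= 1 + t by move: tb; rewrite /Rmin /Rmax; case: Rle_dec; lra.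
  rewrite Rabs_pos_eq; last by apply/Rlt_le/Rinv_0_lt_compat; lra.
  by rewrite -(Rinv_inv 2); apply: Rinv_le_contravar; lra.
have tay := hT (x0 w) (ltac:(lra)).
have x0K : Rabs (x0 w) ^ K.+1 <= (A / a) ^ K.+1 * w ^ K.+1.
  by rewrite -Rpow_mult_distr; apply: pow_incr; split => //; exact: Rabs_pos.
have := Rmult_le_compat_l T _ _ T0 x0K.
rewrite lnE -mE; move: tay near; move: (\rsum_(i < K.+1) _) => S tay near TT.
rewrite (_ : _ - _ = (ln (1 + x) - ln (1 + x0 w)) + (ln (1 + x0 w) - S)); last ring.
apply: Rle_trans (Rabs_triang _ _) _; lra.
Qed.

(* The constant and all coefficients of the polynomial part are left unspecified:
   they only contribute lower order terms to the differences. *)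
Lemma ln_npart_expansion K : exists l C b, [/\ 0 <= C, 0 < b <= 1 &
  forall w n, 0 < w <= b -> INR n * w ^ 16 = PI ^ 2 / 6 ->
  Rabs (ln (INR (npart n)) - (PI ^ 2 / 3 / w ^ 8 + 16 * ln w + pe l w)) <= C * w ^ K.+1].
Proof.
have [l [C [b [l0 C0 b0 hC]]]] := npart_circle K.
have [m [D [c [D0 c0 hD]]]] := ln_expansion K l0 C0.
have [lk [E [d [E0 d0 hE]]]] := kap0_asym K.
have P0 := PI_RGT_0.
have [p pE] : ispoly (fun w => pe m w + pe lk (w ^ 8) + - ln PI).
  apply: ispoly_add; last exact: ispoly_const.
  apply: ispoly_add; first by exists m.
  by apply: ispoly_pe; apply: ispoly_pow; exact: ispoly_id.
exists p, (D + E), (Rmin (Rmin b c) d).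
have m1 := Rmin_l b c; have m2 := Rmin_r b c; have m3 := Rmin_l (Rmin b c) d; have m4 := Rmin_r (Rmin b c) d.
split; [lra|split; [do 2!(apply: Rmin_glb_lt; try lra)|lra]|move=> w n wb nw].
have w80 : 0 < w ^ 8 <= w.
  split; first by apply: pow_lt; lra.
  by rewrite -{2}(pow_1 w); apply: pow_le_pow => //; lra.
have [N1 h1] := hC w n (ltac:(lra)) nw; have [N2 h2] := hE (w ^ 8) (ltac:(lra)).
have {}h1 := h1 (N1 + N2)%N (ltac:(lia)); have {}h2 := h2 (N1 + N2)%N (ltac:(lia)).
move: (kap _ _ _) h1 h2 => k h1 h2.
have [g0 h3] := hD w _ (ltac:(lra)) h1.
have w0 : 0 < w by lra.
have w12 : 0 < w ^ 12 by apply: pow_lt.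
set g := _ / w ^ 12 in g0 h3.
have pg : INR (npart n) = g * (w ^ 12 * exp (INR n * w ^ 8) * exp k * / PI).
  rewrite /g !exp_Ropp; have e1 := exp_pos (INR n * w ^ 8); have e2 := exp_pos k; field; lra.
(* Of the final [16 ln w], the Jacobian gives 12 and the term [(ln u) / 2] of [kap 0] gives 4; [n u]
   and the pole of [kap 0] each give [PI^2 / 6 / w^8]. *)
have lnp : ln (INR (npart n)) = ln g + 12 * ln w + INR n * w ^ 8 + k - ln PI.
  have e1 := exp_pos (INR n * w ^ 8); have e2 := exp_pos k.
  have e3 : 0 < w ^ 12 * exp (INR n * w ^ 8) by nra.
  have e4 : 0 < w ^ 12 * exp (INR n * w ^ 8) * exp k by nra.
  have iP := Rinv_0_lt_compat _ P0.
  rewrite pg ln_mult //; last by nra.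
  rewrite (ln_mult _ (/ PI)) // (ln_mult _ (exp k)) // (ln_mult (w ^ 12)) //.
  by rewrite !ln_exp ln_Rinv // ln_pow // (_ : INR 12 = 12); [ring|rewrite INR_IZR_INZ].
have ln8 : ln (w ^ 8) = 8 * ln w by rewrite ln_pow // (_ : INR 8 = 8) // INR_IZR_INZ.
have nw8 : INR n * w ^ 8 = PI ^ 2 / 6 / w ^ 8.
  by rewrite -nw; field; lra.
have w8K : (w ^ 8) ^ K.+1 <= w ^ K.+1 by apply: pow_incr; lra.
have h4 := Rle_trans _ _ _ h2 (Rmult_le_compat_l _ _ _ E0 w8K).
rewrite lnp -pE nw8.
rewrite (_ : _ - _ = (ln g - pe m w) + (k - (PI ^ 2 / 6 / w ^ 8 + ln (w ^ 8) / 2 + pe lk (w ^ 8)))); last first.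
  by rewrite ln8; field; lra.
apply: Rle_trans (Rabs_triang _ _) _; lra.
Qed.

(** * Finite differences *)

Lemma iter_fdiffS r f n : iter r.+1 fdiff f n = iter r fdiff f n.+1 - iter r fdiff f n.
Proof. by []. Qed.

Lemma iter_fdiff_ext r f g n : (forall m, f m = g m) -> iter r fdiff f n = iter r fdiff g n.
Proof.
move=> fg; elim: r n => [|r IHr] n; first exact: fg.
by rewrite !iter_fdiffS !IHr.
Qed.

Lemma iter_fdiff_lin r a f g n :
  iter r fdiff (fun m => a * f m + g m) n = a * iter r fdiff f n + iter r fdiff g n.
Proof.
elim: r n => [|r IHr] n //.
by rewrite !iter_fdiffS !IHr; ring.
Qed.

Lemma iter_fdiff_scal r a f n : iter r fdiff (fun m => a * f m) n = a * iter r fdiff f n.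
Proof.
elim: r n => [|r IHr] n //.
by rewrite !iter_fdiffS !IHr; ring.
Qed.

Lemma iter_fdiff_const r c n : iter r.+1 fdiff (fun=> c) n = 0.
Proof.
elim: r n => [|r IHr] n; first by rewrite iter_fdiffS /=; ring.
by rewrite iter_fdiffS !IHr; ring.
Qed.

Lemma iter_fdiff_bound r f n M : (forall m, (n <= m)%N -> Rabs (f m) <= M) ->
  Rabs (iter r fdiff f n) <= 2 ^ r * M.
Proof.
elim: r n => [|r IHr] n fM; first by rewrite /= Rmult_1_l; exact: fM.
rewrite iter_fdiffS /Rminus; apply: Rle_trans (Rabs_triang _ _) _; rewrite Rabs_Ropp.
have h1 := IHr n fM; have h2 : Rabs (iter r fdiff f n.+1) <= 2 ^ r * M.
  by apply: IHr => m nm; apply: fM; lia.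
by rewrite /=; lra.
Qed.

(** Mean value property of iterated differences, by induction: one difference replaces [F] by
    [F (x + 1) - F x], whose derivatives are again controlled by the mean value theorem. *)
Lemma iter_fdiff_deriv r (F : nat -> R -> R) n m M :
  (forall j x, INR n <= x -> is_derive (F j) x (F j.+1 x)) ->
  (forall x, INR n <= x <= INR n + INR r -> m <= F r x <= M) ->
  m <= iter r fdiff (fun k => F 0%N (INR k)) n <= M.
Proof.
elim: r F => [|r IHr] F dF FM.
  by apply: FM; rewrite (_ : INR 0 = 0) //; lra.
rewrite iterSr.
rewrite (@iter_fdiff_ext r _ (fun k => F 0%N (INR k + 1) - F 0%N (INR k))); last first.
  by move=> k; rewrite /fdiff S_INR.
apply: (IHr (fun j x => F j (x + 1) - F j x)) => [j x nx|x nx].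
  apply: is_derive_minus; last exact: dF.
  rewrite -[F j.+1 _]Rmult_1_l; apply: (is_derive_comp (F j) (fun x => x + 1)).
    by apply: dF; lra.
  by auto_derive.
rewrite S_INR in FM.
have [t [tx tE]] : exists t, Rmin x (x + 1) <= t <= Rmax x (x + 1) /\
    F r (x + 1) - F r x = F r.+1 t * (x + 1 - x).
  apply: MVT_gen => t; rewrite Rmin_left ?Rmax_right; try lra => tx.
    by move=> tb; apply: dF; lra.
  by move=> tb; apply: ex_derive_continuity_pt; eexists; apply: dF; lra.
rewrite Rmin_left ?Rmax_right in tx; try lra.
by have := FM t (ltac:(lra)); rewrite tE; lra.
Qed.

(** * Differences of powers and of the logarithm *)

Fixpoint falling (a : R) (j : nat) : R := if j is j'.+1 then falling a j' * (a - INR j') else 1.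

Definition power_deriv (a : R) (j : nat) (x : R) : R := falling a j * Rpower x (a - INR j).

Lemma is_derive_power_deriv a j x : 0 < x -> is_derive (power_deriv a j) x (power_deriv a j.+1 x).
Proof.
move=> x0; rewrite /power_deriv S_INR [falling a j.+1]/=; move: (INR j) (falling a j) => k f.
have -> : f * (a - k) * Rpower x (a - (k + 1)) = f * ((a - k) / x * Rpower x (a - k)).
  rewrite (_ : a - (k + 1) = (a - k) + - (1)); last ring.
  by rewrite Rpower_plus Rpower_Ropp Rpower_1 //; field; lra.
by apply: is_derive_scal; rewrite /Rpower; auto_derive => //; field; lra.
Qed.

Lemma power_deriv0 a x : power_deriv a 0 x = Rpower x a.
Proof. by rewrite /power_deriv /= (_ : INR 0 = 0) // Rminus_0_r Rmult_1_l. Qed.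

Lemma Rpower_anti x y a : 0 < x <= y -> a <= 0 -> Rpower y a <= Rpower x a.
Proof.
move=> xy a0; apply: exp_le; have := ln_le x y (proj1 xy) (proj2 xy); nra.
Qed.

Lemma Rpower_gt0 x a : 0 < Rpower x a.
Proof. exact: exp_pos. Qed.

(** The origin of the rising factorial and of the alternating sign: after the first factor, all
    factors [1/2 - j] are negative. *)
Lemma falling_half r : falling (1 / 2) r.+1 = (-1) ^ r * (/ 2 * rising (1 / 2) r).
Proof.
elim: r => [|r IHr]; first by rewrite /= (_ : INR 0 = 0) //; field.
rewrite [falling _ _]/= -/(falling (1 / 2) r.+1) IHr [rising _ r.+1]/= S_INR /=; field.
Qed.

Lemma sign_sqr r : (-1) ^ r * (-1) ^ r = 1.
Proof. by rewrite -Rpow_mult_distr (_ : -1 * -1 = 1) ?pow1 //; ring. Qed.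

Lemma rising_gt0 a k : 0 < a -> 0 < rising a k.
Proof.
move=> a0; elim: k => [|k IHk] /=; first lra.
by apply: Rmult_lt_0_compat => //; have := pos_INR k; lra.
Qed.

Lemma iter_fdiff_half r n : (0 < n)%N ->
  (-1) ^ r * iter r.+1 fdiff (fun k => Rpower (INR k) (1 / 2)) n <=
  / 2 * rising (1 / 2) r * Rpower (INR n) (1 / 2 - INR r.+1).
Proof.
move=> n0; have n1 : 1 <= INR n by apply: (le_INR 1); lia.
have g0 := rising_gt0 r (a := 1 / 2) (ltac:(lra)).
have r1 : 1 <= INR r.+1 by apply: (le_INR 1); lia.
rewrite -iter_fdiff_scal.
rewrite (@iter_fdiff_ext _ _ (fun k => (-1) ^ r * power_deriv (1 / 2) 0 (INR k))); last first.
  by move=> k; rewrite power_deriv0.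
apply: (proj2 (@iter_fdiff_deriv r.+1 (fun j x => (-1) ^ r * power_deriv (1 / 2) j x) n 0 _ _ _)).
  by move=> j x nx; apply: is_derive_scal; apply: is_derive_power_deriv; lra.
move=> x nx; rewrite /power_deriv falling_half.
rewrite (_ : (-1) ^ r * _ = (-1) ^ r * (-1) ^ r * (/ 2 * rising (1 / 2) r * Rpower x (1 / 2 - INR r.+1))); last ring.
rewrite sign_sqr Rmult_1_l; have p0 := Rpower_gt0 x (1 / 2 - INR r.+1); split.
  by apply: Rmult_le_pos; lra.
by apply: Rmult_le_compat_l; [lra|apply: Rpower_anti; lra].
Qed.

Lemma iter_fdiff_power a r : a < 0 -> exists2 C, 0 <= C & forall n, (0 < n)%N ->
  Rabs (iter r fdiff (fun k => Rpower (INR k) a) n) <= C * Rpower (INR n) (a - INR r).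
Proof.
move=> a0; exists (Rabs (falling a r)) => [|n n0]; first exact: Rabs_pos.
have n1 : 1 <= INR n by apply: (le_INR 1); lia.
have r0 := pos_INR r.
rewrite (@iter_fdiff_ext _ _ (fun k => power_deriv a 0 (INR k))); last first.
  by move=> k; rewrite power_deriv0.
apply: Rabs_le; apply: iter_fdiff_deriv => [j x nx|x nx].
  by apply: is_derive_power_deriv; lra.
apply/Rabs_le_between; rewrite /power_deriv Rabs_mult (Rabs_pos_eq (Rpower _ _)); last exact/Rlt_le/Rpower_gt0.
by apply: Rmult_le_compat_l; [exact: Rabs_pos|apply: Rpower_anti; lra].
Qed.

Lemma iter_fdiff_ln r n : (0 < n)%N ->
  INR (fact r) / (INR n + INR r.+1) ^ r.+1 <= (-1) ^ r * iter r.+1 fdiff (fun k => ln (INR k)) n.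
Proof.
move=> n0; have n1 : 1 <= INR n by apply: (le_INR 1); lia.
have f0 := INR_fact_lt_0 r.
pose F j x := (-1) ^ r * ln1p_deriv j (x + - (1)).
rewrite -iter_fdiff_scal.
rewrite (@iter_fdiff_ext _ _ (fun k => F 0%N (INR k))); last first.
  by move=> k; rewrite /F /ln1p_deriv; congr (_ * ln _); ring.
apply: (proj1 (@iter_fdiff_deriv r.+1 F n _ (INR (fact r)) _ _)).
  move=> j x nx; apply: is_derive_scal; rewrite -[ln1p_deriv j.+1 _]Rmult_1_l.
  apply: (is_derive_comp (ln1p_deriv j) (fun x => x + - (1))).
    by apply: is_derive_ln1p_deriv; lra.
  by auto_derive.
move=> x nx; rewrite /F /ln1p_deriv (_ : 1 + (x + - (1)) = x); last ring.
have xr : 0 < x ^ r.+1 by apply: pow_lt; lra.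
rewrite (_ : _ * (_ / _) = (-1) ^ r * (-1) ^ r * (INR (fact r) / x ^ r.+1)); last by field; lra.
rewrite sign_sqr Rmult_1_l; split.
  apply: Rmult_le_compat_l; first lra.
  by apply: Rinv_le_contravar => //; apply: pow_incr; lra.
rewrite -[X in _ <= X]Rmult_1_r; apply: Rmult_le_compat_l; first lra.
by rewrite -Rinv_1; apply: Rinv_le_contravar; [lra|rewrite -(pow1 r.+1); apply: pow_incr; lra].
Qed.

(** The parameter [w] that belongs to [n = x], namely the solution of [x w^16 = PI^2 / 6]. *)
Definition scale16 (x : R) : R := Rpower (PI ^ 2 / 6) (1 / 16) * Rpower x (- (1 / 16)).

Lemma Rpower_pow_nat x a i : Rpower x a ^ i = Rpower x (INR i * a).
Proof. by rewrite /Rpower -exp_INR_mul; congr exp; ring. Qed.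

(** A polynomial in [n^(-1/16)] without constant term is a combination of negative powers of [n];
    each of its differences is smaller than [n^-r] by at least [n^(-1/16)]. *)
Lemma iter_fdiff_scale16 l i r : exists2 C, 0 <= C & forall n, (0 < n)%N ->
  Rabs (iter r fdiff (fun k => scale16 (INR k) ^ i.+1 * pe l (scale16 (INR k))) n) <=
  C * Rpower (INR n) (- (1 / 16) - INR r).
Proof.
elim: l i => [|a l IHl] i.
  exists 0 => [|n n0]; first lra.
  rewrite (@iter_fdiff_ext _ _ (fun k => 0 * 0)) => [|k /=]; last ring.
  by rewrite iter_fdiff_scal !Rmult_0_l Rabs_R0; lra.
have [C C0 hC] := IHl i.+1.
have i0 := pos_INR i.
have [D D0 hD] := @iter_fdiff_power (INR i.+1 * - (1 / 16)) r (ltac:(rewrite S_INR; lra)).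
pose b := a * Rpower (PI ^ 2 / 6) (1 / 16) ^ i.+1.
exists (Rabs b * D + C) => [|n n0]; first by have := Rabs_pos b; nra.
have n1 : 1 <= INR n by apply: (le_INR 1); lia.
rewrite (@iter_fdiff_ext _ _ (fun k => b * Rpower (INR k) (INR i.+1 * - (1 / 16)) +
   scale16 (INR k) ^ i.+2 * pe l (scale16 (INR k)))); last first.
  move=> k.
  have E : scale16 (INR k) ^ i.+1 = Rpower (PI ^ 2 / 6) (1 / 16) ^ i.+1 * Rpower (INR k) (- (1 / 16)) ^ i.+1.
    by rewrite -Rpow_mult_distr.
  rewrite -Rpower_pow_nat /b -(tech_pow_Rmult _ i.+1) E [pe (a :: l) _]/=.
  by move: (scale16 _) (pe l _) => x y; ring.
rewrite iter_fdiff_lin; apply: Rle_trans (Rabs_triang _ _) _; rewrite Rmult_plus_distr_r.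
apply: Rplus_le_compat; last exact: hC.
rewrite Rabs_mult Rmult_assoc; apply: Rmult_le_compat_l; first exact: Rabs_pos.
apply: Rle_trans (hD n n0) _; apply: Rmult_le_compat_l => //.
by apply: Rle_Rpower => //; rewrite S_INR; lra.
Qed.

Lemma ln_ge_quadratic z : 0 <= z -> z - z ^ 2 / 2 <= ln (1 + z).
Proof.
move=> z0.
have [t [tz]] : exists t, Rmin 0 z <= t <= Rmax 0 z /\
    (ln (1 + z) - z + z ^ 2 / 2) - (ln (1 + 0) - 0 + 0 ^ 2 / 2) = t ^ 2 / (1 + t) * (z - 0).
  apply: (MVT_gen (fun z => ln (1 + z) - z + z ^ 2 / 2) 0 z (fun t => t ^ 2 / (1 + t))) => t;
  rewrite Rmin_left ?Rmax_right // => tz.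
    by auto_derive; [lra|rewrite /INR /=; field; lra].
  by apply: ex_derive_continuity_pt; auto_derive; lra.
rewrite Rmin_left ?Rmax_right // in tz.
rewrite Rplus_0_r ln_1.
have : 0 <= t ^ 2 / (1 + t) * (z - 0).
  by apply: Rmult_le_pos; [apply: Rdiv_le_0_compat; [apply: pow_le; lra|lra]|lra].
rewrite /=; lra.
Qed.

Lemma Rpower_small e : 0 < e -> exists2 N, (0 < N)%N & forall n, (N <= n)%N ->
  Rpower (INR n) (- (1 / 16)) <= e.
Proof.
move=> e0; exists (Z.to_nat (up (exp (- 16 * ln e)))).+1 => // n Nn.
have [u1 _] := archimed (exp (- 16 * ln e)).
have h : exp (- 16 * ln e) <= INR n.
  by apply: Rle_trans (Rlt_le _ _ u1) _; rewrite INR_IZR_INZ; apply: IZR_le; lia.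
have := ln_le _ _ (exp_pos _) h; rewrite ln_exp => h2.
by rewrite -[X in _ <= X](exp_ln e) // /Rpower; apply: exp_le; lra.
Qed.

Lemma sqrt_zeta2 : Rpower (PI ^ 2 / 6) (1 / 2) = sqrt 6 * PI / 6.
Proof.
have P0 := PI_RGT_0; have z1 := zeta2_ge1.
rewrite (_ : 1 / 2 = / 2); last field.
rewrite Rpower_sqrt; last lra.
have s6 : sqrt 6 * sqrt 6 = 6 by apply: sqrt_sqrt; lra.
have s60 : 0 < sqrt 6 by apply: sqrt_lt_R0; lra.
apply: sqrt_lem_1; [lra|by apply: Rmult_le_pos; [nra|lra]|].
have -> : sqrt 6 * PI / 6 * (sqrt 6 * PI / 6) = (sqrt 6 * sqrt 6) * PI ^ 2 / 36 by field.
by rewrite s6; field.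
Qed.

Lemma scale16_gt0 x : 0 < scale16 x.
Proof. by apply: Rmult_lt_0_compat; exact: Rpower_gt0. Qed.

Lemma scale16_pow x k : scale16 x ^ k = Rpower (PI ^ 2 / 6) (INR k * (1 / 16)) * Rpower x (INR k * - (1 / 16)).
Proof. by rewrite /scale16 Rpow_mult_distr !Rpower_pow_nat. Qed.

Lemma ln_npart_asym r : exists l c0 C N0, [/\ 0 <= C, (0 < N0)%N & forall n, (N0 <= n)%N ->
  Rabs (ln (INR (npart n)) - (2 * (sqrt 6 * PI / 6) * Rpower (INR n) (1 / 2) - ln (INR n) + c0
     + scale16 (INR n) * pe l (scale16 (INR n)))) <= C * Rpower (INR n) (- INR r.+1)].
Proof.
(* With this order the error is [w^(16 (r+1))], a multiple of [n^-(r+1)]. *)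
have [l [C [b [C0 b0 hC]]]] := ln_npart_expansion (16 * r + 15).
have z1 := zeta2_ge1; set zt := PI ^ 2 / 6 in z1 hC *.
have k0 := Rpower_gt0 zt (1 / 16).
have [N0 N00 hN] := @Rpower_small (b / Rpower zt (1 / 16)) (ltac:(apply: Rdiv_lt_0_compat; lra)).
exists (behead l), (ln zt + pe l 0), (C * zt ^ r.+1), N0; split => //.
  by apply: Rmult_le_pos => //; apply: pow_le; lra.
move=> n Nn; have n0 : 0 < INR n by apply: lt_0_INR; lia.
have w0 := scale16_gt0 (INR n).
have wb : 0 < scale16 (INR n) <= b.
  split => //; have := Rmult_le_compat_l _ _ _ (Rlt_le _ _ k0) (hN n Nn).
  by rewrite /scale16 -/zt (_ : _ * (b / _) = b) //; field; lra.
have inv16 : INR 16 * (1 / 16) = 1 by rewrite (_ : INR 16 = 16); [field|rewrite INR_IZR_INZ].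
have w16 : INR n * scale16 (INR n) ^ 16 = zt.
  rewrite scale16_pow -/zt Ropp_mult_distr_r_reverse inv16 Rpower_Ropp !Rpower_1 //; last lra.
  by field; lra.
have inv8 : INR 8 * (1 / 16) = 1 / 2 by rewrite (_ : INR 8 = 8); [field|rewrite INR_IZR_INZ].
have w8 : PI ^ 2 / 3 / scale16 (INR n) ^ 8 = 2 * (sqrt 6 * PI / 6) * Rpower (INR n) (1 / 2).
  rewrite scale16_pow -/zt Ropp_mult_distr_r_reverse inv8 Rpower_Ropp -sqrt_zeta2 -/zt.
  have h1 := Rpower_gt0 zt (1 / 2); have h2 := Rpower_gt0 (INR n) (1 / 2).
  have h3 : Rpower zt (1 / 2) * Rpower zt (1 / 2) = zt.
    by rewrite -Rpower_plus (_ : 1 / 2 + 1 / 2 = 1) ?Rpower_1; [|lra|field].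
  rewrite (_ : PI ^ 2 / 3 = 2 * zt); last by rewrite /zt; field.
  by rewrite -{1}h3; field; lra.
have lnw : 16 * ln (scale16 (INR n)) = ln zt - ln (INR n).
  rewrite /scale16 ln_mult; [|exact: Rpower_gt0|exact: Rpower_gt0].
  by rewrite /Rpower !ln_exp -/zt; field.
have peE : pe l (scale16 (INR n)) = pe l 0 + scale16 (INR n) * pe (behead l) (scale16 (INR n)).
  by case: (l) => [|a l'] /=; ring.
have h := hC _ n wb w16; rewrite w8 lnw peE in h.
apply: Rle_trans (_ : C * scale16 (INR n) ^ (16 * r + 15).+1 <= _).
  by move: h; congr (Rabs _ <= _); ring.
rewrite Rmult_assoc; apply: Rmult_le_compat_l => //; apply: Req_le.
rewrite (_ : (16 * r + 15).+1 = (16 * r.+1)%coq_nat); last lia.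
rewrite pow_mult scale16_pow -/zt Ropp_mult_distr_r_reverse inv16 Rpow_mult_distr Rpower_1; last lra.
by rewrite Rpower_pow_nat; congr (_ * Rpower _ _); ring.
Qed.

(** A tangent line bound for a convex power; it measures the shift from [n] to [n + 1]. *)
Lemma Rpower_succ_ge x a : 1 <= x -> a <= 0 -> Rpower x a + a * Rpower x (a - 1) <= Rpower (x + 1) a.
Proof.
move=> x1 a0.
have [t [tx tE]] : exists t, Rmin x (x + 1) <= t <= Rmax x (x + 1) /\
    power_deriv a 0 (x + 1) - power_deriv a 0 x = power_deriv a 1 t * (x + 1 - x).
  apply: MVT_gen => t; rewrite Rmin_left ?Rmax_right; try lra.
    by move=> tb; apply: is_derive_power_deriv; lra.
  by move=> tb; apply: ex_derive_continuity_pt; eexists; apply: is_derive_power_deriv; lra.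
rewrite Rmin_left ?Rmax_right in tx; try lra.
rewrite !power_deriv0 {1}/power_deriv /= (_ : INR 0 = 0) // (_ : INR 1 = 1) // in tE.
have h : Rpower t (a - 1) <= Rpower x (a - 1) by apply: Rpower_anti; lra.
nra.
Qed.

(** From [(1 + r / x)^r <= exp (r^2 / x)] and [exp (- t) >= 1 - t]. *)
Lemma inv_pow_shift_ge x r : 0 < x -> Rpower x (- INR r) * (1 - INR r ^ 2 / x) <= / (x + INR r) ^ r.
Proof.
move=> x0; have r0 := pos_INR r.
have rx : 0 <= INR r / x by exact: Rdiv_le_0_compat.
have xr : 0 < x ^ r by apply: pow_lt.
have E : (x + INR r) ^ r = x ^ r * (1 + INR r / x) ^ r.
  by rewrite -Rpow_mult_distr; congr (_ ^ _); field; lra.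
rewrite E Rpower_Ropp Rpower_pow // Rinv_mult.
apply: Rmult_le_compat_l; first exact/Rlt_le/Rinv_0_lt_compat.
apply: Rle_trans (_ : exp (- (INR r ^ 2 / x)) <= _).
  by have := exp_ineq1_le (- (INR r ^ 2 / x)); lra.
rewrite exp_Ropp; apply: Rinv_le_contravar; first by apply: pow_lt; lra.
rewrite (_ : INR r ^ 2 / x = INR r * (INR r / x)); last by field; lra.
rewrite exp_INR_mul; apply: pow_incr; split; first lra.
exact: exp_ineq1_le.
Qed.

(** The remainder [E] carries no smoothness, so its differences are only bounded by [2 ^ s.+1] times
    its size; hence the expansion is taken one power of [n] further than the target. *)
Lemma fdiff_ln_npart_le s : exists C N0, [/\ 0 <= C, (0 < N0)%N & forall n, (N0 <= n)%N ->
  (-1) ^ s * iter s.+1 fdiff (fun m => ln (INR (npart m))) n <=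
  sqrt 6 * PI / 6 * rising (1 / 2) s * Rpower (INR n) (1 / 2 - INR s.+1)
  - INR (fact s) / (INR n + INR s.+1) ^ s.+1 + C * Rpower (INR n) (- (1 / 16) - INR s.+1)].
Proof.
have [l [c0 [C [N0 [C0 N00 hN]]]]] := ln_npart_asym s.+1.
have [D D0 hD] := iter_fdiff_scale16 l 0 s.+1.
exists (D + 2 ^ s.+1 * C), N0; split => //.
  by have := pow_le 2 s.+1 (ltac:(lra)); nra.
move=> n Nn; have n0 : (0 < n)%N by lia.
have n1 : 1 <= INR n by apply: (le_INR 1); lia.
pose c := sqrt 6 * PI / 6.
have c1 : 0 < c.
  have P0 := PI_RGT_0; have s60 : 0 < sqrt 6 by apply: sqrt_lt_R0; lra.
  by rewrite /c; apply: Rdiv_lt_0_compat; nra.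
pose E m := ln (INR (npart m)) - (2 * c * Rpower (INR m) (1 / 2) - ln (INR m) + c0
     + scale16 (INR m) * pe l (scale16 (INR m))).
rewrite (@iter_fdiff_ext _ _ (fun m => 2 * c * Rpower (INR m) (1 / 2) + (-1 * ln (INR m) +
   (1 * (scale16 (INR m) ^ 1 * pe l (scale16 (INR m))) + (1 * E m + c0))))); last first.
  by move=> m; rewrite /E; ring.
rewrite !iter_fdiff_lin iter_fdiff_const.
have h1 := iter_fdiff_half s n0; have h2 := iter_fdiff_ln s n0; have h3 := hD n n0.
have h4 := @iter_fdiff_bound s.+1 E n (C * Rpower (INR n) (- INR s.+2)).
have {}h4 : Rabs (iter s.+1 fdiff E n) <= 2 ^ s.+1 * (C * Rpower (INR n) (- INR s.+2)).
  apply: h4 => m nm; apply: Rle_trans (hN m _) _; first lia.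
  apply: Rmult_le_compat_l => //; apply: Rpower_anti; last by have := pos_INR s.+2; lra.
  by split; [lra|apply: le_INR; lia].
have h5 : Rpower (INR n) (- INR s.+2) <= Rpower (INR n) (- (1 / 16) - INR s.+1).
  by apply: Rle_Rpower => //; rewrite (S_INR s.+1); lra.
have p2 : 0 <= 2 ^ s.+1 * C by apply: Rmult_le_pos => //; apply: pow_le; lra.
have h6 := Rmult_le_compat_l _ _ _ p2 h5.
have sgn x : (-1) ^ s * x <= Rabs x.
  by apply: Rle_trans (Rle_abs _) _; rewrite Rabs_mult pow_1_abs; lra.
set a1 := iter _ _ (fun k => Rpower (INR k) _) n in h1 *.
set a2 := iter _ _ (fun k => ln (INR k)) n in h2 *.
set a3 := iter _ _ (fun k => scale16 (INR k) ^ 1 * _) n in h3 *.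
set a4 := iter _ _ E n in h4 *.
have -> : (-1) ^ s * (2 * c * a1 + (-1 * a2 + (1 * a3 + (1 * a4 + 0)))) =
   2 * c * ((-1) ^ s * a1) - (-1) ^ s * a2 + (-1) ^ s * a3 + (-1) ^ s * a4 by ring.
have s3 := sgn a3; have s4 := sgn a4.
have k1 := Rmult_le_compat_l (2 * c) _ _ (ltac:(lra)) h1.
rewrite Rmult_plus_distr_r -/c.
rewrite (_ : c * rising (1 / 2) s * _ = 2 * c * (/ 2 * rising (1 / 2) s * Rpower (INR n) (1 / 2 - INR s.+1))); last by field.
lra.
Qed.

Theorem theorem3p1 (r : nat) (hr : (1 <= r)%N) :
  exists nr : nat, (0 < nr)%N /\
    forall n : nat, (nr <= n)%N ->
      (-1) ^ (r - 1)%N * iter r fdiff (fun m => ln (INR (npart m))) n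
      < ln (1 + sqrt 6 * PI / 6 * rising (1 / 2) (r - 1)%N
                * (1 / Rpower (INR n + 1) (INR r - 1 / 2))).
Proof.
case: r hr => // s _; rewrite subn1 /=  -/(iter s.+1 fdiff _).
have [C [N0 [C0 N00 hN]]] := fdiff_ln_npart_le s.
pose A := sqrt 6 * PI / 6 * rising (1 / 2) s.
have P0 := PI_RGT_0; have s60 : 0 < sqrt 6 by apply: sqrt_lt_R0; lra.
have A0 : 0 < A.
  apply: Rmult_lt_0_compat; first by apply: Rdiv_lt_0_compat; nra.
  by apply: rising_gt0; lra.
pose r := INR s.+1.
have r1 : 1 <= r by apply: (le_INR 1); lia.
(* After division by [Q = n^-r], these are the coefficients of all terms of size at most
   [y = n^(-1/16)]: shifted power from the logarithm, shift from [n] to [n + 1], remainder, and the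
   quadratic term when [r >= 2]. *)
pose M := INR (fact s) * r ^ 2 + A * (r - 1 / 2) + C + A ^ 2 / 2.
have f1 : 1 <= INR (fact s) by apply: (le_INR 1); have := lt_O_fact s; lia.
have M0 : 0 < M by rewrite /M /=; nra.
pose de := 1 - PI ^ 2 / 12.
have de0 : 0 < de by have := PI_sqr_lt; rewrite /de; lra.
have [N1 N10 hy] := @Rpower_small (de / (2 * M)) (ltac:(apply: Rdiv_lt_0_compat; lra)).
exists (N0 + N1)%N; split; first lia.
move=> n Nn; apply: Rle_lt_trans (hN n _) _; first lia.
have x1 : 1 <= INR n by apply: (le_INR 1); lia.
have {}hy := hy n (ltac:(lia)).
move: (INR n) x1 hy => x x1 hy {hN Nn n}; rewrite -/r -/A in hy *.
pose z := A * Rpower (x + 1) (1 / 2 - r).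
have -> : A * (1 / Rpower (x + 1) (r - 1 / 2)) = z.
  by rewrite /z (_ : 1 / 2 - r = - (r - 1 / 2)); [rewrite Rpower_Ropp /Rdiv Rmult_1_l|ring].
have z0 : 0 < z by apply: Rmult_lt_0_compat => //; exact: Rpower_gt0.
apply: Rlt_le_trans (ln_ge_quadratic (Rlt_le _ _ z0)).
have q0 := Rpower_gt0 x (- r).
have y0 := Rpower_gt0 x (- (1 / 16)).
set Q := Rpower x (- r) in q0; set y := Rpower x (- (1 / 16)) in hy y0.
have yM : M * y <= de / 2.
  have := Rmult_le_compat_l M _ _ (Rlt_le _ _ M0) hy.
  by rewrite (_ : M * (de / (2 * M)) = de / 2) //; field; lra.
have ge1 : A * (Rpower x (1 / 2 - r) - (r - 1 / 2) * (Q * y)) <= z.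
  apply: Rmult_le_compat_l; first lra.
  apply: Rle_trans (@Rpower_succ_ge x (1 / 2 - r) x1 (ltac:(lra))).
  have : Rpower x (1 / 2 - r - 1) <= Q * y.
    by rewrite -Rpower_plus; apply: Rle_Rpower => //; lra.
  nra.
have ge2 : z ^ 2 <= A ^ 2 * (Q * Rpower x (1 - r)).
  have h : Rpower (x + 1) (1 / 2 - r) <= Rpower x (1 / 2 - r) by apply: Rpower_anti; lra.
  rewrite /z Rpow_mult_distr; apply: Rmult_le_compat_l; first by apply: pow_le; lra.
  have -> : Q * Rpower x (1 - r) = Rpower x (1 / 2 - r) ^ 2.
    by rewrite Rpower_pow_nat -Rpower_plus (_ : INR 2 = 2) //; congr Rpower; field.
  by apply: pow_incr; split => //; apply/Rlt_le/Rpower_gt0.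
have ge3 : INR (fact s) * (Q * (1 - r ^ 2 * y)) <= INR (fact s) / (x + r) ^ s.+1.
  apply: Rmult_le_compat_l; first lra.
  apply: Rle_trans (inv_pow_shift_ge s.+1 (ltac:(lra) : 0 < x)).
  rewrite -/r -/Q; apply: Rmult_le_compat_l; first lra.
  have : / x <= y.
    rewrite -{1}(Rpower_1 x); last lra.
    by rewrite -Rpower_Ropp; apply: Rle_Rpower => //; lra.
  have := pow2_ge_0 r; rewrite /Rdiv; nra.
have E4 : Rpower x (- (1 / 16) - r) = Q * y by rewrite -Rpower_plus; congr Rpower; ring.
rewrite E4; set p := Rpower x (1 - r) in ge2.
have key : A ^ 2 / 2 * p + (INR (fact s) * r ^ 2 + A * (r - 1 / 2) + C) * y < INR (fact s).
  have Mle : (INR (fact s) * r ^ 2 + A * (r - 1 / 2) + C) * y + A ^ 2 / 2 * y <= de / 2 by rewrite -Rmult_plus_distr_r.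
  (* For [r = 1] the quadratic term has the same order as the gain [fact s = 1], and [p = 1]; for
     [r >= 2] one has [p <= y], so it joins the small terms. *)
  have [s0|s0] := posnP s.
    have A12 : A ^ 2 / 2 = PI ^ 2 / 12.
      have s6 : sqrt 6 ^ 2 = 6 by apply: pow2_sqrt; lra.
      by rewrite /A s0 [rising _ _]/= Rmult_1_r /Rdiv !Rpow_mult_distr s6 /=; field.
    have p1 : p = 1 by rewrite /p /r s0 (_ : INR 1 = 1) // Rminus_diag Rpower_O //; lra.
    have A2 : 0 <= A ^ 2 / 2 * y by apply: Rmult_le_pos; [have := pow2_ge_0 A; lra|lra].
    by rewrite p1 A12 Rmult_1_r; rewrite A12 in Mle A2; rewrite /de in Mle de0; lra.
  have r2 : 2 <= r by apply: (le_INR 2); lia.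
  have py : p <= y by apply: Rle_Rpower => //; lra.
  have A2 : A ^ 2 / 2 * p <= A ^ 2 / 2 * y by apply: Rmult_le_compat_l => //; have := pow2_ge_0 A; lra.
  have : de <= 1 by rewrite /de; have := pow2_ge_0 PI; lra.
  lra.
have := Rmult_lt_compat_l _ _ _ q0 key; lra.
Qed.
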